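(* Let $\mathcal X,\mathcal Z$ be complex Hilbert spaces, let $E\in L(\mathcal X,\mathcal Z)$ and let $A\colon\mathcal D(A)\subseteq\mathcal X\to\mathcal Z$ be a closed and densely defined linear operator. Assume that $(E,A)$ has a complex resolvent index $p=p_{\mathrm{c,res}}^{(E,A)}$, and let $\mu\in\rho(E,A)$. Then for every $x_0\in\operatorname{ran}\big(((\mu E-A)^{-1}E)^{p+2}\big)$ there exists a unique classical solution $x\colon\mathbb R_{\ge 0}\to\mathcal X$ of $\frac{d}{dt}Ex(t)=Ax(t)$, $t\ge 0$, with initial condition $x(0)=x_0$.
   Context: $L(\mathcal X,\mathcal Z)$ denotes the bounded linear operators from $\mathcal X$ to $\mathcal Z$; $\mathbb N=\{0,1,2,\dots\}$; $\mathbb C_{\mathrm{Re}>\omega}=\{\lambda\in\mathbb C:\operatorname{Re}\lambda>\omega\}$. The resolvent set is $\rho(E,A)=\{\lambda\in\mathbb C : (\lambda E-A)^{-1}\in L(\mathcal Z,\mathcal X)\}$. Complex resolvent index: $p_{\mathrm{c,res}}^{(E,A)}$ is the smallest $p\in\mathbb N$ such that there exist $\omega\in\mathbb R$, $C>0$ with $\mathbb C_{\mathrm{Re}>\omega}\subseteq\rho(E,A)$ and $\|(\lambda E-A)^{-1}\|\le C|\lambda|^{p-1}$ for all $\lambda\in\mathbb C_{\mathrm{Re}>\omega}$. The pair $(E,A)$ ''has a complex resolvent index'' if such a $p$ exists. Classical solution: $x\colon\mathbb R_{\ge0}\to\mathcal X$ is a classical solution of $\frac{d}{dt}Ex(t)=Ax(t)$,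 $t\ge0$, for the initial condition $x_0\in\mathcal X$ if $x(\cdot)$ is continuous on $\mathbb R_{\ge0}$, $Ex(\cdot)$ is continuously differentiable on $\mathbb R_{>0}$, $x(t)\in\mathcal D(A)$ for all $t\ge0$, $x(0)=x_0$, and the equation $\frac{d}{dt}Ex(t)=Ax(t)$ holds for $t\ge 0$ (derivative at $t=0$ understood one-sidedly). *)

(* Defs.v *)
From Stdlib Require Import Reals ZArith.
From Coquelicot Require Import Coquelicot.

Open Scope R_scope.

(* Positive definiteness of [inner] follows from [norm_eq_zero]. *)
Record HilbertSpace := {
  hilbert_module :> CompleteNormedModule C_AbsRing;
  inner : hilbert_module -> hilbert_module -> C;
  inner_plus_l : forall x y z,
    inner (plus x y) z = Cplus (inner x z) (inner y z);
  inner_scal_l : forall (c : C) x y, inner (scal c x) y = Cmult c (inner x y);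
  inner_conj : forall x y, inner y x = Cconj (inner x y);
  inner_norm : forall x, inner x x = RtoC (norm x ^ 2)
}.

Section RestrictScalars.

Variable V : NormedModule C_AbsRing.

Definition rscal (r : R) (v : V) : V := scal (RtoC r) v.

Lemma rscal_assoc (r s : R) (v : V) : rscal r (rscal s v) = rscal (mult r s) v.
Proof.
  unfold rscal. rewrite scal_assoc. apply (f_equal (fun c : C => scal c v)).
  symmetry. exact (RtoC_mult r s).
Qed.

Lemma rscal_one (v : V) : rscal one v = v.
Proof. exact (scal_one v). Qed.

Lemma rscal_distr_l (r : R) (u v : V) :
  rscal r (plus u v) = plus (rscal r u) (rscal r v).
Proof. exact (scal_distr_l (RtoC r) u v). Qed.

Lemma rscal_distr_r (r s : R) (v : V) :
  rscal (plus r s) v = plus (rscal r v) (rscal s v).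
Proof.
  refine (eq_trans _ (scal_distr_r (RtoC r) (RtoC s) v)).
  apply (f_equal (fun c : C => scal c v)). exact (RtoC_plus r s).
Qed.

Lemma norm_rscal (r : R) (v : V) : norm (rscal r v) <= Rabs r * norm v.
Proof.
  unfold rscal. rewrite <- (Cmod_R r). exact (norm_scal (RtoC r : C_AbsRing) v).
Qed.

Definition restrict_ModuleSpace : ModuleSpace R_Ring :=
  ModuleSpace.Pack R_Ring V
    (ModuleSpace.Class R_Ring V (AbelianGroup.class V)
      (ModuleSpace.Mixin R_Ring V rscal
        rscal_assoc rscal_one rscal_distr_l rscal_distr_r)) V.

Definition restrict_NormedModuleAux : NormedModuleAux R_AbsRing :=
  NormedModuleAux.Pack R_AbsRing V
    (NormedModuleAux.Class R_AbsRing V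
      (ModuleSpace.class R_Ring restrict_ModuleSpace)
      (UniformSpace.class V)) V.

(* The real normed space underlying [V]: Coquelicot's [is_derive], for
   functions of a real variable, needs values in a module over [R]. *)
Definition restrict_scalars : NormedModule R_AbsRing :=
  NormedModule.Pack R_AbsRing V
    (NormedModule.Class R_AbsRing V
      (NormedModuleAux.class R_AbsRing restrict_NormedModuleAux)
      (NormedModule.Mixin R_AbsRing restrict_NormedModuleAux
        (norm : V -> R) (@norm_factor C_AbsRing V)
        (@norm_triangle C_AbsRing V) norm_rscal
        (@norm_compat1 C_AbsRing V) (@norm_compat2 C_AbsRing V)
        (@norm_eq_zero C_AbsRing V))) V.

End RestrictScalars.

(* A possibly unbounded linear operator defined on the subspace [dom]; the
   values of [op] outside [dom] carry no meaning. *)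
Record linear_operator (X Z : NormedModule C_AbsRing) := {
  dom : X -> Prop;
  op :> X -> Z;
  dom_zero : dom zero;
  dom_plus : forall x y, dom x -> dom y -> dom (plus x y);
  dom_scal : forall (c : C) x, dom x -> dom (scal c x);
  op_plus : forall x y, dom x -> dom y -> op (plus x y) = plus (op x) (op y);
  op_scal : forall (c : C) x, dom x -> op (scal c x) = scal c (op x)
}.

Arguments dom {X Z} _ _.
Arguments op {X Z} _ _.

Definition closed_operator {X Z : NormedModule C_AbsRing}
    (A : linear_operator X Z) : Prop :=
  closed (fun xz : X * Z => dom A (fst xz) /\ snd xz = A (fst xz)).

Definition densely_defined {X Z : NormedModule C_AbsRing}
    (A : linear_operator X Z) : Prop :=
  forall (x : X) (eps : posreal), exists y : X, ball x eps y /\ dom A y.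

Section Pencil.

Context {X Z : NormedModule C_AbsRing}.
Variables (E : X -> Z) (A : linear_operator X Z).

Definition pencil (lam : C) (x : X) : Z := minus (scal lam (E x)) (A x).

(* [T] is the inverse of [lam E - A : dom A -> Z], and it is bounded. *)
Definition is_resolvent (lam : C) (T : Z -> X) : Prop :=
  is_linear T /\
  (forall z : Z, dom A (T z) /\ pencil lam (T z) = z) /\
  (forall x : X, dom A x -> T (pencil lam x) = x).

Definition resolvent_set (lam : C) : Prop :=
  exists T : Z -> X, is_resolvent lam T.

End Pencil.

Definition operator_norm {U V : NormedModule C_AbsRing} (T : U -> V) : Rbar :=
  Lub_Rbar (fun r : R => exists u : U, norm u <= 1 /\ r = norm (T u)).

(* For [p = 0] the exponent is [-1]. The value of [powerRZ] at [lam = 0] has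
   no influence on the index, since [omega] may always be increased. *)
Definition complex_resolvent_growth {X Z : NormedModule C_AbsRing}
    (E : X -> Z) (A : linear_operator X Z) (p : nat) : Prop :=
  exists omega K : R, 0 < K /\
    (forall lam : C, omega < Re lam -> resolvent_set E A lam) /\
    (forall (lam : C) (T : Z -> X),
      omega < Re lam -> is_resolvent E A lam T ->
      Rbar_le (operator_norm T) (K * powerRZ (Cmod lam) (Z.of_nat p - 1))).

Definition is_complex_resolvent_index {X Z : NormedModule C_AbsRing}
    (E : X -> Z) (A : linear_operator X Z) (p : nat) : Prop :=
  complex_resolvent_growth E A p /\
  forall q : nat, complex_resolvent_growth E A q -> (p <= q)%nat.

(* A function on the nonnegative reals is represented by a function on [R],
   of which only the values at nonnegative arguments matter: they are the only
   ones that enter the conditions below. *)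
Definition is_classical_solution {X Z : NormedModule C_AbsRing}
    (E : X -> Z) (A : linear_operator X Z) (x0 : X) (x : R -> X) : Prop :=
  continuous_on (fun t : R => 0 <= t) x /\
  (forall t : R, 0 <= t -> dom A (x t)) /\
  x 0 = x0 /\
  exists dEx : R -> Z,
    (forall t : R, 0 < t ->
      is_derive (V := restrict_scalars Z) (fun s : R => E (x s)) t (dEx t)) /\
    continuous_on (fun t : R => 0 < t) dEx /\
    filterdiff (V := restrict_scalars Z) (fun s : R => E (x s))
      (within (fun s : R => 0 <= s) (locally 0))
      (fun h : R => scal h (dEx 0 : restrict_scalars Z)) /\
    (forall t : R, 0 <= t -> dEx t = A (x t)).

(* Main.v *)
Require Import Defs.
From Stdlib Require Import Reals Factorial Lra Lia Psatz List ClassicalEpsilon.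
From Coquelicot Require Import Coquelicot.

(* With [R = (mu E - A)^-1 E] and [x t = exp (mu t) u t], the equation becomes
   [R u' = - u], [u 0 = R^k v], [k = p + 2]. The operators
   [S z = ((mu + z) E - A)^-1 E] satisfy [z R S z = R - S z] and grow at most like
   [|z|^(p - 1)], so the inverse Laplace transform [f t] of [S z v / z^k], taken
   along a vertical line, converges absolutely together with its derivative. It
   satisfies [f 0 = 0] (move the line to infinity) and
   [R f' + f = kappa t^(k - 1) / (k - 1)! R v] for [t >= 0]. A polynomial in [t] with
   values in the span of the [R^j v] solves the same inhomogeneous equation up to
   [kappa] with initial value [+- R^k v]; subtracting [f / kappa] gives [u].
   The value of [kappa], that is [2 pi], is irrelevant: only [kappa <> 0] matters.
   For uniqueness, let [G t v] be the solution just constructed and let [u] solve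
   [(R u)' = - u], [u 0 = 0]. Then [G (t - s) (R u s)] does not depend on [s], so
   [R^(k + 1) u t = 0], and differentiating [k + 1] times yields [u = 0]. *)

Open Scope R_scope.

(** * Normalisation of linear combinations *)

(** Formally [S z] is [(z + R^-1)^-1], the Laplace transform of [exp (- t R^-1)]; but [R] need not
    be injective, and the growth bound does not provide a semigroup of bounded operators. Division
    by [z^k] replaces the missing semigroup by its [k]-fold integral, which is [f] up to [kappa].
    Integrating [exp (- t R^-1)] once gives [R - R exp (- t R^-1)], so the [k]-fold integral is
    [(- R)^k exp (- t R^-1)] plus a polynomial in [t]: this is the origin of the polynomial, of the
    sign, and of initial values in the range of [R^k]. The factor [exp (mu t)] trades the unbounded
    pencil for the single bounded operator [R] on [X]. Uniqueness cannot be read off a Laplace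
    transform, because an arbitrary solution comes without a growth bound; the family [G] serves as
    a propagator instead. Scalar transforms are found from differential equations in [t], and the
    line is moved by differentiating in its abscissa, so that neither residues nor contour integrals
    appear. *)

Inductive vexpr :=
  | VZero
  | VAtom (n : nat)
  | VPlus (a b : vexpr)
  | VOpp (a : vexpr)
  | VScal (c : C) (a : vexpr).

Fixpoint vcoef (e : vexpr) (n : nat) : C :=
  match e with
  | VZero => 0
  | VAtom m => if Nat.eqb m n then 1 else 0
  | VPlus a b => vcoef a n + vcoef b n
  | VOpp a => - vcoef a n
  | VScal c a => c * vcoef a n
  end%C.

(** A finite conjunction that computes to one scalar equation per atom. Indices beyond the
    environment need no equation, since such atoms denote [zero]. *)
Fixpoint vcoef_eq (e1 e2 : vexpr) (i n : nat) : Prop :=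
  match n with
  | O => True
  | S m => vcoef e1 i = vcoef e2 i /\ vcoef_eq e1 e2 (S i) m
  end.

Section LinearCombinations.

Context {W : NormedModule C_AbsRing}.

Fixpoint vden (env : list W) (e : vexpr) : W :=
  match e with
  | VZero => zero
  | VAtom n => nth n env zero
  | VPlus a b => plus (vden env a) (vden env b)
  | VOpp a => opp (vden env a)
  | VScal c a => scal c (vden env a)
  end.

Fixpoint lincomb (env : list W) (k : nat -> C) : W :=
  match env with
  | nil => zero
  | x :: r => plus (scal (k O) x) (lincomb r (fun n => k (S n)))
  end.

Lemma lincomb_ext env : forall k1 k2, (forall n, k1 n = k2 n) ->
  lincomb env k1 = lincomb env k2.
Proof.
  induction env as [|x r IH]; intros k1 k2 H; simpl; [reflexivity|].
  rewrite H. f_equal. apply IH. intro n. apply H.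
Qed.

Lemma lincomb_zero env : lincomb env (fun _ => RtoC 0) = zero.
Proof.
  induction env as [|x r IH]; simpl; [reflexivity|].
  rewrite IH, plus_zero_r. exact (scal_zero_l (K := C_Ring) x).
Qed.

Lemma lincomb_plus env : forall k1 k2,
  lincomb env (fun n => Cplus (k1 n) (k2 n)) = plus (lincomb env k1) (lincomb env k2).
Proof.
  induction env as [|x r IH]; intros k1 k2; simpl.
  - rewrite plus_zero_r. reflexivity.
  - rewrite IH, (scal_distr_r (K := C_Ring) (k1 O) (k2 O) x
      : scal (Cplus (k1 O) (k2 O)) x = plus (scal (k1 O) x) (scal (k2 O) x)).
    rewrite <- !plus_assoc. f_equal. rewrite !plus_assoc. f_equal. apply plus_comm.
Qed.

Lemma lincomb_scal env c : forall k,
  lincomb env (fun n => Cmult c (k n)) = scal c (lincomb env k).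
Proof.
  induction env as [|x r IH]; intros k; simpl.
  - symmetry. exact (@scal_zero_r C_Ring (NormedModule.ModuleSpace C_AbsRing W) c).
  - rewrite IH. etransitivity; [|symmetry; exact (@scal_distr_l C_Ring (NormedModule.ModuleSpace C_AbsRing W) c _ _)]. f_equal.
    symmetry. exact (scal_assoc (K := C_Ring) c (k O) x).
Qed.

Lemma lincomb_atom env : forall m,
  lincomb env (fun n => if Nat.eqb m n then RtoC 1 else RtoC 0) = nth m env zero.
Proof.
  induction env as [|x r IH]; intros [|m]; simpl; try reflexivity.
  - rewrite lincomb_zero, plus_zero_r. exact (scal_one (K := C_Ring) x).
  - rewrite IH, (scal_zero_l (K := C_Ring) x : scal (RtoC 0) x = zero). apply plus_zero_l.
Qed.

Lemma vden_lincomb env e : vden env e = lincomb env (vcoef e).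
Proof.
  induction e as [|n|a IHa b IHb|a IHa|c a IHa]; cbn [vden].
  - symmetry. apply lincomb_zero.
  - symmetry. apply lincomb_atom.
  - rewrite IHa, IHb. symmetry. apply lincomb_plus.
  - rewrite IHa.
    transitivity (scal (Copp 1) (lincomb env (vcoef a))).
    { symmetry. exact (@scal_opp_one C_Ring (NormedModule.ModuleSpace C_AbsRing W) _). }
    rewrite <- lincomb_scal. apply lincomb_ext. intro n. simpl. ring.
  - rewrite IHa. symmetry. apply lincomb_scal.
Qed.

Lemma vcoef_eq_sound env e1 e2 :
  vcoef_eq e1 e2 0 (length env) -> vden env e1 = vden env e2.
Proof.
  intro H. rewrite !vden_lincomb.
  (* [vcoef_eq] counts upwards while the list loses its head, so the induction runs over a tail with
     offset [i]. *)
  assert (G : forall (l : list W) i, vcoef_eq e1 e2 i (length l) ->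
    lincomb l (fun n => vcoef e1 (i + n)) = lincomb l (fun n => vcoef e2 (i + n))).
  { intro l. induction l as [|x r IH]; intros i Hi; simpl; [reflexivity|].
    destruct Hi as [Hi Hr]. rewrite Nat.add_0_r, Hi. f_equal.
    specialize (IH (S i) Hr).
    etransitivity; [|etransitivity; [exact IH|]]; apply lincomb_ext; intro n;
      f_equal; lia. }
  exact (G env 0%nat H).
Qed.

End LinearCombinations.

Ltac vfind x env :=
  match env with
  | cons x _ => constr:(O)
  | cons _ ?r => let n := vfind x r in constr:(S n)
  end.

Ltac vatoms t env :=
  match t with
  | @plus _ ?a ?b => let e := vatoms a env in vatoms b e
  | @minus _ ?a ?b => let e := vatoms a env in vatoms b e
  | @opp _ ?a => vatoms a env
  | @zero _ => env
  | @scal _ _ _ ?a => vatoms a env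
  | ?x => match env with
          | context [cons x _] => env
          | _ => constr:(cons x env)
          end
  end.

Ltac vquote t env :=
  match t with
  | @plus _ ?a ?b =>
      let p := vquote a env in let q := vquote b env in constr:(VPlus p q)
  | @minus _ ?a ?b =>
      let p := vquote a env in let q := vquote b env in constr:(VPlus p (VOpp q))
  | @opp _ ?a => let p := vquote a env in constr:(VOpp p)
  | @zero _ => constr:(VZero)
  | @scal _ _ ?c ?a =>
      let p := vquote a env in
      (* the scalar is complex, or real by restriction of scalars *)
      match goal with
      | _ => constr:(VScal (c : C) p)
      | _ => constr:(VScal (RtoC (c : R)) p)
      end
  | ?x => let n := vfind x env in constr:(VAtom n)
  end.

(* Reduces an equality of linear combinations in [W] to the equalities of the
   coefficients of the atoms. *)
Ltac vcoefs W :=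
  match goal with
  | |- @eq _ ?a ?b =>
      let env := vatoms a constr:(@nil W) in
      let env := vatoms b env in
      let ea := vquote a env in
      let eb := vquote b env in
      change (@vden W env ea = @vden W env eb);
      apply vcoef_eq_sound;
      cbv [vcoef_eq vcoef Nat.eqb length];
      repeat split
  end.

Ltac vring W := vcoefs W; rewrite ?RtoC_plus, ?RtoC_minus, ?RtoC_opp, ?RtoC_mult; ring.

(** * Functions of a real variable with values in a complex space *)

(** Riemann integrals take values in a complete space over the reals. Carrier, uniform structure and
    norm are unchanged, so statements pass between [W] and [realify W] by conversion. *)
Definition realify (W : CompleteNormedModule C_AbsRing) : CompleteNormedModule R_AbsRing :=
  CompleteNormedModule.Pack R_AbsRing W
    (CompleteNormedModule.Class R_AbsRing W
      (NormedModule.class R_AbsRing (restrict_scalars W))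
      (CompleteNormedModule.mixin C_AbsRing W
        (CompleteNormedModule.class C_AbsRing W))) W.

Notation CC := C_CompleteNormedModule.

Section Norm.

Context {W : CompleteNormedModule C_AbsRing}.
Implicit Types x y z : W.

Lemma vnorm_zero : norm (@zero W) = 0.
Proof. exact (@norm_zero C_AbsRing W). Qed.

Lemma vnorm_ge_0 x : 0 <= norm x.
Proof. exact (@norm_ge_0 C_AbsRing W x). Qed.

Lemma vnorm_eq_0 x : norm x = 0 -> x = zero.
Proof. exact (@norm_eq_zero C_AbsRing W x). Qed.

Lemma vnorm_opp x : norm (opp x) = norm x.
Proof. exact (@norm_opp C_AbsRing W x). Qed.

Lemma vnorm_triangle x y : norm (plus x y) <= norm x + norm y.
Proof. exact (@norm_triangle C_AbsRing W x y). Qed.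

Lemma vnorm_triangle_minus x y : norm (minus x y) <= norm x + norm y.
Proof. rewrite <- (vnorm_opp y). apply vnorm_triangle. Qed.

Lemma vnorm_minus_sym x y : norm (minus x y) = norm (minus y x).
Proof. rewrite <- vnorm_opp. f_equal. vring W. Qed.

(** The axiom [norm_scal] is one inequality; the other is the same axiom for the scalar [/ c] and
    the vector [scal c x]. *)
Lemma vnorm_scal (c : C) x : norm (scal c x) = Cmod c * norm x.
Proof.
  destruct (Ceq_dec c 0) as [->|Hc].
  - transitivity (norm (@zero W)); [f_equal; vring W|].
    rewrite vnorm_zero, Cmod_0. ring.
  - apply Rle_antisym; [exact (@norm_scal C_AbsRing W c x)|].
    assert (Hm : 0 < Cmod c) by (apply Cmod_gt_0; exact Hc).
    apply Rmult_le_reg_l with (/ Cmod c); [apply Rinv_0_lt_compat; exact Hm|].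
    rewrite <- Rmult_assoc, Rinv_l, Rmult_1_l, <- Cmod_inv by (lra || exact Hc).
    eapply Rle_trans; [|exact (@norm_scal C_AbsRing W (/ c)%C (scal c x))].
    apply Req_le. f_equal. vcoefs W. field. exact Hc.
Qed.

Lemma minus_zero_eq x y : minus x y = zero -> x = y.
Proof.
  intro H. transitivity (plus y (minus x y)); [vring W|]. rewrite H. vring W.
Qed.

Lemma opp_zero_eq x : opp x = zero -> x = zero.
Proof.
  intro H. transitivity (opp (opp x)); [vring W|]. rewrite H. vring W.
Qed.

Lemma vnorm_small x : (forall eps, 0 < eps -> norm x <= eps) -> x = zero.
Proof.
  intro H. apply vnorm_eq_0. apply Rle_antisym; [|apply vnorm_ge_0].
  apply le_epsilon. intros eps He. rewrite Rplus_0_l. exact (H eps He).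
Qed.

End Norm.

(** * Bounded linear maps *)

Section Linear.

Context {W W' : CompleteNormedModule C_AbsRing} (T : W -> W').
Hypothesis HT : is_linear T.

Lemma lin_plus x y : T (plus x y) = plus (T x) (T y).
Proof. exact (linear_plus T HT x y). Qed.

Lemma lin_scal (c : C) x : T (scal c x) = scal c (T x).
Proof. exact (linear_scal T HT c x). Qed.

Lemma lin_zero : T zero = zero.
Proof.
  transitivity (T (scal (RtoC 0) zero)); [f_equal; vring W|].
  rewrite lin_scal. vring W'.
Qed.

Lemma lin_opp x : T (opp x) = opp (T x).
Proof.
  transitivity (T (scal (RtoC (-1)) x)); [f_equal; vring W|].
  rewrite lin_scal. vring W'.
Qed.

Lemma lin_minus x y : T (minus x y) = minus (T x) (T y).
Proof. unfold minus. rewrite lin_plus, lin_opp. reflexivity. Qed.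

Lemma lin_bound : exists M, 0 < M /\ forall x, norm (T x) <= M * norm x.
Proof. exact (linear_norm T HT). Qed.

End Linear.

(** * Continuity and differentiability in terms of increments *)

Section Calculus.

Context {W : CompleteNormedModule C_AbsRing}.
Implicit Types g : R -> W.

Definition cont_at g (t : R) : Prop :=
  forall eps, 0 < eps -> exists del, 0 < del /\
    forall h, Rabs h < del -> norm (minus (g (t + h)) (g t)) <= eps.

(** The bound is nonstrict because both sides vanish at [h = 0]. Equivalence with [is_derive] is
    [deriv_at_is_derive]. *)
Definition deriv_at g (t : R) (l : W) : Prop :=
  forall eps, 0 < eps -> exists del, 0 < del /\
    forall h, Rabs h < del ->
      norm (minus (minus (g (t + h)) (g t)) (scal (RtoC h) l)) <= eps * Rabs h.

Definition cont g : Prop := forall t, cont_at g t.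

Lemma cont_at_continuous g t : cont_at g t <-> continuous g t.
Proof.
  unfold continuous. split; intro H.
  - apply (proj2 (@filterlim_locally_ball_norm C_AbsRing R W (locally t) _ g (g t))).
    intro eps. destruct (H (eps / 2)) as [del [Hd Hg]]; [generalize (cond_pos eps); lra|].
    exists (mkposreal del Hd). intros s Hs. unfold ball_norm.
    rewrite <- (Rplus_minus t s).
    eapply Rle_lt_trans; [apply Hg; exact Hs|]. generalize (cond_pos eps). lra.
  - intros eps He.
    destruct (proj1 (@filterlim_locally_ball_norm C_AbsRing R W (locally t) _ g (g t)) H
      (mkposreal eps He)) as [del Hd].
    exists del. split; [apply cond_pos|]. intros h Hh. apply Rlt_le. apply Hd.
    change (Rabs (t + h - t) < del). rewrite Rplus_minus_l. exact Hh.
Qed.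

Lemma deriv_at_is_derive g t l :
  deriv_at g t l <-> is_derive (V := restrict_scalars W) g t l.
Proof.
  split.
  - intro H. split.
    + exact (@is_linear_scal_l R_AbsRing (restrict_scalars W) l).
    + intros x Hx. replace x with t
        by exact (@is_filter_lim_locally_unique R_AbsRing R_NormedModule _ _ Hx).
      intro eps. destruct (H eps (cond_pos eps)) as [del [Hd Hg]].
      exists (mkposreal del Hd). intros s Hs.
      specialize (Hg (s - t) Hs). rewrite Rplus_minus in Hg.
      exact Hg.
  - intros [_ H] eps He.
    destruct (H t (fun P HP => HP) (mkposreal eps He)) as [del Hd].
    exists del. split; [apply cond_pos|]. intros h Hh.
    assert (Hb : ball t del (t + h)).
    { change (Rabs (t + h - t) < del). rewrite Rplus_minus_l. exact Hh. }
    specialize (Hd (t + h) Hb).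
    change (norm (minus (minus (g (t + h)) (g t)) (scal (RtoC (t + h - t)) l))
      <= eps * Rabs (t + h - t)) in Hd.
    rewrite Rplus_minus_l in Hd. exact Hd.
Qed.

Lemma deriv_cont_at g t l : deriv_at g t l -> cont_at g t.
Proof.
  intros H eps He. destruct (H 1 Rlt_0_1) as [del [Hd Hg]].
  assert (Hp : 0 < 1 + norm l) by (generalize (vnorm_ge_0 l); lra).
  exists (Rmin del (eps / (1 + norm l))). split.
  { apply Rmin_glb_lt; [exact Hd|]. apply Rdiv_lt_0_compat; assumption. }
  intros h Hh.
  assert (H1 := Rlt_le_trans _ _ _ Hh (Rmin_l _ _)).
  assert (H2 := Rlt_le_trans _ _ _ Hh (Rmin_r _ _)).
  specialize (Hg h H1).
  replace (minus (g (t + h)) (g t)) with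
    (plus (minus (minus (g (t + h)) (g t)) (scal (RtoC h) l)) (scal (RtoC h) l))
    by (vring W).
  eapply Rle_trans; [apply vnorm_triangle|]. rewrite vnorm_scal, Cmod_R.
  apply Rlt_le in H2. apply (Rmult_le_compat_r (1 + norm l)) in H2; [|lra].
  unfold Rdiv in H2. rewrite Rmult_assoc, Rinv_l in H2 by lra. lra.
Qed.

Lemma cont_ext g1 g2 : (forall t, g1 t = g2 t) -> cont g1 -> cont g2.
Proof.
  intros H Hc t eps He. destruct (Hc t eps He) as [del [Hd Hg]].
  exists del. split; [exact Hd|]. intros h Hh. rewrite <- !H. apply Hg. exact Hh.
Qed.

Lemma deriv_ext g1 g2 t l : (forall t, g1 t = g2 t) -> deriv_at g1 t l -> deriv_at g2 t l.
Proof.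
  intros H Hc eps He. destruct (Hc eps He) as [del [Hd Hg]].
  exists del. split; [exact Hd|]. intros h Hh. rewrite <- !H. apply Hg. exact Hh.
Qed.

Lemma cont_const (w : W) : cont (fun _ => w).
Proof.
  intros t eps He. exists 1. split; [lra|]. intros h _.
  replace (minus w w) with (@zero W) by (vring W). rewrite vnorm_zero. lra.
Qed.

Lemma deriv_const (w : W) t : deriv_at (fun _ => w) t zero.
Proof.
  intros eps He. exists 1. split; [lra|]. intros h _.
  replace (minus _ _) with (@zero W) by (vring W).
  rewrite vnorm_zero. apply Rmult_le_pos; [lra|apply Rabs_pos].
Qed.

Lemma cont_at_plus g1 g2 t : cont_at g1 t -> cont_at g2 t ->
  cont_at (fun s => plus (g1 s) (g2 s)) t.
Proof.
  intros H1 H2 eps He.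
  destruct (H1 (eps / 2)) as [d1 [Hd1 Hg1]]; [lra|].
  destruct (H2 (eps / 2)) as [d2 [Hd2 Hg2]]; [lra|].
  exists (Rmin d1 d2). split; [apply Rmin_glb_lt; assumption|]. intros h Hh.
  specialize (Hg1 h (Rlt_le_trans _ _ _ Hh (Rmin_l _ _))).
  specialize (Hg2 h (Rlt_le_trans _ _ _ Hh (Rmin_r _ _))).
  replace (minus (plus (g1 (t + h)) (g2 (t + h))) (plus (g1 t) (g2 t))) with
    (plus (minus (g1 (t + h)) (g1 t)) (minus (g2 (t + h)) (g2 t))) by (vring W).
  eapply Rle_trans; [apply vnorm_triangle|]. lra.
Qed.

Lemma cont_at_opp g t : cont_at g t -> cont_at (fun s => opp (g s)) t.
Proof.
  intros H eps He. destruct (H eps He) as [d [Hd Hg]].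
  exists d. split; [exact Hd|]. intros h Hh.
  eapply Rle_trans; [|exact (Hg h Hh)]. apply Req_le. rewrite <- vnorm_opp.
  f_equal. vring W.
Qed.

Lemma deriv_plus g1 g2 t l1 l2 : deriv_at g1 t l1 -> deriv_at g2 t l2 ->
  deriv_at (fun s => plus (g1 s) (g2 s)) t (plus l1 l2).
Proof.
  intros H1 H2 eps He.
  destruct (H1 (eps / 2)) as [d1 [Hd1 Hg1]]; [lra|].
  destruct (H2 (eps / 2)) as [d2 [Hd2 Hg2]]; [lra|].
  exists (Rmin d1 d2). split; [apply Rmin_glb_lt; assumption|]. intros h Hh.
  specialize (Hg1 h (Rlt_le_trans _ _ _ Hh (Rmin_l _ _))).
  specialize (Hg2 h (Rlt_le_trans _ _ _ Hh (Rmin_r _ _))).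
  replace (minus _ _) with
    (plus (minus (minus (g1 (t + h)) (g1 t)) (scal (RtoC h) l1))
       (minus (minus (g2 (t + h)) (g2 t)) (scal (RtoC h) l2))) by (vring W).
  eapply Rle_trans; [apply vnorm_triangle|]. lra.
Qed.

Lemma deriv_comp_sub g a t l : deriv_at g (a - t) l ->
  deriv_at (fun s => g (a - s)) t (opp l).
Proof.
  intros H eps He. destruct (H eps He) as [d [Hd Hg]].
  exists d. split; [exact Hd|]. intros h Hh. rewrite <- Rabs_Ropp in Hh.
  specialize (Hg (- h) Hh). rewrite Rabs_Ropp in Hg.
  replace (a - (t + h)) with (a - t + - h) by ring.
  eapply Rle_trans; [|exact Hg]. apply Req_le. f_equal. vring W.
Qed.

Lemma cont_at_comp_sub g a t : cont_at g (a - t) -> cont_at (fun s => g (a - s)) t.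
Proof.
  intros H eps He. destruct (H eps He) as [d [Hd Hg]].
  exists d. split; [exact Hd|]. intros h Hh. rewrite <- Rabs_Ropp in Hh.
  replace (a - (t + h)) with (a - t + - h) by ring. exact (Hg (- h) Hh).
Qed.

End Calculus.

Section LinearCalculus.

Context {W W' : CompleteNormedModule C_AbsRing} (T : W -> W').
Hypothesis HT : is_linear T.

Lemma cont_at_lin g t : cont_at g t -> cont_at (fun s => T (g s)) t.
Proof.
  intros H eps He. destruct (lin_bound T HT) as [M [HM HB]].
  destruct (H (eps / M)) as [d [Hd Hg]]; [apply Rdiv_lt_0_compat; assumption|].
  exists d. split; [exact Hd|]. intros h Hh. rewrite <- lin_minus by exact HT.
  eapply Rle_trans; [apply HB|].
  replace eps with (M * (eps / M)) by (field; lra).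
  apply Rmult_le_compat_l; [lra|]. apply Hg. exact Hh.
Qed.

Lemma deriv_lin g t l : deriv_at g t l -> deriv_at (fun s => T (g s)) t (T l).
Proof.
  intros H eps He. destruct (lin_bound T HT) as [M [HM HB]].
  destruct (H (eps / M)) as [d [Hd Hg]]; [apply Rdiv_lt_0_compat; assumption|].
  exists d. split; [exact Hd|]. intros h Hh.
  rewrite <- lin_scal, <- !lin_minus by exact HT.
  eapply Rle_trans; [apply HB|].
  replace (eps * Rabs h) with (M * (eps / M * Rabs h)) by (field; lra).
  apply Rmult_le_compat_l; [lra|]. apply Hg. exact Hh.
Qed.

End LinearCalculus.

Lemma deriv_opp {W : CompleteNormedModule C_AbsRing} (g : R -> W) t l :
  deriv_at g t l -> deriv_at (fun s => opp (g s)) t (opp l).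
Proof.
  intros H eps He. destruct (H eps He) as [d [Hd Hg]].
  exists d. split; [exact Hd|]. intros h Hh.
  eapply Rle_trans; [|exact (Hg h Hh)]. apply Req_le. rewrite <- vnorm_opp.
  f_equal. vring W.
Qed.

(** * Product rule *)

Section Product.

Context {W W' : CompleteNormedModule C_AbsRing}.
Variables (M : R -> W -> W') (y : R -> W) (t : R).
Hypothesis M_minus : forall s u v, M s (minus u v) = minus (M s u) (M s v).
Hypothesis M_scal : forall s (r : R) u, M s (scal (RtoC r) u) = scal (RtoC r) (M s u).
Hypothesis M_bound : exists B del, 0 < B /\ 0 < del /\
  forall h u, Rabs h < del -> norm (M (t + h) u) <= B * norm u.

Lemma cont_at_product : cont_at (fun s => M s (y t)) t -> cont_at y t ->
  cont_at (fun s => M s (y s)) t.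
Proof.
  intros HM Hy eps He. destruct M_bound as [B [d0 [HB [Hd0 HBM]]]].
  destruct (HM (eps / 2)) as [d1 [Hd1 H1]]; [lra|].
  destruct (Hy (eps / 2 / B)) as [d2 [Hd2 H2]]; [apply Rdiv_lt_0_compat; lra|].
  exists (Rmin d0 (Rmin d1 d2)). split; [repeat apply Rmin_glb_lt; assumption|].
  intros h Hh.
  assert (Ha := Rlt_le_trans _ _ _ Hh (Rmin_l _ _)).
  assert (Hb := Rlt_le_trans _ _ _ Hh (Rmin_r _ _)).
  specialize (H1 h (Rlt_le_trans _ _ _ Hb (Rmin_l _ _))).
  specialize (H2 h (Rlt_le_trans _ _ _ Hb (Rmin_r _ _))).
  replace (minus _ _) with
    (plus (M (t + h) (minus (y (t + h)) (y t))) (minus (M (t + h) (y t)) (M t (y t))))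
    by (rewrite M_minus; vring W').
  eapply Rle_trans; [apply vnorm_triangle|].
  assert (H3 := HBM h (minus (y (t + h)) (y t)) Ha).
  apply (Rmult_le_compat_l B) in H2; [|lra].
  replace (B * (eps / 2 / B)) with (eps / 2) in H2 by (field; lra). lra.
Qed.

Lemma deriv_product l y' : deriv_at (fun s => M s (y t)) t l ->
  cont_at (fun s => M s y') t -> deriv_at y t y' ->
  deriv_at (fun s => M s (y s)) t (plus l (M t y')).
Proof.
  intros HM Hc Hy eps He. destruct M_bound as [B [d0 [HB [Hd0 HBM]]]].
  destruct (HM (eps / 3)) as [d1 [Hd1 H1]]; [lra|].
  destruct (Hy (eps / 3 / B)) as [d2 [Hd2 H2]]; [apply Rdiv_lt_0_compat; lra|].
  destruct (Hc (eps / 3)) as [d3 [Hd3 H3]]; [lra|].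
  exists (Rmin d0 (Rmin d1 (Rmin d2 d3))). split; [repeat apply Rmin_glb_lt; assumption|].
  intros h Hh.
  assert (Ha := Rlt_le_trans _ _ _ Hh (Rmin_l _ _)).
  assert (Hb := Rlt_le_trans _ _ _ Hh (Rmin_r _ _)).
  assert (Hb' := Rlt_le_trans _ _ _ Hb (Rmin_r _ _)).
  specialize (H1 h (Rlt_le_trans _ _ _ Hb (Rmin_l _ _))).
  specialize (H2 h (Rlt_le_trans _ _ _ Hb' (Rmin_l _ _))).
  specialize (H3 h (Rlt_le_trans _ _ _ Hb' (Rmin_r _ _))).
  replace (minus _ _) with
    (plus (M (t + h) (minus (minus (y (t + h)) (y t)) (scal (RtoC h) y')))
      (plus (minus (minus (M (t + h) (y t)) (M t (y t))) (scal (RtoC h) l))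
        (scal (RtoC h) (minus (M (t + h) y') (M t y')))))
    by (rewrite !M_minus, M_scal; vring W').
  eapply Rle_trans; [apply vnorm_triangle|].
  eapply Rle_trans; [apply Rplus_le_compat_l, vnorm_triangle|].
  rewrite vnorm_scal, Cmod_R.
  assert (H4 := HBM h (minus (minus (y (t + h)) (y t)) (scal (RtoC h) y')) Ha).
  apply (Rmult_le_compat_l B) in H2; [|lra].
  replace (B * (eps / 3 / B * Rabs h)) with (eps / 3 * Rabs h) in H2 by (field; lra).
  assert (H5 := Rmult_le_compat_l (Rabs h) _ _ (Rabs_pos h) H3). lra.
Qed.

End Product.

Lemma is_linear_scal_atom {W : CompleteNormedModule C_AbsRing} (w : W) :
  is_linear (U := CC) (V := W) (fun c : C => scal c w).
Proof.
  split.
  - intros a b. change (scal (Cplus a b) w = plus (scal a w) (scal b w)). vring W.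
  - intros a b. change (scal (Cmult a b) w = scal a (scal b w)). vring W.
  - exists (norm w + 1). split; [generalize (vnorm_ge_0 w); lra|]. intro c.
    rewrite vnorm_scal. change (norm (c : CC)) with (Cmod c).
    generalize (Cmod_ge_0 c) (vnorm_ge_0 w). nra.
Qed.

Section ScalProduct.

Context {W : CompleteNormedModule C_AbsRing}.

Lemma scal_bound (m : R -> CC) t : cont_at m t ->
  exists B del, 0 < B /\ 0 < del /\
    forall h (u : W), Rabs h < del -> norm (scal (m (t + h) : C) u) <= B * norm u.
Proof.
  intro Hm. destruct (Hm 1 Rlt_0_1) as [d [Hd H]].
  exists (1 + Cmod (m t)), d.
  split; [generalize (Cmod_ge_0 (m t)); lra|]. split; [exact Hd|].
  intros h u Hh. rewrite vnorm_scal. apply Rmult_le_compat_r; [apply vnorm_ge_0|].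
  specialize (H h Hh). change (Cmod (Cminus (m (t + h)) (m t)) <= 1) in H.
  replace (m (t + h)) with (Cplus (Cminus (m (t + h)) (m t)) (m t)) by ring.
  eapply Rle_trans; [apply Cmod_triangle|]. lra.
Qed.

Lemma cont_at_scal (m : R -> CC) (y : R -> W) t :
  cont_at m t -> cont_at y t -> cont_at (fun s => scal (m s : C) (y s)) t.
Proof.
  intros Hm Hy.
  apply (cont_at_product (fun s u => scal (m s : C) u)).
  - intros. vring W.
  - apply scal_bound. exact Hm.
  - exact (cont_at_lin _ (is_linear_scal_atom (y t)) m t Hm).
  - exact Hy.
Qed.

Lemma deriv_scal (m : R -> CC) (y : R -> W) t (m' : C) y' :
  deriv_at m t (m' : CC) -> deriv_at y t y' ->
  deriv_at (fun s => scal (m s : C) (y s)) t (plus (scal m' (y t)) (scal (m t : C) y')).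
Proof.
  intros Hm Hy.
  apply (deriv_product (fun s u => scal (m s : C) u)).
  - intros. vring W.
  - intros. vring W.
  - apply scal_bound. exact (deriv_cont_at _ _ _ Hm).
  - exact (deriv_lin _ (is_linear_scal_atom (y t)) m t m' Hm).
  - exact (cont_at_lin _ (is_linear_scal_atom y') m t (deriv_cont_at _ _ _ Hm)).
  - exact Hy.
Qed.

End ScalProduct.

(** * Integrals *)

Section Integral.

Context {W : CompleteNormedModule C_AbsRing}.
Implicit Types g : R -> W.

Definition int g (a b : R) : W := RInt (V := realify W) g a b.

Definition integral g (a b : R) (l : W) : Prop := is_RInt (V := realify W) g a b l.

Lemma int_correct g a b : cont g -> integral g a b (int g a b).
Proof.
  intro H. apply (RInt_correct (V := realify W)).
  apply (ex_RInt_continuous (V := realify W)). intros z _.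
  exact (proj1 (cont_at_continuous g z) (H z)).
Qed.

Lemma int_unique g a b l : integral g a b l -> int g a b = l.
Proof. exact (is_RInt_unique (V := realify W) g a b l). Qed.

Lemma int_ext g1 g2 a b : (forall t, g1 t = g2 t) -> int g1 a b = int g2 a b.
Proof. intro H. apply (RInt_ext (V := realify W)). intros t _. apply H. Qed.

Lemma int_plus g1 g2 a b : cont g1 -> cont g2 ->
  int (fun t => plus (g1 t) (g2 t)) a b = plus (int g1 a b) (int g2 a b).
Proof.
  intros H1 H2. apply int_unique.
  exact (is_RInt_plus (V := realify W) _ _ _ _ _ _ (int_correct g1 a b H1)
    (int_correct g2 a b H2)).
Qed.

Lemma int_chasles g a b c : cont g -> plus (int g a b) (int g b c) = int g a c.
Proof.
  intros H. symmetry. apply int_unique.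
  exact (is_RInt_Chasles (V := realify W) _ _ _ _ _ _ (int_correct g a b H)
    (int_correct g b c H)).
Qed.

Lemma norm_int_le g (h : R -> R) a b lh : cont g -> a <= b ->
  (forall t, a <= t <= b -> norm (g t) <= h t) -> is_RInt h a b lh ->
  norm (int g a b) <= lh.
Proof.
  intros Hg Hab Hn Hh.
  exact (norm_RInt_le (V := realify W) g h a b _ lh Hab Hn (int_correct g a b Hg) Hh).
Qed.

Lemma norm_int_le_const g a b M : cont g -> a <= b ->
  (forall t, a <= t <= b -> norm (g t) <= M) -> norm (int g a b) <= (b - a) * M.
Proof.
  intros Hg Hab Hn.
  exact (norm_RInt_le_const (V := realify W) g a b _ M Hab Hn (int_correct g a b Hg)).
Qed.

Lemma int_deriv g g' a b : (forall t, Rmin a b <= t <= Rmax a b -> deriv_at g t (g' t)) ->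
  (forall t, Rmin a b <= t <= Rmax a b -> cont_at g' t) ->
  integral g' a b (minus (g b) (g a)).
Proof.
  intros Hd Hc. apply (is_RInt_derive (V := realify W)).
  - intros t Ht. exact (proj1 (deriv_at_is_derive g t (g' t)) (Hd t Ht)).
  - intros t Ht. exact (proj1 (cont_at_continuous g' t) (Hc t Ht)).
Qed.

Lemma deriv_zero_const g a b : a <= b -> (forall t, a <= t <= b -> deriv_at g t zero) ->
  g b = g a.
Proof.
  intros Hab Hd. apply minus_zero_eq.
  rewrite <- (int_unique (fun _ => @zero W) a b (minus (g b) (g a))).
  - apply vnorm_eq_0. apply Rle_antisym; [|apply vnorm_ge_0].
    eapply Rle_trans; [apply norm_int_le_const with (M := 0)|lra].
    + apply cont_const.
    + exact Hab.
    + intros. rewrite vnorm_zero. lra.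
  - apply int_deriv; rewrite Rmin_left, Rmax_right by exact Hab.
    + exact Hd.
    + intros t _. apply cont_const.
Qed.

End Integral.

(** A linear map commutes with Riemann sums, and its continuity carries this over to their limit. *)
Lemma integral_lin {W W' : CompleteNormedModule C_AbsRing} (T : W -> W') g a b l :
  is_linear T -> integral g a b l -> integral (fun t => T (g t)) a b (T l).
Proof.
  intros HT H. unfold integral, is_RInt.
  apply filterlim_ext with (f := fun ptd =>
    T (scal (sign (b - a) : R_AbsRing) (Riemann_sum (V := realify W) g ptd))).
  - intro ptd. etransitivity; [exact (lin_scal T HT (RtoC (sign (b - a))) _)|].
    change (scal (RtoC (sign (b - a))) (T (Riemann_sum (V := realify W) g ptd)) =
      scal (RtoC (sign (b - a))) (Riemann_sum (V := realify W') (fun t => T (g t)) ptd)).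
    f_equal. induction ptd as [x0|h ptd IH] using SF_cons_ind.
    + exact (lin_zero T HT).
    + rewrite (Riemann_sum_cons (V := realify W)), (Riemann_sum_cons (V := realify W')).
      etransitivity; [exact (lin_plus T HT _ _)|]. rewrite IH.
      apply (f_equal (fun z => plus z _)).
      exact (lin_scal T HT (RtoC (SF_h ptd - fst h)) (g (snd h))).
  - eapply filterlim_comp; [exact H|].
    exact (@linear_cont C_AbsRing W W' T l HT).
Qed.

Lemma int_lin {W W' : CompleteNormedModule C_AbsRing} (T : W -> W') g a b :
  is_linear T -> cont g -> int (fun t => T (g t)) a b = T (int g a b).
Proof.
  intros HT Hg. apply int_unique. apply integral_lin; [exact HT|].
  apply int_correct. exact Hg.
Qed.

(** * Absolutely convergent integrals over the line *)

Lemma is_RInt_tail a b M : 0 < a -> a <= b ->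
  is_RInt (fun t => M / t ^ 2) a b (M * (/ a - / b)).
Proof.
  intros Ha Hab.
  replace (M * (/ a - / b)) with (minus (- M / b) (- M / a))
    by (unfold minus, plus, opp; simpl; field; lra).
  apply (is_RInt_derive (V := R_CompleteNormedModule) (fun t => - M / t)).
  - intros t Ht. rewrite Rmin_left in Ht by exact Hab.
    auto_derive; [lra|]. field. lra.
  - intros t Ht. rewrite Rmin_left in Ht by exact Hab.
    apply (ex_derive_continuous (K := R_AbsRing) (V := R_NormedModule)). auto_derive.
    intro H. simpl in H. apply Rmult_integral in H. destruct H as [H|H]; lra.
Qed.

Lemma is_RInt_tail_neg a b M : 0 < a -> a <= b ->
  is_RInt (fun t => M / t ^ 2) (- b) (- a) (M * (/ a - / b)).
Proof.
  intros Ha Hab.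
  replace (M * (/ a - / b)) with (minus (- M / - a) (- M / - b))
    by (unfold minus, plus, opp; simpl; field; lra).
  apply (is_RInt_derive (V := R_CompleteNormedModule) (fun t => - M / t)).
  - intros t Ht. rewrite Rmax_right in Ht by lra.
    auto_derive; [lra|]. field. lra.
  - intros t Ht. rewrite Rmax_right in Ht by lra.
    apply (ex_derive_continuous (K := R_AbsRing) (V := R_NormedModule)). auto_derive.
    intro H. simpl in H. apply Rmult_integral in H. destruct H as [H|H]; lra.
Qed.

Lemma is_RInt_cauchy_kernel n M :
  is_RInt (fun t => M / (1 + t ^ 2)) (- n) n (M * (2 * atan n)).
Proof.
  replace (M * (2 * atan n)) with (minus (M * atan n) (M * atan (- n)))
    by (rewrite atan_opp; unfold minus, plus, opp; simpl; ring).
  apply (is_RInt_derive (V := R_CompleteNormedModule) (fun t => M * atan t)).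
  - intros t _. auto_derive; [exact I|]. field. nra.
  - intros t _.
    apply (ex_derive_continuous (K := R_AbsRing) (V := R_NormedModule)). auto_derive.
    simpl. nra.
Qed.

Section Line.

Context {W : CompleteNormedModule C_AbsRing}.
Implicit Types g : R -> W.

(** One majorant serves all integrals over the line: its primitive is [atan], its tails are below
    [M / t^2], and it matches [|z|^-2] on vertical lines with abscissa at least 1. *)
Definition dominated (M : R) g : Prop := forall s, norm (g s) <= M / (1 + s ^ 2).

Definition summable g : Prop := cont g /\ exists M, dominated M g.

(** The integral over the real line, as the limit over the windows [[-n, n]]. It is total by [iota];
    [line_limit] shows that the limit exists for summable functions. *)
Definition line g : W :=
  iota (fun l : W => filterlim (fun n : nat => int g (- INR n) (INR n))
    eventually (locally l)).

Lemma dominated_ge_0 M g : dominated M g -> 0 <= M.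
Proof.
  intro H. specialize (H 0). replace (M / (1 + 0 ^ 2)) with M in H by field.
  generalize (vnorm_ge_0 (g 0)). lra.
Qed.

Lemma dominated_tail M g t : dominated M g -> 0 < t ^ 2 -> norm (g t) <= M / t ^ 2.
Proof.
  intros H Ht. eapply Rle_trans; [apply H|].
  apply Rmult_le_compat_l; [exact (dominated_ge_0 M g H)|].
  apply Rinv_le_contravar; lra.
Qed.

Lemma int_tail M g a b : cont g -> dominated M g -> 0 < a -> a <= b ->
  norm (minus (int g (- b) b) (int g (- a) a)) <= 2 * M / a.
Proof.
  intros Hg HM Ha Hab. assert (H0 := dominated_ge_0 M g HM).
  replace (minus _ _) with (plus (int g (- b) (- a)) (int g a b)).
  2: { rewrite <- (int_chasles g (- b) (- a) b Hg), <- (int_chasles g (- a) a b Hg).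
       vring W. }
  eapply Rle_trans; [apply vnorm_triangle|].
  assert (H1 : norm (int g a b) <= M * (/ a - / b)).
  { eapply norm_int_le; [exact Hg|exact Hab| |apply is_RInt_tail; assumption].
    intros t Ht. apply dominated_tail; [exact HM|]. nra. }
  assert (H2 : norm (int g (- b) (- a)) <= M * (/ a - / b)).
  { eapply norm_int_le; [exact Hg|lra| |apply is_RInt_tail_neg; assumption].
    intros t Ht. apply dominated_tail; [exact HM|]. nra. }
  assert (H3 : 0 < / b) by (apply Rinv_0_lt_compat; lra).
  unfold Rdiv. nra.
Qed.

Lemma int_window M g n : cont g -> dominated M g -> 0 <= n ->
  norm (int g (- n) n) <= 4 * M.
Proof.
  intros Hg HM Hn. assert (H0 := dominated_ge_0 M g HM).
  eapply Rle_trans.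
  { eapply norm_int_le; [exact Hg|lra| |apply is_RInt_cauchy_kernel].
    intros t _. apply HM. }
  (* [2 * atan n] is less than [PI], which is at most 4: this is the constant 4 in all later norm
     bounds. *)
  generalize (atan_bound n) PI_4. intros. nra.
Qed.

Lemma line_limit g : summable g ->
  filterlim (fun n : nat => int g (- INR n) (INR n)) eventually (locally (line g)).
Proof.
  intros [Hg [M HM]].
  assert (HE : exists l : W,
    filterlim (fun n : nat => int g (- INR n) (INR n)) eventually (locally l)).
  { apply (proj1 (@filterlim_locally_cauchy nat (CompleteNormedModule.CompleteSpace _ W)
      eventually _ (fun n : nat => int g (- INR n) (INR n)))).
    intro eps. assert (H0 := dominated_ge_0 M g HM).
    destruct (nfloor_ex (2 * M / eps)) as [N [_ HN]].
    { apply Rmult_le_pos; [lra|]. apply Rlt_le, Rinv_0_lt_compat, cond_pos. }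
    assert (Hle : forall n m, (S N <= n)%nat -> (n <= m)%nat ->
      norm (minus (int g (- INR m) (INR m)) (int g (- INR n) (INR n))) < eps).
    { intros n m Hn Hm. apply le_INR in Hn. apply le_INR in Hm.
      rewrite S_INR in Hn. assert (HN0 := pos_INR N).
      eapply Rle_lt_trans; [apply int_tail with (M := M); (assumption || lra)|].
      assert (Hn0 : 0 < INR n) by lra.
      apply Rmult_lt_reg_r with (INR n); [exact Hn0|].
      unfold Rdiv. rewrite Rmult_assoc, Rinv_l, Rmult_1_r by lra.
      apply Rmult_lt_reg_r with (/ eps); [apply Rinv_0_lt_compat, cond_pos|].
      replace (eps * INR n * / eps) with (INR n)
        by (field; generalize (cond_pos eps); lra).
      unfold Rdiv in HN. lra. }
    exists (fun n => (S N <= n)%nat). split; [exists (S N); tauto|].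
    intros n m Hn Hm. apply (@norm_compat1 C_AbsRing W).
    destruct (Nat.le_ge_cases n m) as [H|H]; [exact (Hle n m Hn H)|].
    eapply Rle_lt_trans; [|exact (Hle m n Hm H)]. apply Req_le, vnorm_minus_sym. }
  refine (iota_correct (K := C_AbsRing) (V := W) (fun l : W =>
    filterlim (fun n : nat => int g (- INR n) (INR n)) eventually (locally l)) _).
  destruct HE as [l Hl].
  exists l. split; [exact Hl|]. intros l' Hl'.
  exact (@filterlim_locally_unique nat C_AbsRing W eventually _ _ l l' Hl Hl').
Qed.

Lemma line_window M g a : cont g -> dominated M g -> 0 < a ->
  norm (minus (line g) (int g (- a) a)) <= 2 * M / a.
Proof.
  intros Hg HM Ha. assert (HL := line_limit g (conj Hg (ex_intro _ M HM))).
  apply le_epsilon. intros eps He.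
  destruct (proj1 (@filterlim_locally_ball_norm C_AbsRing nat W eventually _ _ _) HL
    (mkposreal eps He)) as [N HN].
  destruct (nfloor_ex a (Rlt_le _ _ Ha)) as [k [_ Hk]].
  set (m := max N (S k)).
  specialize (HN m (Nat.le_max_l _ _)). unfold ball_norm in HN. simpl in HN.
  assert (Hm : a <= INR m).
  { apply Rle_trans with (INR (S k)); [rewrite S_INR; lra|].
    apply le_INR, Nat.le_max_r. }
  replace (minus _ _) with
    (plus (minus (int g (- INR m) (INR m)) (int g (- a) a))
       (opp (minus (int g (- INR m) (INR m)) (line g)))) by (vring W).
  eapply Rle_trans; [apply vnorm_triangle|]. rewrite vnorm_opp.
  apply Rplus_le_compat; [|apply Rlt_le; exact HN].
  apply int_tail; assumption.
Qed.

(** The working criterion for the value of an integral: agreement with the windows up to [C / n].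
    Linearity, integration by parts and the shift of the line all supply this rate. *)
Lemma line_unique g l C : summable g ->
  (forall n : nat, (0 < n)%nat -> norm (minus l (int g (- INR n) (INR n))) <= C / INR n) ->
  line g = l.
Proof.
  intros [Hg [M HM]] H. apply minus_zero_eq, vnorm_small. intros eps He.
  assert (H0 := dominated_ge_0 M g HM).
  assert (HC : 0 <= C).
  { specialize (H 1%nat Nat.lt_0_1). change (INR 1) with 1 in H.
    generalize (vnorm_ge_0 (minus l (int g (- (1)) 1))). lra. }
  destruct (nfloor_ex ((2 * M + C) / eps)) as [N [_ HN]].
  { apply Rmult_le_pos; [lra|]. apply Rlt_le, Rinv_0_lt_compat. exact He. }
  assert (Hn : 0 < INR (S N)) by (apply lt_0_INR; lia).
  specialize (H (S N) (Nat.lt_0_succ N)).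
  assert (H1 := line_window M g (INR (S N)) Hg HM Hn).
  replace (minus _ _) with
    (plus (minus (line g) (int g (- INR (S N)) (INR (S N))))
       (opp (minus l (int g (- INR (S N)) (INR (S N)))))) by (vring W).
  eapply Rle_trans; [apply vnorm_triangle|]. rewrite vnorm_opp.
  apply Rle_trans with ((2 * M + C) / INR (S N)); [unfold Rdiv in *; lra|].
  apply Rmult_le_reg_r with (INR (S N)); [exact Hn|].
  unfold Rdiv. rewrite Rmult_assoc, Rinv_l, Rmult_1_r by lra.
  rewrite <- S_INR in HN.
  apply Rmult_le_reg_r with (/ eps); [apply Rinv_0_lt_compat; exact He|].
  replace (eps * INR (S N) * / eps) with (INR (S N)) by (field; lra).
  unfold Rdiv in HN. lra.
Qed.

Lemma line_norm M g : cont g -> dominated M g -> norm (line g) <= 4 * M.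
Proof.
  intros Hg HM. apply le_epsilon. intros eps He.
  assert (H0 := dominated_ge_0 M g HM).
  set (a := (2 * M + 1) / eps).
  assert (Ha : 0 < a) by (apply Rdiv_lt_0_compat; lra).
  replace (line g) with (plus (int g (- a) a) (minus (line g) (int g (- a) a)))
    by (vring W).
  eapply Rle_trans; [apply vnorm_triangle|].
  apply Rplus_le_compat; [apply int_window; (assumption || lra)|].
  eapply Rle_trans; [apply line_window; eassumption|].
  apply Rmult_le_reg_r with a; [exact Ha|].
  unfold Rdiv. rewrite Rmult_assoc, Rinv_l, Rmult_1_r by lra.
  unfold a. replace (eps * ((2 * M + 1) / eps)) with (2 * M + 1) by (field; lra). lra.
Qed.

Lemma line_ext g1 g2 : summable g1 -> (forall s, g1 s = g2 s) -> line g1 = line g2.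
Proof.
  intros [Hg [M HM]] H. symmetry. apply (line_unique g2 _ (2 * M)).
  - split; [exact (cont_ext _ _ H Hg)|]. exists M. intro s. rewrite <- H. apply HM.
  - intros n Hn. rewrite <- (int_ext g1 g2 _ _ H).
    apply line_window; [assumption..|]. apply lt_0_INR. exact Hn.
Qed.

Lemma summable_plus g1 g2 : summable g1 -> summable g2 ->
  summable (fun s => plus (g1 s) (g2 s)).
Proof.
  intros [H1 [M1 HM1]] [H2 [M2 HM2]]. split.
  - intro t. apply cont_at_plus; [apply H1|apply H2].
  - exists (M1 + M2). intro s. eapply Rle_trans; [apply vnorm_triangle|].
    unfold Rdiv. rewrite Rmult_plus_distr_r. apply Rplus_le_compat; [apply HM1|apply HM2].
Qed.

Lemma line_plus g1 g2 : summable g1 -> summable g2 ->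
  line (fun s => plus (g1 s) (g2 s)) = plus (line g1) (line g2).
Proof.
  intros H1 H2. destruct (H1) as [Hc1 [M1 HM1]]. destruct (H2) as [Hc2 [M2 HM2]].
  apply (line_unique _ _ (2 * M1 + 2 * M2)); [apply summable_plus; assumption|].
  intros n Hn. apply lt_0_INR in Hn. rewrite int_plus by assumption.
  replace (minus _ _) with
    (plus (minus (line g1) (int g1 (- INR n) (INR n)))
      (minus (line g2) (int g2 (- INR n) (INR n)))) by (vring W).
  eapply Rle_trans; [apply vnorm_triangle|].
  unfold Rdiv. rewrite Rmult_plus_distr_r.
  apply Rplus_le_compat; apply line_window; assumption.
Qed.

End Line.

Section LineLinear.

Context {W W' : CompleteNormedModule C_AbsRing} (T : W -> W').
Hypothesis HT : is_linear T.

Lemma summable_lin g : summable g -> summable (fun s => T (g s)).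
Proof.
  intros [H1 [M1 HM1]]. destruct (lin_bound T HT) as [B [HB HTB]]. split.
  - intro t. apply cont_at_lin; [exact HT|apply H1].
  - exists (B * M1). intro s. eapply Rle_trans; [apply HTB|].
    unfold Rdiv. rewrite Rmult_assoc. apply Rmult_le_compat_l; [lra|apply HM1].
Qed.

Lemma line_lin g : summable g -> line (fun s => T (g s)) = T (line g).
Proof.
  intro H. destruct (H) as [Hg [M HM]]. destruct (lin_bound T HT) as [B [HB HTB]].
  apply (line_unique _ _ (B * (2 * M))); [apply summable_lin; exact H|].
  intros n Hn. apply lt_0_INR in Hn. rewrite int_lin, <- lin_minus by assumption.
  eapply Rle_trans; [apply HTB|]. unfold Rdiv. rewrite Rmult_assoc.
  apply Rmult_le_compat_l; [lra|apply line_window; assumption].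
Qed.

End LineLinear.

Lemma is_linear_scal_const {W : CompleteNormedModule C_AbsRing} (c : C) :
  is_linear (U := W) (V := W) (fun w : W => scal c w).
Proof.
  split.
  - intros. vring W.
  - intros k x. change (scal c (scal (k : C) x) = scal (k : C) (scal c x)). vring W.
  - exists (Cmod c + 1). split; [generalize (Cmod_ge_0 c); lra|]. intro x.
    eapply Rle_trans; [exact (Req_le _ _ (@vnorm_scal W c x))|]. apply Rmult_le_compat_r; [apply vnorm_ge_0|lra].
Qed.

(** * The complex exponential *)

Definition cexp (w : C) : C := (exp (Re w) * cos (Im w), exp (Re w) * sin (Im w)).

Lemma cexp_plus a b : cexp (a + b)%C = (cexp a * cexp b)%C.
Proof.
  destruct a as [a1 a2], b as [b1 b2]. unfold cexp, Cplus, Cmult. simpl.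
  rewrite exp_plus, cos_plus, sin_plus. f_equal; ring.
Qed.

Lemma cexp_0 : cexp 0 = 1%C.
Proof.
  unfold cexp. simpl. rewrite exp_0, cos_0, sin_0. unfold RtoC. f_equal; ring.
Qed.

Lemma Cmod_cexp w : Cmod (cexp w) = exp (Re w).
Proof.
  unfold Cmod, cexp. simpl fst. simpl snd.
  replace (_ + _) with (exp (Re w) ^ 2).
  - rewrite <- Rsqr_pow2. apply sqrt_Rsqr. apply Rlt_le, exp_pos.
  - generalize (sin2_cos2 (Im w)). unfold Rsqr. intro H. simpl.
    transitivity (exp (Re w) ^ 2 * (sin (Im w) * sin (Im w) + cos (Im w) * cos (Im w)));
      [rewrite H; ring|ring].
Qed.

Lemma is_derive_eps (f : R -> R) t l eps : is_derive f t l -> 0 < eps ->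
  exists del, 0 < del /\ forall h, Rabs h < del ->
    Rabs (f (t + h) - f t - h * l) <= eps * Rabs h.
Proof.
  intros [_ H] He.
  destruct (H t (fun P HP => HP) (mkposreal eps He)) as [del Hd].
  exists del. split; [apply cond_pos|]. intros h Hh.
  assert (Hb : ball t del (t + h)).
  { change (Rabs (t + h - t) < del). rewrite Rplus_minus_l. exact Hh. }
  specialize (Hd (t + h) Hb).
  change (Rabs (f (t + h) - f t - (t + h - t) * l) <= eps * Rabs (t + h - t)) in Hd.
  rewrite Rplus_minus_l in Hd. exact Hd.
Qed.

Lemma Cmod_le_sum (z : C) : Cmod z <= Rabs (Re z) + Rabs (Im z).
Proof.
  replace z with (RtoC (Re z) + RtoC (Im z) * Ci)%C at 1
    by (destruct z; unfold RtoC, Ci, Cplus, Cmult; simpl; f_equal; ring).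
  eapply Rle_trans; [apply Cmod_triangle|].
  rewrite Cmod_mult, Cmod_Ci, !Cmod_R. lra.
Qed.

Lemma deriv_pair (g : R -> CC) t (l : C) :
  is_derive (fun s => Re (g s)) t (Re l) -> is_derive (fun s => Im (g s)) t (Im l) ->
  deriv_at g t (l : CC).
Proof.
  intros H1 H2 eps He.
  destruct (is_derive_eps _ _ _ (eps / 2) H1) as [d1 [Hd1 Hg1]]; [lra|].
  destruct (is_derive_eps _ _ _ (eps / 2) H2) as [d2 [Hd2 Hg2]]; [lra|].
  exists (Rmin d1 d2). split; [apply Rmin_glb_lt; assumption|]. intros h Hh.
  specialize (Hg1 h (Rlt_le_trans _ _ _ Hh (Rmin_l _ _))).
  specialize (Hg2 h (Rlt_le_trans _ _ _ Hh (Rmin_r _ _))).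
  change (Cmod (g (t + h)%R - g t - RtoC h * l)%C <= eps * Rabs h).
  eapply Rle_trans; [apply Cmod_le_sum|].
  replace (Re (g (t + h)%R - g t - RtoC h * l)%C)
    with (Re (g (t + h)) - Re (g t) - h * Re l)
    by (unfold Re, Im; simpl; ring).
  replace (Im (g (t + h)%R - g t - RtoC h * l)%C)
    with (Im (g (t + h)) - Im (g t) - h * Im l)
    by (unfold Re, Im; simpl; ring).
  lra.
Qed.

(** The affine exponent covers both variables of [exp (t z)]: the time [t], and the ordinate of [z]
    on a vertical line. *)
Lemma deriv_cexp_affine (a w : C) t :
  deriv_at (W := CC) (fun s => cexp (a + RtoC s * w)%C) t
    ((w * cexp (a + RtoC t * w))%C : CC).
Proof.
  destruct a as [a1 a2], w as [x y]. apply deriv_pair.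
  - unfold cexp. simpl. auto_derive; [exact I|]. unfold Rminus. ring.
  - unfold cexp. simpl. auto_derive; [exact I|]. unfold Rminus. ring.
Qed.

Lemma deriv_cexp (w : C) t :
  deriv_at (W := CC) (fun s => cexp (RtoC s * w)%C) t ((w * cexp (RtoC t * w))%C : CC).
Proof.
  replace (RtoC t * w)%C with (0 + RtoC t * w)%C by ring.
  eapply deriv_ext; [|apply deriv_cexp_affine].
  intro s. simpl. f_equal. ring.
Qed.

Lemma exp_monotone x y : x <= y -> exp x <= exp y.
Proof.
  intros [H|H]; [apply Rlt_le, exp_increasing; exact H|rewrite H; lra].
Qed.

Lemma Re_scale_bound (r : R) (w : C) : 0 <= r <= 1 ->
  exp (Re (RtoC r * w)%C) <= exp (Rabs (Re w)).
Proof.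
  intro Hr. apply exp_monotone.
  replace (Re (RtoC r * w)%C) with (r * Re w) by (unfold Re; simpl; ring).
  generalize (Rle_abs (Re w)) (Rabs_pos (Re w)). nra.
Qed.

(** The derivative of [r -> cexp (r w)] is integrated over [[0, 1]], where the modulus of the
    exponential is at most [exp (Rabs (Re w))]. *)
Lemma cexp_minus_1 (w : C) : Cmod (cexp w - 1)%C <= Cmod w * exp (Rabs (Re w)).
Proof.
  assert (Hc : cont (W := CC) (fun r => (w * cexp (RtoC r * w))%C)).
  { intro r. exact (cont_at_lin (W := CC) (W' := CC) _ (is_linear_scal_const (W := CC) w)
      _ r (deriv_cont_at _ _ _ (deriv_cexp w r))). }
  assert (H := int_deriv (W := CC) _ _ 0 1 (fun r _ => deriv_cexp w r) (fun r _ => Hc r)).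
  apply int_unique in H.
  assert (Hn : norm (int (W := CC) (fun r => (w * cexp (RtoC r * w))%C) 0 1)
    <= (1 - 0) * (Cmod w * exp (Rabs (Re w)))).
  { apply norm_int_le_const; [exact Hc|lra|]. intros r Hr.
    change (Cmod (w * cexp (RtoC r * w))%C <= Cmod w * exp (Rabs (Re w))).
    rewrite Cmod_mult, Cmod_cexp. apply Rmult_le_compat_l; [apply Cmod_ge_0|].
    apply Re_scale_bound. exact Hr. }
  rewrite H in Hn.
  change (Cmod (cexp (RtoC 1 * w) - cexp (RtoC 0 * w))%C
    <= (1 - 0) * (Cmod w * exp (Rabs (Re w)))) in Hn.
  rewrite Cmult_1_l, Cmult_0_l, cexp_0 in Hn. lra.
Qed.

(** Meant for large ordinates: being linear in [w], it costs one factor [z] only, which the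
    summability of [z F] absorbs. The quadratic bound below, which is small compared with [w], is
    used on bounded windows. *)
Lemma cexp_minus_1_linear (w : C) :
  Cmod (cexp w - 1 - w)%C <= Cmod w * (exp (Rabs (Re w)) + 1).
Proof.
  eapply Rle_trans; [apply Cmod_triangle|]. rewrite Cmod_opp.
  generalize (cexp_minus_1 w). lra.
Qed.

Lemma cexp_minus_1_quadratic (w : C) :
  Cmod (cexp w - 1 - w)%C <= Cmod w * Cmod w * exp (Rabs (Re w)).
Proof.
  assert (Hd : forall r, deriv_at (W := CC) (fun r => (cexp (RtoC r * w) - RtoC r * w)%C) r
    ((w * (cexp (RtoC r * w) - 1))%C : CC)).
  { intro r. destruct w as [x y]. apply deriv_pair.
    - unfold cexp. simpl. auto_derive; [exact I|]. unfold Rminus. ring.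
    - unfold cexp. simpl. auto_derive; [exact I|]. unfold Rminus. ring. }
  assert (Hc : cont (W := CC) (fun r => (w * (cexp (RtoC r * w) - 1))%C)).
  { intro r. apply (cont_at_lin (W := CC) (W' := CC) (fun z => (w * z)%C)
      (is_linear_scal_const (W := CC) w)).
    apply (cont_at_plus (W := CC) (fun r => cexp (RtoC r * w)%C) (fun _ => (- (1))%C)).
    - exact (deriv_cont_at _ _ _ (deriv_cexp w r)).
    - apply (cont_const (W := CC)). }
  assert (H := int_deriv (W := CC) _ _ 0 1 (fun r _ => Hd r) (fun r _ => Hc r)).
  apply int_unique in H.
  assert (Hn : norm (int (W := CC) (fun r => (w * (cexp (RtoC r * w) - 1))%C) 0 1)
    <= (1 - 0) * (Cmod w * Cmod w * exp (Rabs (Re w)))).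
  { apply norm_int_le_const; [exact Hc|lra|]. intros r Hr.
    change (Cmod (w * (cexp (RtoC r * w) - 1))%C
      <= Cmod w * Cmod w * exp (Rabs (Re w))).
    rewrite Cmod_mult, Rmult_assoc. apply Rmult_le_compat_l; [apply Cmod_ge_0|].
    eapply Rle_trans; [apply cexp_minus_1|].
    rewrite Cmod_mult, Cmod_R, Rabs_pos_eq by lra.
    replace (Re (RtoC r * w)%C) with (r * Re w) by (unfold Re; simpl; ring).
    rewrite Rabs_mult, (Rabs_pos_eq r) by lra.
    apply Rmult_le_compat; [generalize (Cmod_ge_0 w); nra|apply Rlt_le, exp_pos| |].
    - generalize (Cmod_ge_0 w). nra.
    - apply exp_monotone. generalize (Rabs_pos (Re w)). nra. }
  rewrite H in Hn.
  change (Cmod ((cexp (RtoC 1 * w) - RtoC 1 * w) - (cexp (RtoC 0 * w) - RtoC 0 * w))%C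
    <= (1 - 0) * (Cmod w * Cmod w * exp (Rabs (Re w)))) in Hn.
  rewrite !Cmult_1_l, !Cmult_0_l, cexp_0 in Hn.
  replace (cexp w - 1 - w)%C with (cexp w - w - (1 - 0))%C by ring. lra.
Qed.

(** * Inverse Laplace transforms *)

(** A quantitative form of dominated convergence. [m] is the scale of the claim: 1 for continuity,
    [Rabs h] for differentiability. Outside a window of radius [a] the domination is uniform in [h];
    inside, the integrand has the additional factor [Rabs h]. *)
Lemma small_line {W : CompleteNormedModule C_AbsRing} (g : R -> R -> W) (m : R -> R) B D del :
  0 < del -> 0 <= B -> (forall a, 0 <= D a) -> (forall h, 0 <= m h) ->
  (forall h, cont (g h)) ->
  (forall h, Rabs h < del -> dominated (B * m h) (g h)) ->
  (forall a h s, Rabs h < del -> Rabs s <= a -> norm (g h s) <= D a * Rabs h * m h) ->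
  forall eps, 0 < eps -> exists del', 0 < del' /\
    forall h, Rabs h < del' -> norm (line (g h)) <= eps * m h.
Proof.
  intros Hd HB HD Hm Hc Hdom Hwin eps He.
  (* The radius makes the tails at most [eps / 2 * m h]. Once it is fixed, [K] bounds the window of
     length [2 * a]; the summand 1 keeps both constants positive. *)
  set (a := (4 * B + 1) / eps).
  assert (Ha : 0 < a) by (apply Rdiv_lt_0_compat; lra).
  set (K := 2 * a * D a + 1). assert (HK : 0 < K) by (unfold K; generalize (HD a); nra).
  exists (Rmin del (eps / 2 / K)). split.
  { apply Rmin_glb_lt; [exact Hd|]. apply Rdiv_lt_0_compat; lra. }
  intros h Hh.
  assert (H1 := Rlt_le_trans _ _ _ Hh (Rmin_l _ _)).
  assert (H2 := Rlt_le_trans _ _ _ Hh (Rmin_r _ _)).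
  replace (line (g h)) with
    (plus (int (g h) (- a) a) (minus (line (g h)) (int (g h) (- a) a))) by (vring W).
  eapply Rle_trans; [apply vnorm_triangle|].
  assert (H3 : norm (int (g h) (- a) a) <= (a - - a) * (D a * Rabs h * m h)).
  { apply norm_int_le_const; [apply Hc|lra|]. intros s Hs. apply Hwin; [exact H1|].
    apply Rabs_le. lra. }
  assert (H4 := line_window (B * m h) (g h) a (Hc h) (Hdom h H1) Ha).
  assert (H5 : 2 * (B * m h) / a <= eps / 2 * m h).
  { replace (2 * (B * m h) / a) with (4 * B / a / 2 * m h) by (field; lra).
    apply Rmult_le_compat_r; [apply Hm|].
    apply Rmult_le_compat_r; [lra|].
    apply Rmult_le_reg_r with a; [exact Ha|].
    unfold Rdiv at 1. rewrite Rmult_assoc, Rinv_l, Rmult_1_r by lra.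
    unfold a. replace (eps * ((4 * B + 1) / eps)) with (4 * B + 1) by (field; lra). lra. }
  assert (H6 : (a - - a) * (D a * Rabs h * m h) <= eps / 2 * m h).
  { replace ((a - - a) * (D a * Rabs h * m h)) with (2 * a * D a * Rabs h * m h) by ring.
    apply Rmult_le_compat_r; [apply Hm|].
    apply Rle_trans with (K * Rabs h).
    - apply Rmult_le_compat_r; [apply Rabs_pos|unfold K; lra].
    - apply Rle_trans with (K * (eps / 2 / K)).
      + apply Rmult_le_compat_l; lra.
      + apply Req_le. field. lra. }
  lra.
Qed.

Section Laplace.

Context {W : CompleteNormedModule C_AbsRing}.
Variable c : R.
Hypothesis c_pos : 0 < c.
Implicit Types F : R -> W.

(** The inverse Laplace transform, up to the factor [2 pi], of a function given by its values [F s]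
    at the points [c + i s], written as pairs [(c, s)]. *)
Definition lap F (t : R) : W := line (fun s => scal (cexp (RtoC t * (c, s))) (F s)).

Lemma cexp_line_deriv t s : deriv_at (W := CC) (fun s => cexp (RtoC t * (c, s))%C) s
  ((Ci * RtoC t * cexp (RtoC t * (c, s)))%C : CC).
Proof.
  replace (RtoC t * (c, s))%C with (RtoC t * RtoC c + RtoC s * (Ci * RtoC t))%C
    by (unfold Ci, RtoC, Cmult, Cplus; simpl; f_equal; ring).
  eapply deriv_ext; [|apply deriv_cexp_affine].
  intro r. simpl. f_equal. unfold Ci, RtoC, Cmult, Cplus; simpl; f_equal; ring.
Qed.

Lemma cexp_line_cont t : cont (W := CC) (fun s => cexp (RtoC t * (c, s))%C).
Proof. intro s. exact (deriv_cont_at _ _ _ (cexp_line_deriv t s)). Qed.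

Lemma Re_line t s : Re (RtoC t * (c, s))%C = t * c.
Proof. unfold Re. simpl. ring. Qed.

Lemma lap_integrand_dominated M F t : dominated M F ->
  dominated (exp (t * c) * M) (fun s => scal (cexp (RtoC t * (c, s))) (F s)).
Proof.
  intros HM s. rewrite vnorm_scal, Cmod_cexp, Re_line.
  unfold Rdiv. rewrite Rmult_assoc.
  apply Rmult_le_compat_l; [apply Rlt_le, exp_pos|apply HM].
Qed.

Lemma lap_integrand_cont F t : cont F -> cont (fun s => scal (cexp (RtoC t * (c, s))) (F s)).
Proof. intros HF s. apply cont_at_scal; [apply cexp_line_cont|apply HF]. Qed.

Lemma lap_integrand_summable F t : summable F ->
  summable (fun s => scal (cexp (RtoC t * (c, s))) (F s)).
Proof.
  intros [HF [M HM]]. split; [apply lap_integrand_cont; exact HF|].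
  exists (exp (t * c) * M). apply lap_integrand_dominated. exact HM.
Qed.

Lemma lap_norm M F t : cont F -> dominated M F -> norm (lap F t) <= 4 * (exp (t * c) * M).
Proof.
  intros HF HM. apply line_norm.
  - apply lap_integrand_cont. exact HF.
  - apply lap_integrand_dominated. exact HM.
Qed.

Lemma lap_plus F1 F2 t : summable F1 -> summable F2 ->
  lap (fun s => plus (F1 s) (F2 s)) t = plus (lap F1 t) (lap F2 t).
Proof.
  intros H1 H2. unfold lap.
  rewrite <- line_plus by (apply lap_integrand_summable; assumption).
  apply line_ext.
  - apply lap_integrand_summable. apply summable_plus; assumption.
  - intro s. vring W.
Qed.

Lemma lap_ext F1 F2 t : summable F1 -> (forall s, F1 s = F2 s) -> lap F1 t = lap F2 t.
Proof.
  intros H1 H2. apply line_ext; [apply lap_integrand_summable; exact H1|].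
  intro s. rewrite H2. reflexivity.
Qed.

Lemma exp_small h : Rabs h < 1 -> exp (Rabs (Re (RtoC h * (c, 0))%C)) <= exp c.
Proof.
  intro Hh. apply exp_monotone. rewrite Re_line, Rabs_mult, (Rabs_pos_eq c) by lra. nra.
Qed.

Lemma dominated_le M F s : dominated M F -> norm (F s) <= M.
Proof.
  intro HM. eapply Rle_trans; [apply HM|]. assert (H0 := dominated_ge_0 M F HM).
  rewrite <- (Rmult_1_r M) at 2. apply Rmult_le_compat_l; [exact H0|].
  rewrite <- Rinv_1. apply Rinv_le_contravar; nra.
Qed.

Lemma Cmod_line s a : Rabs s <= a -> Cmod (c, s) <= c + a.
Proof.
  intro H. eapply Rle_trans; [apply Cmod_le_sum|]. unfold Re, Im. simpl.
  rewrite (Rabs_pos_eq c); lra.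
Qed.

Lemma lap_cont F : summable F -> cont (lap F).
Proof.
  intros HF t eps He. destruct (HF) as [Hc [M HM]]. assert (H0 := dominated_ge_0 M F HM).
  (* The integrand of the increment of [lap F] from [t] to [t + h], with the factor [exp (t z)]
     split off. *)
  set (g := fun h s => scal (cexp (RtoC t * (c, s)) * (cexp (RtoC h * (c, s)) - 1))%C (F s)).
  assert (Hgc : forall h, cont (g h)).
  { intros h s. apply cont_at_scal; [|apply Hc].
    apply (cont_at_scal (W := CC) (fun s => cexp (RtoC t * (c, s))%C)); [apply cexp_line_cont|].
    apply (cont_at_plus (W := CC) _ (fun _ => (- (1))%C)); [apply cexp_line_cont|].
    apply (cont_const (W := CC)). }
  assert (HT : 0 < exp (t * c)) by apply exp_pos.
  assert (HE : 0 < exp c) by apply exp_pos.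
  destruct (small_line g (fun _ => 1) (exp (t * c) * (exp c + 1) * M)
    (fun a => exp (t * c) * (c + Rabs a) * exp c * M) 1) with (eps := eps)
    as [del [Hd Hs]]; try lra.
  - apply Rmult_le_pos; nra.
  - intro a. generalize (Rabs_pos a). intro. repeat apply Rmult_le_pos; lra.
  - intros. lra.
  - exact Hgc.
  - intros h Hh s. unfold g. rewrite vnorm_scal, Cmod_mult, Cmod_cexp, Re_line.
    assert (H1 : Cmod (cexp (RtoC h * (c, s)) - 1) <= exp c + 1).
    { eapply Rle_trans; [apply Cmod_triangle|]. rewrite Cmod_opp, Cmod_1, Cmod_cexp, Re_line.
      apply Rplus_le_compat_r, exp_monotone. apply Rabs_def2 in Hh. nra. }
    replace (exp (t * c) * (exp c + 1) * M * 1 / (1 + s ^ 2))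
      with (exp (t * c) * (exp c + 1) * (M / (1 + s ^ 2))) by (field; nra).
    apply Rmult_le_compat; [| apply vnorm_ge_0 | | apply HM].
    + apply Rmult_le_pos; [lra|apply Cmod_ge_0].
    + apply Rmult_le_compat_l; lra.
  - intros a h s Hh Hs. unfold g. rewrite vnorm_scal, Cmod_mult, Cmod_cexp, Re_line.
    assert (H1 := cexp_minus_1 (RtoC h * (c, s))).
    rewrite Cmod_mult, Cmod_R, Re_line in H1.
    assert (H2 := exp_small h Hh). rewrite Re_line in H2.
    assert (H3 := Cmod_line s a Hs).
    assert (H4 := Rle_abs a). assert (H5 := Cmod_ge_0 (c, s)). assert (H6 := Rabs_pos h).
    replace (exp (t * c) * (c + Rabs a) * exp c * M * Rabs h * 1)
      with (exp (t * c) * (Rabs h * (c + Rabs a) * exp c) * M) by ring.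
    apply Rmult_le_compat; [| apply vnorm_ge_0 | | apply dominated_le; exact HM].
    + apply Rmult_le_pos; [lra|apply Cmod_ge_0].
    + apply Rmult_le_compat_l; [lra|]. eapply Rle_trans; [exact H1|].
      apply Rmult_le_compat; [nra|apply Rlt_le, exp_pos|nra|exact H2].
  - exists del. split; [exact Hd|]. intros h Hh. specialize (Hs h Hh).
    rewrite Rmult_1_r in Hs.
    eapply Rle_trans; [|exact Hs]. apply Req_le. f_equal.
    (* The difference is written with the scalar [-1], so that additivity and linearity of [line]
       turn it into one integral. *)
    transitivity (plus (lap F (t + h)) (scal (RtoC (-1)) (lap F t))); [vring W|].
    unfold lap. rewrite <- (line_lin _ (is_linear_scal_const (RtoC (-1))))
      by (apply lap_integrand_summable; exact HF).
    assert (S1 := lap_integrand_summable F (t + h) HF).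
    assert (S2 := summable_lin _ (is_linear_scal_const (RtoC (-1))) _
      (lap_integrand_summable F t HF)).
    rewrite <- line_plus by assumption.
    apply line_ext; [apply summable_plus; assumption|].
    intro s. unfold g. rewrite RtoC_plus, Cmult_plus_distr_r, cexp_plus. vring W.
Qed.

(** Differentiation under the integral: [small_line] at scale [Rabs h] applied to the remainder
    [exp (h z) - 1 - h z], with the domination of [z F] in both regions. *)
Lemma lap_deriv F t : summable F -> summable (fun s => scal ((c, s) : C) (F s)) ->
  deriv_at (lap F) t (lap (fun s => scal ((c, s) : C) (F s)) t).
Proof.
  intros HF HzF eps He. destruct (HF) as [Hc _]. destruct (HzF) as [_ [M HM]].
  assert (H0 := dominated_ge_0 M _ HM).
  set (g := fun h s => scal (cexp (RtoC t * (c, s))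
    * (cexp (RtoC h * (c, s)) - 1 - RtoC h * (c, s)))%C (F s)).
  assert (Hz : cont (W := CC) (fun s => (c, s) : C)).
  { intro s. apply (deriv_cont_at (W := CC)) with (l := Ci).
    apply deriv_pair; simpl; auto_derive; try exact I; reflexivity. }
  assert (Hgc : forall h, cont (g h)).
  { intros h s. apply cont_at_scal; [|apply Hc].
    apply (cont_at_scal (W := CC) (fun s => cexp (RtoC t * (c, s))%C)); [apply cexp_line_cont|].
    apply (cont_at_plus (W := CC) (fun s => cexp (RtoC h * (c, s)) - 1)%C
      (fun s => (- (RtoC h * (c, s)))%C)).
    - apply (cont_at_plus (W := CC) _ (fun _ => (- (1))%C)); [apply cexp_line_cont|].
      apply (cont_const (W := CC)).
    - apply (cont_ext (W := CC) (fun s => ((- RtoC h) * (c, s))%C) (fun s => (- (RtoC h * (c, s)))%C)).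
      { intro r. change ((- RtoC h * (c, r))%C = (- (RtoC h * (c, r)))%C). ring. }
      intro r. exact (cont_at_lin (W := CC) (W' := CC) _
        (is_linear_scal_const (W := CC) (- RtoC h)%C) _ r (Hz r)). }
  assert (HT : 0 < exp (t * c)) by apply exp_pos.
  assert (HE : 0 < exp c) by apply exp_pos.
  destruct (small_line g Rabs (exp (t * c) * (exp c + 1) * M)
    (fun a => exp (t * c) * (c + Rabs a) * exp c * M) 1) with (eps := eps)
    as [del [Hd Hs]]; try lra.
  - apply Rmult_le_pos; nra.
  - intro a. generalize (Rabs_pos a). intro. repeat apply Rmult_le_pos; lra.
  - apply Rabs_pos.
  - exact Hgc.
  - intros h Hh s. unfold g. rewrite vnorm_scal, Cmod_mult, Cmod_cexp, Re_line.
    assert (H1 := cexp_minus_1_linear (RtoC h * (c, s))).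
    rewrite Cmod_mult, Cmod_R, Re_line in H1.
    assert (H2 := exp_small h Hh). rewrite Re_line in H2.
    specialize (HM s). cbv beta in HM. rewrite vnorm_scal in HM.
    replace (exp (t * c) * (exp c + 1) * M * Rabs h / (1 + s ^ 2))
      with (exp (t * c) * (Rabs h * (exp c + 1)) * (M / (1 + s ^ 2))) by (field; nra).
    apply Rle_trans with (exp (t * c) * (Rabs h * (exp c + 1)) * (Cmod (c, s) * norm (F s))).
    + rewrite !Rmult_assoc. apply Rmult_le_compat_l; [lra|].
      rewrite <- !Rmult_assoc. apply Rmult_le_compat_r; [apply vnorm_ge_0|].
      eapply Rle_trans; [exact H1|].
      replace (Rabs h * (exp c + 1) * Cmod (c, s))
        with (Rabs h * Cmod (c, s) * (exp c + 1)) by ring.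
      apply Rmult_le_compat_l; [|lra].
      apply Rmult_le_pos; [apply Rabs_pos|apply Cmod_ge_0].
    + apply Rmult_le_compat_l; [|exact HM].
      generalize (Rabs_pos h). intro. repeat apply Rmult_le_pos; lra.
  - intros a h s Hh Hs. unfold g. rewrite vnorm_scal, Cmod_mult, Cmod_cexp, Re_line.
    assert (H1 := cexp_minus_1_quadratic (RtoC h * (c, s))).
    rewrite Cmod_mult, Cmod_R, Re_line in H1.
    assert (H2 := exp_small h Hh). rewrite Re_line in H2.
    assert (H3 := Cmod_line s a Hs).
    assert (H4 := Rle_abs a). assert (H5 := Cmod_ge_0 (c, s)). assert (H6 := Rabs_pos h).
    assert (H7 := dominated_le M _ s HM). cbv beta in H7. rewrite vnorm_scal in H7.
    apply Rle_trans with (exp (t * c) * (Rabs h * Rabs h * (c + Rabs a) * exp c)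
      * (Cmod (c, s) * norm (F s))).
    + rewrite !Rmult_assoc. apply Rmult_le_compat_l; [lra|].
      rewrite <- !Rmult_assoc. apply Rmult_le_compat_r; [apply vnorm_ge_0|].
      eapply Rle_trans; [exact H1|].
      apply Rle_trans with (Rabs h * Cmod (c, s) * (Rabs h * (c + Rabs a)) * exp c);
        [|apply Req_le; ring].
      apply Rmult_le_compat; [|apply Rlt_le, exp_pos| |exact H2].
      * apply Rmult_le_pos; apply Rmult_le_pos; assumption.
      * apply Rmult_le_compat_l; [apply Rmult_le_pos; assumption|].
        apply Rmult_le_compat_l; lra.
    + replace (exp (t * c) * (c + Rabs a) * exp c * M * Rabs h * Rabs h)
        with (exp (t * c) * (Rabs h * Rabs h * (c + Rabs a) * exp c) * M) by ring.
      apply Rmult_le_compat_l; [|exact H7].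
      generalize (Rabs_pos a). intro. repeat apply Rmult_le_pos; lra.
  - exists del. split; [exact Hd|]. intros h Hh. specialize (Hs h Hh).
    eapply Rle_trans; [|exact Hs]. apply Req_le. f_equal.
    transitivity (plus (plus (lap F (t + h)) (scal (RtoC (-1)) (lap F t)))
      (scal (- RtoC h)%C (lap (fun s => scal ((c, s) : C) (F s)) t))); [vring W|].
    unfold lap. rewrite <- (line_lin _ (is_linear_scal_const (RtoC (-1))))
      by (apply lap_integrand_summable; exact HF).
    rewrite <- (line_lin _ (is_linear_scal_const (- RtoC h)%C))
      by (apply (lap_integrand_summable (fun s => scal ((c, s) : C) (F s))); exact HzF).
    assert (S1 := lap_integrand_summable F (t + h) HF).
    assert (S2 := summable_lin _ (is_linear_scal_const (RtoC (-1))) _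
      (lap_integrand_summable F t HF)).
    assert (S3 := summable_lin _ (is_linear_scal_const (- RtoC h)%C) _
      (lap_integrand_summable _ t HzF)).
    assert (S4 := summable_plus _ _ S1 S2).
    rewrite <- line_plus by assumption. rewrite <- line_plus by assumption.
    apply line_ext; [apply (summable_plus _ _ S4 S3)|].
    intro s. unfold g. rewrite RtoC_plus, Cmult_plus_distr_r, cexp_plus. vring W.
Qed.

End Laplace.

Lemma lap_lin {W W' : CompleteNormedModule C_AbsRing} (T : W -> W') c F t :
  0 < c -> is_linear T -> summable F -> lap c (fun s => T (F s)) t = T (lap c F t).
Proof.
  intros Hc HT HF. unfold lap.
  rewrite <- (line_lin T HT) by (apply lap_integrand_summable; assumption).
  symmetry. apply line_ext.
  - apply summable_lin; [exact HT|]. apply lap_integrand_summable; assumption.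
  - intro s. apply (lin_scal T HT).
Qed.

(** * The inverse Laplace transforms of the powers of [1 / z] *)

Section Kernel.

Variable c : R.
Hypothesis c_ge_1 : 1 <= c.

Definition zinv (s : R) : C := (/ (c, s))%C.

Lemma line_nonzero s : ((c, s) : C) <> 0%C.
Proof. intro H. injection H. lra. Qed.

Lemma Cmod_line_sq s : Cmod (c, s) * Cmod (c, s) = c ^ 2 + s ^ 2.
Proof.
  replace (Cmod (c, s) * Cmod (c, s)) with (Cmod (c, s) ^ 2) by ring.
  rewrite Cmod2_alt. reflexivity.
Qed.

Lemma zinv_mult s : ((c, s) * zinv s)%C = 1%C.
Proof. unfold zinv. field. apply line_nonzero. Qed.

Lemma Cmod_zinv s : Cmod (c, s) * Cmod (zinv s) = 1.
Proof. rewrite <- Cmod_mult, zinv_mult. apply Cmod_1. Qed.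

Lemma Cmod_line_ge_1 s : 1 <= Cmod (c, s).
Proof.
  eapply Rle_trans; [|apply re_le_Cmod]. unfold Re. simpl. rewrite Rabs_pos_eq; lra.
Qed.

Lemma Cmod_zinv_eq s : Cmod (zinv s) = / Cmod (c, s).
Proof.
  generalize (Cmod_zinv s) (Cmod_line_ge_1 s). intros H H1.
  apply Rmult_eq_reg_l with (Cmod (c, s)); [|lra]. rewrite H. field. lra.
Qed.

Lemma Cmod_zinv_pos s : 0 < Cmod (zinv s).
Proof.
  rewrite Cmod_zinv_eq. apply Rinv_0_lt_compat. generalize (Cmod_line_ge_1 s). lra.
Qed.

Lemma Cmod_zinv_le_1 s : Cmod (zinv s) <= 1.
Proof.
  rewrite Cmod_zinv_eq, <- Rinv_1 at 1.
  apply Rinv_le_contravar; [lra|apply Cmod_line_ge_1].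
Qed.

Lemma Cmod_zinv_sq s : Cmod (zinv s) * Cmod (zinv s) <= 1 / (1 + s ^ 2).
Proof.
  rewrite Cmod_zinv_eq, <- Rinv_mult, Cmod_line_sq. unfold Rdiv. rewrite Rmult_1_l.
  apply Rinv_le_contravar; nra.
Qed.

Lemma Cmod_zinv_pow_le j k s : (j <= k)%nat -> Cmod (zinv s ^ k)%C <= Cmod (zinv s) ^ j.
Proof.
  intro H. rewrite Cmod_pow. replace k with (j + (k - j))%nat by lia.
  rewrite pow_add. rewrite <- (Rmult_1_r (Cmod (zinv s) ^ j)) at 2.
  apply Rmult_le_compat_l; [apply pow_le, Cmod_ge_0|].
  rewrite <- (pow1 (k - j)). apply pow_incr. split; [apply Cmod_ge_0|apply Cmod_zinv_le_1].
Qed.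

Lemma zinv_deriv s : deriv_at (W := CC) zinv s ((- Ci * (zinv s * zinv s))%C : CC).
Proof.
  apply deriv_pair; unfold zinv, Cinv, Ci, Re, Im; simpl; auto_derive.
  all: try (repeat split; nra).
  all: field; nra.
Qed.

Lemma zinv_pow_deriv j s : deriv_at (W := CC) (fun s => (zinv s ^ j)%C) s
  ((- (RtoC (INR j) * Ci) * zinv s ^ S j)%C : CC).
Proof.
  induction j as [|j IH].
  - simpl. replace (- (0 * Ci) * (zinv s * 1))%C with (@zero CC)
      by (change (RtoC 0 = (- (0 * Ci) * (zinv s * 1))%C); ring).
    apply deriv_const.
  - assert (H := deriv_scal (W := CC) zinv (fun s => (zinv s ^ j)%C) s _ _
      (zinv_deriv s) IH).
    replace (- (RtoC (INR (S j)) * Ci) * zinv s ^ S (S j))%C with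
      (- Ci * (zinv s * zinv s) * zinv s ^ j
        + zinv s * (- (RtoC (INR j) * Ci) * zinv s ^ S j))%C; [exact H|].
    rewrite S_INR, RtoC_plus. simpl. ring.
Qed.

Lemma zinv_pow_cont j : cont (W := CC) (fun s => (zinv s ^ j)%C).
Proof. intro s. exact (deriv_cont_at _ _ _ (zinv_pow_deriv j s)). Qed.

Lemma zinv_pow_dominated j : dominated (W := CC) 1 (fun s => (zinv s ^ S (S j))%C).
Proof.
  intro s. change (Cmod (zinv s ^ S (S j))%C <= 1 / (1 + s ^ 2)).
  eapply Rle_trans; [apply (Cmod_zinv_pow_le 2); lia|].
  simpl. rewrite Rmult_1_r. apply Cmod_zinv_sq.
Qed.

Lemma zinv_pow_summable j : summable (W := CC) (fun s => (zinv s ^ S (S j))%C).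
Proof.
  split; [apply zinv_pow_cont|]. exists 1. apply zinv_pow_dominated.
Qed.

(** The transform of [z^-j], that is [2 pi t^(j - 1) / (j - 1)!] for [t >= 0]. The lemmas start at
    [j = 2], where the integral converges absolutely. *)
Definition phi (j : nat) (t : R) : C := lap (W := CC) c (fun s => (zinv s ^ j)%C) t.

Lemma phi_deriv j t : deriv_at (W := CC) (phi (S (S (S j)))) t (phi (S (S j)) t : CC).
Proof.
  assert (HE : forall s, (zinv s ^ S (S j))%C = ((c, s) * zinv s ^ S (S (S j)))%C).
  { intro s. change (zinv s ^ S (S (S j)))%C with (zinv s * zinv s ^ S (S j))%C.
    rewrite Cmult_assoc, zinv_mult. ring. }
  unfold phi at 2. rewrite (lap_ext (W := CC) c _ _ t (zinv_pow_summable j) HE).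
  assert (Hc0 : 0 < c) by lra.
  refine (lap_deriv (W := CC) c Hc0 (fun s => (zinv s ^ S (S (S j)))%C) t
    (zinv_pow_summable (S j)) _).
  destruct (zinv_pow_summable j) as [H1 [M H2]]. split.
  - exact (cont_ext (W := CC) _ _ HE H1).
  - exists M. intro s. specialize (H2 s). cbv beta in H2. rewrite HE in H2. exact H2.
Qed.

(* Integration by parts on the line. *)
Lemma phi_rec j t :
  (RtoC t * phi (S (S j)) t = RtoC (INR (S (S j))) * phi (S (S (S j))) t)%C.
Proof.
  set (k := S (S j)).
  set (D := fun s => (cexp (RtoC t * (c, s)) * zinv s ^ k)%C).
  (* Chosen so that the derivative of [D] along the line is [Ci * g]; the boundary values of [D]
     decay like [1 / n], hence [g] integrates to zero. *)
  set (g := fun s : R => Cplus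
    (RtoC t * (cexp (RtoC t * (c, s)) * zinv s ^ k))
    (- RtoC (INR k) * (cexp (RtoC t * (c, s)) * zinv s ^ S k))).
  assert (Hk := zinv_pow_summable j). fold k in Hk.
  assert (Hk1 := zinv_pow_summable (S j)). change (S (S (S j))) with (S k) in Hk1.
  assert (Hc0 : 0 < c) by lra.
  assert (I1 := lap_integrand_summable (W := CC) c _ t Hk).
  assert (I2 := lap_integrand_summable (W := CC) c _ t Hk1).
  assert (J1 := summable_lin (W := CC) (W' := CC) _ (is_linear_scal_const (W := CC) (RtoC t)) _ I1).
  assert (J2 := summable_lin (W := CC) (W' := CC) _
    (is_linear_scal_const (W := CC) (- RtoC (INR k))%C) _ I2).
  assert (Hg : summable (W := CC) g) by exact (summable_plus (W := CC) _ _ J1 J2).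
  assert (HD : forall s, deriv_at (W := CC) D s ((Ci * g s)%C : CC)).
  { intro s.
    replace (Ci * g s)%C with
      ((Ci * RtoC t * cexp (RtoC t * (c, s))) * zinv s ^ k
        + cexp (RtoC t * (c, s)) * (- (RtoC (INR k) * Ci) * zinv s ^ S k))%C
      by (unfold g; ring).
    apply (deriv_scal (W := CC) (fun s => cexp (RtoC t * (c, s))%C)).
    - apply cexp_line_deriv.
    - apply zinv_pow_deriv. }
  assert (HL : line (W := CC) g = zero).
  { apply line_unique with (C := 2 * exp (t * c)); [exact Hg|].
    intros n Hn. apply lt_0_INR in Hn.
    assert (Hgc : cont (W := CC) g) by apply Hg.
    assert (HI : (Ci * int (W := CC) g (- INR n)%R (INR n) = D (INR n) - D (- INR n)%R)%C).
    { transitivity (int (W := CC) (fun s => (Ci * g s)%C) (- INR n) (INR n)).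
      - symmetry. exact (int_lin (W := CC) (W' := CC) _ g _ _
          (is_linear_scal_const (W := CC) Ci) Hgc).
      - apply (int_unique (W := CC)). apply (int_deriv (W := CC)).
        + intros s _. apply HD.
        + intros s _. exact (cont_at_lin (W := CC) (W' := CC) _
            (is_linear_scal_const (W := CC) Ci) _ s (Hgc s)). }
    assert (HB : forall s, INR n = Rabs s -> Cmod (D s) <= exp (t * c) / INR n).
    { intros s Hs. unfold D. rewrite Cmod_mult, Cmod_cexp, Re_line.
      apply Rmult_le_compat_l; [apply Rlt_le, exp_pos|].
      eapply Rle_trans; [apply (Cmod_zinv_pow_le 1); unfold k; lia|].
      rewrite pow_1, Cmod_zinv_eq. apply Rinv_le_contravar; [exact Hn|].
      rewrite Hs. eapply Rle_trans; [|apply Rmax_Cmod]. apply Rmax_r. }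
    replace (norm _) with (Cmod (Ci * int (W := CC) g (- INR n)%R (INR n))%C).
    - rewrite HI. eapply Rle_trans; [apply Cmod_triangle|]. rewrite Cmod_opp.
      assert (B1 := HB (INR n)). assert (B2 := HB (- INR n)).
      rewrite Rabs_Ropp in B2. rewrite (Rabs_pos_eq (INR n)) in B1, B2 by lra.
      specialize (B1 eq_refl). specialize (B2 eq_refl). unfold Rdiv in *. lra.
    - rewrite Cmod_mult, Cmod_Ci, Rmult_1_l. symmetry.
      transitivity (norm (opp (int (W := CC) g (- INR n) (INR n)))).
      + f_equal. vring CC.
      + apply (vnorm_opp (W := CC)). }
  assert (HS : line (W := CC) g = Cplus (RtoC t * phi k t) (- RtoC (INR k) * phi (S k) t)).
  { etransitivity; [exact (line_plus (W := CC) _ _ J1 J2)|].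
    exact (f_equal2 (@plus CC)
      (line_lin (W := CC) (W' := CC) _ (is_linear_scal_const (W := CC) (RtoC t)) _ I1)
      (line_lin (W := CC) (W' := CC) _
         (is_linear_scal_const (W := CC) (- RtoC (INR k))%C) _ I2)). }
  rewrite HS in HL. change (@zero CC) with (RtoC 0) in HL.
  replace (RtoC t * phi k t)%C with
    (RtoC (INR k) * phi (S k) t
      + (RtoC t * phi k t + - RtoC (INR k) * phi (S k) t))%C by ring.
  rewrite HL. ring.
Qed.

Definition kappa : C := phi 2 1.

Lemma deriv_real (f : R -> R) (l t : R) : is_derive f t l ->
  deriv_at (W := CC) (fun s => RtoC (f s)) t (RtoC l : CC).
Proof.
  intro H. apply deriv_pair; simpl; [exact H|].
  apply (is_derive_const (K := R_AbsRing) (V := R_NormedModule) 0).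
Qed.

(** [phi_rec] gives [s phi_2 = 2 phi_3], and [phi_3' = phi_2]; hence [s phi_3' = 2 phi_3] and
    [phi_3 / s^2] is constant on the positive axis. [kappa] is the remaining constant of
    integration. *)
Lemma phi_2_pos t : 0 < t -> phi 2 t = (RtoC t * kappa)%C.
Proof.
  intro Ht. set (chi := fun s => (RtoC (/ (s * s)) * phi 3 s)%C).
  assert (H2 : forall s, 0 < s -> phi 2 s = (RtoC (2 / s) * phi 3 s)%C).
  { intros s Hs. assert (H := phi_rec 0 s). change (INR 2) with (1 + 1) in H.
    replace (RtoC (2 / s) * phi 3 s)%C with (RtoC (/ s) * (RtoC (1 + 1) * phi 3 s))%C.
    - rewrite <- H, Cmult_assoc, <- RtoC_mult, Rinv_l by lra. ring.
    - rewrite Cmult_assoc, <- RtoC_mult. do 2 f_equal. field. lra. }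
  assert (Hd : forall s, 0 < s -> deriv_at (W := CC) chi s zero).
  { intros s Hs.
    assert (D1 : is_derive (fun s => / (s * s)) s (- 2 / (s * s * s))).
    { auto_derive; [nra|]. field. lra. }
    assert (D := deriv_scal (W := CC) _ _ s _ _ (deriv_real _ _ _ D1) (phi_deriv 0 s)).
    replace (@zero CC) with (Cplus (RtoC (- 2 / (s * s * s)) * phi 3 s)
      (RtoC (/ (s * s)) * phi 2 s)); [exact D|].
    rewrite H2, Cmult_assoc, <- RtoC_mult by exact Hs.
    change (@zero CC) with (RtoC 0).
    rewrite <- Cmult_plus_distr_r, <- RtoC_plus.
    replace (- 2 / (s * s * s) + / (s * s) * (2 / s)) with 0 by (field; lra). ring. }
  assert (HC : chi t = chi 1).
  { destruct (Rle_dec 1 t) as [H|H].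
    - apply (deriv_zero_const (W := CC)); [exact H|]. intros s Hs. apply Hd. lra.
    - symmetry. apply (deriv_zero_const (W := CC)); [lra|]. intros s Hs. apply Hd. lra. }
  unfold kappa. rewrite (H2 t), (H2 1) by lra. unfold chi in HC.
  replace (/ (1 * 1)) with 1 in HC by field. rewrite Cmult_1_l in HC. rewrite <- HC.
  rewrite !Cmult_assoc, <- !RtoC_mult. do 2 f_equal. field. lra.
Qed.

Lemma phi_2 t : 0 <= t -> phi 2 t = (RtoC t * kappa)%C.
Proof.
  intros [Ht|<-]; [apply phi_2_pos; exact Ht|]. rewrite Cmult_0_l.
  apply (vnorm_small (W := CC)). intros eps He.
  assert (Hc0 : 0 < c) by lra.
  destruct (lap_cont (W := CC) c Hc0 _ (zinv_pow_summable 0) 0 (eps / 2)) as [d [Hd H]]; [lra|].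
  assert (Hk := Cmod_ge_0 kappa).
  (* At 0 the recursion cannot be divided by [t], so the value comes from continuity: [h] is a
     positive time at which both [phi 2 h - phi 2 0] and [h * kappa] are at most [eps / 2]. *)
  set (h := Rmin (d / 2) (eps / 2 / (Cmod kappa + 1))).
  assert (Hp : 0 < eps / 2 / (Cmod kappa + 1)) by (apply Rdiv_lt_0_compat; lra).
  assert (Hh : 0 < h) by (apply Rmin_glb_lt; lra).
  assert (Hh1 : h <= d / 2) by apply Rmin_l.
  assert (Hh2 : h <= eps / 2 / (Cmod kappa + 1)) by apply Rmin_r.
  specialize (H h). rewrite (Rabs_pos_eq h) in H by lra. specialize (H ltac:(lra)).
  rewrite Rplus_0_l in H. change (Cmod (phi 2 h - phi 2 0)%C <= eps / 2) in H.
  change (Cmod (phi 2 0) <= eps).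
  replace (phi 2 0) with (phi 2 h + - (phi 2 h - phi 2 0))%C by ring.
  eapply Rle_trans; [apply Cmod_triangle|]. rewrite Cmod_opp.
  rewrite phi_2_pos at 1 by exact Hh. rewrite Cmod_mult, Cmod_R, Rabs_pos_eq by lra.
  assert (h * Cmod kappa <= eps / 2); [|lra].
  apply Rle_trans with (eps / 2 / (Cmod kappa + 1) * (Cmod kappa + 1)).
  - apply Rmult_le_compat; lra.
  - apply Req_le. field. lra.
Qed.

Lemma phi_explicit j t : 0 <= t ->
  phi (S (S j)) t = (RtoC (t ^ S j / INR (fact (S j))) * kappa)%C.
Proof.
  intro Ht. induction j as [|j IH].
  - rewrite phi_2 by exact Ht. f_equal. f_equal. simpl. field.
  - assert (H := phi_rec j t). rewrite IH in H.
    assert (Hn : INR (S (S j)) <> 0) by (apply not_0_INR; lia).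
    assert (Hf : INR (fact (S j)) <> 0) by (apply INR_fact_neq_0).
    replace (phi (S (S (S j))) t) with
      (RtoC (/ INR (S (S j))) * (RtoC (INR (S (S j))) * phi (S (S (S j))) t))%C.
    + rewrite <- H, !Cmult_assoc, <- !RtoC_mult. do 2 f_equal.
      change (fact (S (S j))) with (S (S j) * fact (S j))%nat. rewrite mult_INR.
      change (t ^ S (S j)) with (t * t ^ S j). field. split; assumption.
    + rewrite Cmult_assoc, <- RtoC_mult, Rinv_l by exact Hn. ring.
Qed.

(* If [kappa] vanished, [q t = lap (1 / (z^2 (2 c - z)))] would satisfy
   [q' = 2 c q] on the positive axis while growing at most like [exp (c t)]. *)
Lemma kappa_nonzero : kappa <> 0%C.
Proof.
  intro Hk. assert (Hc0 : 0 < c) by lra.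
  (* The values of [1 / (2 c - z)] at [z = c + i s], which are conjugate to those of [1 / z]. *)
  set (w := fun s : R => (/ (c, (- s)%R))%C).
  assert (Hw0 : forall s, ((c, (- s)%R) : C) <> 0%C).
  { intros s H. injection H. lra. }
  assert (Hwmod : forall s, Cmod (w s) = Cmod (zinv s)).
  { intro s. unfold w, zinv. rewrite !Cmod_inv by (apply Hw0 || apply line_nonzero).
    f_equal. exact (Cmod_conj (c, s)). }
  assert (Hwd : forall s, deriv_at (W := CC) w s ((Ci * (w s * w s))%C : CC)).
  { intro s. apply deriv_pair; unfold w, Cinv, Ci, Re, Im; simpl; auto_derive.
    all: try (repeat split; nra).
    all: field; nra. }
  set (F := fun s => (zinv s ^ 2 * w s)%C).
  set (zF := fun s => ((c, s) * (zinv s ^ 2 * w s))%C).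
  assert (EzF : forall s, zF s = (zinv s ^ 1 * w s)%C).
  { intro s. unfold zF. simpl.
    transitivity (((c, s) * zinv s) * zinv s * w s)%C; [ring|]. rewrite zinv_mult. ring. }
  assert (HzF : summable (W := CC) zF).
  { split.
    - apply (cont_ext (W := CC) _ _ (fun s => eq_sym (EzF s))). intro s.
      exact (cont_at_scal (W := CC) _ _ s (zinv_pow_cont 1 s) (deriv_cont_at _ _ _ (Hwd s))).
    - exists 1. intro s. rewrite EzF. change (Cmod (zinv s ^ 1 * w s) <= 1 / (1 + s ^ 2)).
      rewrite Cmod_mult, Hwmod, Cmod_pow, pow_1. apply Cmod_zinv_sq. }
  assert (HF1 : dominated (W := CC) 1 F).
  { intro s. change (Cmod (zinv s ^ 2 * w s) <= 1 / (1 + s ^ 2)).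
    rewrite Cmod_mult, Hwmod, Cmod_pow.
    assert (H1 := Cmod_zinv_sq s). assert (H2 := Cmod_zinv_le_1 s).
    assert (H3 := Cmod_zinv_pos s).
    apply Rle_trans with (Cmod (zinv s) * Cmod (zinv s)); [nra|exact H1]. }
  assert (HF : summable (W := CC) F).
  { split; [|exists 1; exact HF1]. intro s.
    exact (cont_at_scal (W := CC) _ _ s (zinv_pow_cont 2 s) (deriv_cont_at _ _ _ (Hwd s))). }
  set (q := fun t => lap (W := CC) c F t : C).
  (* Since [z / (z^2 (2 c - z)) = 2 c / (z^2 (2 c - z)) - 1 / z^2], the derivative of [q] is
     [2 c q - phi 2], and [phi 2 t = t kappa] vanishes by assumption. *)
  assert (Hq : forall t, 0 <= t -> deriv_at (W := CC) q t ((RtoC (2 * c) * q t)%C : CC)).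
  { intros t Ht.
    replace (RtoC (2 * c) * q t)%C with (lap (W := CC) c zF t : C).
    - exact (lap_deriv (W := CC) c Hc0 F t HF HzF).
    - assert (S2 := zinv_pow_summable 0).
      assert (T1 := summable_lin (W := CC) (W' := CC) _
        (is_linear_scal_const (W := CC) (RtoC (2 * c))) _ HF).
      assert (T2 := summable_lin (W := CC) (W' := CC) _
        (is_linear_scal_const (W := CC) (RtoC (-1))) _ S2).
      assert (Hs := summable_plus (W := CC) _ _ T1 T2).
      transitivity (lap (W := CC) c
        (fun s => Cplus (RtoC (2 * c) * F s) (RtoC (-1) * zinv s ^ 2)) t : C).
      + symmetry. apply (lap_ext (W := CC) c _ _ t Hs). intro s.
        change (RtoC (2 * c) * F s + RtoC (-1) * zinv s ^ 2 = zF s)%C.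
        assert (E : ((c, (- s)%R) * w s = 1)%C) by (unfold w; field; apply Hw0).
        transitivity (RtoC (2 * c) * F s + RtoC (-1) * zinv s ^ 2 * ((c, (- s)%R) * w s))%C.
        * rewrite E. ring.
        * replace ((c, (- s)%R) : C) with (RtoC (2 * c) - (c, s))%C
            by (unfold RtoC, Cminus, Cplus, Copp; simpl; f_equal; ring).
          unfold F, zF. ring.
      + etransitivity; [exact (lap_plus (W := CC) c _ _ t T1 T2)|].
        etransitivity; [exact (f_equal2 (@plus CC)
          (lap_lin (W := CC) (W' := CC) _ c F t Hc0
            (is_linear_scal_const (W := CC) (RtoC (2 * c))) HF)
          (lap_lin (W := CC) (W' := CC) _ c _ t Hc0
            (is_linear_scal_const (W := CC) (RtoC (-1))) S2))|].
        change (RtoC (2 * c) * q t + RtoC (-1) * phi 2 t = RtoC (2 * c) * q t)%C.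
        rewrite phi_2, Hk by exact Ht. ring. }
  assert (Hq0 : q 0 = 0%C).
  { apply (vnorm_small (W := CC)). intros eps He. change (Cmod (q 0) <= eps).
    (* [q t = exp (2 c t) q 0] and [|q t| <= 4 exp (c t)] give [|q 0| <= 4 exp (- c t)], which is at
       most [eps] at this time because [exp (c t) >= 1 + c t]. *)
    set (t := 4 / eps / c).
    assert (Ht : 0 < t) by (apply Rdiv_lt_0_compat; [apply Rdiv_lt_0_compat|]; lra).
    set (rho := fun s => (RtoC (exp (- (2 * c) * s)) * q s)%C).
    assert (E : rho t = rho 0).
    { apply (deriv_zero_const (W := CC)); [lra|]. intros s Hs.
      assert (D1 : is_derive (fun s => exp (- (2 * c) * s)) s
        (- (2 * c) * exp (- (2 * c) * s))).
      { auto_derive; [exact I|]. ring. }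
      assert (D := deriv_scal (W := CC) _ _ s _ _ (deriv_real _ _ _ D1) (Hq s (proj1 Hs))).
      replace (@zero CC) with (Cplus (RtoC (- (2 * c) * exp (- (2 * c) * s)) * q s)
        (RtoC (exp (- (2 * c) * s)) * (RtoC (2 * c) * q s))); [exact D|].
      change (@zero CC) with (RtoC 0). rewrite RtoC_mult, RtoC_opp. ring. }
    unfold rho in E. rewrite Rmult_0_r, exp_0, Cmult_1_l in E. rewrite <- E.
    rewrite Cmod_mult, Cmod_R, Rabs_pos_eq by (apply Rlt_le, exp_pos).
    assert (HB : Cmod (q t) <= 4 * (exp (t * c) * 1))
      by exact (lap_norm (W := CC) c 1 F t (proj1 HF) HF1).
    apply Rle_trans with (exp (- (2 * c) * t) * (4 * (exp (t * c) * 1))).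
    - apply Rmult_le_compat_l; [apply Rlt_le, exp_pos|exact HB].
    - replace (- (2 * c) * t) with (- (t * c) + - (t * c)) by ring.
      rewrite exp_plus.
      replace (exp (- (t * c)) * exp (- (t * c)) * (4 * (exp (t * c) * 1)))
        with (4 * exp (- (t * c)) * (exp (- (t * c)) * exp (t * c))) by ring.
      rewrite <- exp_plus, Rplus_opp_l, exp_0, Rmult_1_r, exp_Ropp.
      assert (H1 := exp_ineq1_le (t * c)).
      assert (Htc : t * c = 4 / eps) by (unfold t; field; lra). rewrite Htc in *.
      assert (0 < 4 / eps) by (apply Rdiv_lt_0_compat; lra).
      apply Rle_trans with (4 * / (4 / eps)).
      + apply Rmult_le_compat_l; [lra|]. apply Rinv_le_contravar; lra.
      + apply Req_le. field. lra. }
  (* At [t = 0] the integrand is [(c - i s) / (c^2 + s^2)^2], with the elementary primitive [P]. The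
     windows have positive real values bounded below, which contradicts [q 0 = 0]. *)
  assert (HI : forall n, 0 < n -> int (W := CC) (fun s => scal (cexp (RtoC 0 * (c, s))) (F s)) (- n) n
    = RtoC (n / (c * (c ^ 2 + n ^ 2)) + atan (n / c) / c ^ 2)).
  { intros n Hn.
    set (P := fun s => ((s / (c * (c ^ 2 + s ^ 2)) + atan (s / c) / c ^ 2) / 2,
      / (2 * (c ^ 2 + s ^ 2))) : C).
    transitivity (P n - P (- n)%R)%C.
    - apply (int_unique (W := CC)). apply (int_deriv (W := CC)).
      + { intros s _. change (deriv_at (W := CC) P s
          ((cexp (RtoC 0 * (c, s)) * F s)%C : CC)).
        rewrite Cmult_0_l, cexp_0, Cmult_1_l.
        assert (0 < c ^ 2 + s ^ 2) by nra.
        assert (0 < c * c + s * s) by nra.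
        apply deriv_pair; unfold P, F, w, zinv, Cinv, Re, Im; simpl; auto_derive.
        all: try (repeat split; nra).
        all: field; repeat split; nra. }
      + intros s _. apply (lap_integrand_cont (W := CC)). apply HF.
    - unfold P, RtoC, Cminus, Cplus, Copp. simpl. f_equal.
      + replace (- n / c) with (- (n / c)) by (field; lra). rewrite atan_opp.
        field. split; nra.
      + field. nra. }
  assert (Ha : 0 < atan (1 / c)).
  { rewrite <- atan_0. apply atan_increasing. apply Rdiv_lt_0_compat; lra. }
  set (b := atan (1 / c) / c ^ 2).
  assert (Hb : 0 < b) by (apply Rdiv_lt_0_compat; nra).
  (* The window differs from [q 0] by at most [2 / n], so [n >= 3 / b] makes the lower bound [b]
     impossible. *)
  set (n := Rmax 1 (3 / b)).
  assert (Hn1 : 1 <= n) by apply Rmax_l. assert (Hn2 : 3 / b <= n) by apply Rmax_r.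
  assert (HW := line_window (W := CC) (exp (0 * c) * 1) _ n
    (lap_integrand_cont (W := CC) c _ 0 (proj1 HF))
    (lap_integrand_dominated (W := CC) c 1 F 0 HF1) ltac:(lra)).
  rewrite HI in HW by lra.
  change (Cmod (q 0%R - RtoC (n / (c * (c ^ 2 + n ^ 2)) + atan (n / c) / c ^ 2))%C
    <= 2 * (exp (0 * c) * 1) / n) in HW.
  rewrite Hq0, Rmult_0_l, exp_0 in HW.
  replace (0 - RtoC (n / (c * (c ^ 2 + n ^ 2)) + atan (n / c) / c ^ 2))%C
    with (- RtoC (n / (c * (c ^ 2 + n ^ 2)) + atan (n / c) / c ^ 2))%C in HW by ring.
  rewrite Cmod_opp, Cmod_R in HW.
  assert (H1 : b <= atan (n / c) / c ^ 2).
  { apply Rmult_le_compat_r; [apply Rlt_le, Rinv_0_lt_compat; nra|].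
    destruct Hn1 as [Hn1|Hn1]; [|rewrite <- Hn1; lra].
    apply Rlt_le, atan_increasing. apply Rmult_lt_compat_r; [apply Rinv_0_lt_compat|]; lra. }
  assert (H2 : 0 < n / (c * (c ^ 2 + n ^ 2))).
  { apply Rdiv_lt_0_compat; [lra|]. apply Rmult_lt_0_compat; nra. }
  rewrite Rabs_pos_eq in HW by lra.
  assert (H3 : b <= 2 / n) by (unfold Rdiv in *; lra).
  apply (Rmult_le_compat_r n) in H3; [|lra].
  replace (2 / n * n) with 2 in H3 by (field; lra).
  apply (Rmult_le_compat_l b) in Hn2; [|lra].
  replace (b * (3 / b)) with 3 in Hn2 by (field; lra). lra.
Qed.

End Kernel.

(** * Shifting the line of integration to infinity *)

Section Holomorphic.

Context {W : CompleteNormedModule C_AbsRing}.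
Implicit Types F : C -> W.

Lemma mean_value (g g' : R -> W) a b M : a <= b ->
  (forall t, a <= t <= b -> deriv_at g t (g' t)) ->
  (forall t, a <= t <= b -> cont_at g' t) ->
  (forall t, a <= t <= b -> norm (g' t) <= M) ->
  norm (minus (g b) (g a)) <= (b - a) * M.
Proof.
  intros Hab Hd Hc HM.
  assert (H : integral g' a b (minus (g b) (g a))).
  { apply int_deriv; rewrite Rmin_left, Rmax_right by exact Hab; assumption. }
  exact (norm_RInt_le_const (V := realify W) g' a b _ M Hab HM H).
Qed.

(* Complex differentiability with a remainder that is quadratic, uniformly on
   the bounded subsets of the half-plane. *)
Definition holo (a : R) F F' : Prop :=
  forall N, exists B, 0 <= B /\ forall z h : C, a < Re z -> a < Re (z + h)%C ->
    Cmod z <= N -> Cmod (z + h)%C <= N ->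
    norm (F z) <= B /\ norm (F' z) <= B /\
    norm (minus (minus (F (z + h)%C) (F z)) (scal h (F' z))) <= B * (Cmod h * Cmod h).

Lemma holo_ext a F1 F2 F' : (forall z, F1 z = F2 z) -> holo a F1 F' -> holo a F2 F'.
Proof.
  intros HE H N. destruct (H N) as [B [HB HN]]. exists B. split; [exact HB|].
  intros. rewrite <- !HE. apply HN; assumption.
Qed.

Lemma half_plane_nonzero a z : 0 <= a -> a < Re z -> z <> 0%C.
Proof. intros Ha Hz H. rewrite H in Hz. simpl in Hz. lra. Qed.

Lemma half_plane_Cmod a z : 1 <= a -> a < Re z -> 1 <= Cmod z.
Proof. intros Ha Hz. generalize (re_le_Cmod z) (Rle_abs (Re z)). lra. Qed.

Lemma half_plane_Cinv a z : 1 <= a -> a < Re z -> Cmod (/ z)%C <= 1.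
Proof.
  intros Ha Hz. rewrite Cmod_inv by (apply (half_plane_nonzero a); lra).
  rewrite <- Rinv_1. apply Rinv_le_contravar; [lra|].
  apply (half_plane_Cmod a); assumption.
Qed.

(** In the half-plane [1 / z] has modulus at most 1, so each of the three parts of the remainder is
    bounded by [B] times the square of the increment. *)
Lemma holo_div a F F' : 1 <= a -> holo a F F' ->
  holo a (fun z => scal (/ z)%C (F z))
    (fun z => minus (scal (/ z)%C (F' z)) (scal (/ z * / z)%C (F z))).
Proof.
  intros Ha H N. destruct (H N) as [B [HB HN]]. exists (3 * B). split; [lra|].
  intros z h Hz Hzh Hn Hnh. destruct (HN z h Hz Hzh Hn Hnh) as [H1 [H2 H3]].
  assert (I1 := half_plane_Cinv a z Ha Hz).
  assert (I2 := half_plane_Cinv a (z + h)%C Ha Hzh).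
  assert (P1 := Cmod_ge_0 (/ z)%C). assert (P2 := Cmod_ge_0 (/ (z + h))%C).
  assert (Z1 : z <> 0%C) by (apply (half_plane_nonzero a); lra).
  assert (Z2 : (z + h)%C <> 0%C) by (apply (half_plane_nonzero a); lra).
  assert (V1 := vnorm_ge_0 (F z)). assert (V2 := vnorm_ge_0 (F' z)).
  assert (P3 := Cmod_ge_0 h).
  split; [|split].
  - rewrite vnorm_scal. nra.
  - eapply Rle_trans; [apply vnorm_triangle_minus|].
    rewrite !vnorm_scal, Cmod_mult.
    assert (Cmod (/ z) * Cmod (/ z) <= 1) by nra. nra.
  - replace (minus _ _) with
      (plus (scal (/ (z + h))%C (minus (minus (F (z + h)%C) (F z)) (scal h (F' z))))
        (plus (scal (- (h * h * / z * / (z + h)))%C (F' z))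
          (scal (h * h * (/ z * / z) * / (z + h))%C (F z)))).
    2: { vcoefs W; field; repeat split; assumption. }
    eapply Rle_trans; [apply vnorm_triangle|].
    eapply Rle_trans; [apply Rplus_le_compat_l, vnorm_triangle|].
    rewrite !vnorm_scal, Cmod_opp, !Cmod_mult.
    set (q := Cmod h * Cmod h) in *. assert (0 <= q) by (unfold q; nra).
    assert (Q1 : Cmod (/ z) * Cmod (/ (z + h)) <= 1) by nra.
    assert (Q0 : 0 <= Cmod (/ z) * Cmod (/ (z + h))) by nra.
    assert (Q2 : Cmod (/ z) * Cmod (/ z) * Cmod (/ (z + h)) <= 1) by nra.
    assert (Q3 : 0 <= Cmod (/ z) * Cmod (/ z) * Cmod (/ (z + h))) by nra.
    assert (R1 : Cmod (/ (z + h)) * norm (minus (minus (F (z + h)%C) (F z)) (scal h (F' z)))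
      <= 1 * (B * q)).
    { apply Rmult_le_compat; [lra|apply vnorm_ge_0|lra|exact H3]. }
    assert (R2 : q * Cmod (/ z) * Cmod (/ (z + h)) * norm (F' z) <= q * 1 * B).
    { apply Rmult_le_compat; [nra|lra|rewrite Rmult_assoc; nra|exact H2]. }
    assert (R3 : q * (Cmod (/ z) * Cmod (/ z)) * Cmod (/ (z + h)) * norm (F z) <= q * 1 * B).
    { apply Rmult_le_compat; [rewrite Rmult_assoc; nra|lra|rewrite Rmult_assoc; nra|exact H1]. }
    lra.
Qed.

Lemma Cmod_pair_bound r s r0 n : Rabs (r - r0) <= 1 -> Rabs s <= n ->
  Cmod (r, s) <= Rabs r0 + 1 + n.
Proof.
  intros H1 H2. eapply Rle_trans; [apply Cmod_le_sum|]. unfold Re, Im. simpl.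
  assert (Rabs r <= Rabs r0 + 1); [|lra].
  replace r with (r0 + (r - r0)) by ring. eapply Rle_trans; [apply Rabs_triang|]. lra.
Qed.

Lemma pair_plus_real r s h : ((r, s) + RtoC h)%C = (r + h, s).
Proof. unfold RtoC, Cplus. simpl. f_equal; ring. Qed.

Lemma pair_plus_imag r s h : ((r, s) + Ci * RtoC h)%C = (r, s + h).
Proof. unfold RtoC, Ci, Cplus, Cmult. simpl. f_equal; ring. Qed.

Lemma quadratic_deriv (g : R -> W) t (l : W) B d : 0 <= B -> 0 < d ->
  (forall h, Rabs h < d ->
    norm (minus (minus (g (t + h)) (g t)) (scal (RtoC h) l)) <= B * (Rabs h * Rabs h)) ->
  deriv_at g t l.
Proof.
  intros HB Hd H eps He. exists (Rmin d (eps / (B + 1))).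
  split; [apply Rmin_glb_lt; [exact Hd|apply Rdiv_lt_0_compat; lra]|].
  intros h Hh.
  assert (H1 := Rlt_le_trans _ _ _ Hh (Rmin_l _ _)).
  assert (H2 := Rlt_le_trans _ _ _ Hh (Rmin_r _ _)).
  eapply Rle_trans; [apply H; exact H1|]. rewrite <- Rmult_assoc.
  apply Rmult_le_compat_r; [apply Rabs_pos|].
  apply Rle_trans with ((B + 1) * (eps / (B + 1))).
  - apply Rmult_le_compat; [exact HB|apply Rabs_pos|lra|lra].
  - apply Req_le. field. lra.
Qed.

Lemma holo_deriv_imag a F F' r s : holo a F F' -> a < r ->
  deriv_at (fun s => F (r, s)) s (scal Ci (F' (r, s))).
Proof.
  intros H Hr. destruct (H (Rabs r + 1 + (Rabs s + 1))) as [B [HB HN]].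
  apply quadratic_deriv with (B := B) (d := 1); [exact HB|lra|]. intros h Hh.
  destruct (HN (r, s) (Ci * RtoC h)%C) as [_ [_ H1]].
  - exact Hr.
  - rewrite pair_plus_imag. exact Hr.
  - apply Cmod_pair_bound; [rewrite Rminus_diag, Rabs_R0|]; lra.
  - rewrite pair_plus_imag. apply Cmod_pair_bound; [rewrite Rminus_diag, Rabs_R0; lra|].
    eapply Rle_trans; [apply Rabs_triang|]. lra.
  - rewrite pair_plus_imag, Cmod_mult, Cmod_Ci, Cmod_R, Rmult_1_l in H1.
    eapply Rle_trans; [|exact H1]. apply Req_le. f_equal. vring W.
Qed.

Lemma holo_deriv_real a F F' r s : holo a F F' -> a < r ->
  deriv_at (fun r => F (r, s)) r (F' (r, s)).
Proof.
  intros H Hr. destruct (H (Rabs r + 1 + Rabs s)) as [B [HB HN]].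
  apply quadratic_deriv with (B := B) (d := Rmin 1 (r - a));
    [exact HB|apply Rmin_glb_lt; lra|]. intros h Hh.
  assert (Hh1 := Rlt_le_trans _ _ _ Hh (Rmin_l _ _)).
  assert (Hh2 := Rlt_le_trans _ _ _ Hh (Rmin_r _ _)).
  apply Rabs_def2 in Hh2.
  destruct (HN (r, s) (RtoC h)%C) as [_ [_ H1]].
  - exact Hr.
  - rewrite pair_plus_real. simpl. lra.
  - apply Cmod_pair_bound; [rewrite Rminus_diag, Rabs_R0|]; lra.
  - rewrite pair_plus_real. apply Cmod_pair_bound; [rewrite Rplus_minus_l|]; lra.
  - rewrite pair_plus_real, Cmod_R in H1. exact H1.
Qed.

(** The quadratic estimate is used from [z] to [z + i h] and back. In the sum the values of [F]
    cancel and [i h (F' (z + i h) - F' z)] remains, bounded by [2 B h^2]; so [F'] is locally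
    Lipschitz along the line. *)
Lemma holo_derivative_cont a F F' r : holo a F F' -> a < r -> cont (fun s => F' (r, s)).
Proof.
  intros H Hr s eps He. destruct (H (Rabs r + 1 + (Rabs s + 1))) as [B [HB HN]].
  exists (Rmin 1 (eps / (2 * B + 1))).
  split; [apply Rmin_glb_lt; [lra|apply Rdiv_lt_0_compat; lra]|].
  intros h Hh.
  assert (Hh1 := Rlt_le_trans _ _ _ Hh (Rmin_l _ _)).
  assert (Hh2 := Rlt_le_trans _ _ _ Hh (Rmin_r _ _)).
  destruct (Req_dec h 0) as [->|Hh0].
  { rewrite Rplus_0_r. replace (minus _ _) with (@zero W) by (vring W).
    rewrite vnorm_zero. lra. }
  assert (N1 : Cmod (r, s) <= Rabs r + 1 + (Rabs s + 1)).
  { apply Cmod_pair_bound; [rewrite Rminus_diag, Rabs_R0|]; lra. }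
  assert (N2 : Cmod (r, s + h) <= Rabs r + 1 + (Rabs s + 1)).
  { apply Cmod_pair_bound; [rewrite Rminus_diag, Rabs_R0; lra|].
    eapply Rle_trans; [apply Rabs_triang|]. lra. }
  destruct (HN (r, s) (Ci * RtoC h)%C) as [_ [_ H1]];
    [exact Hr|rewrite pair_plus_imag; exact Hr|exact N1|rewrite pair_plus_imag; exact N2|].
  destruct (HN (r, s + h) (Ci * RtoC (- h))%C) as [_ [_ H2]];
    [exact Hr|rewrite pair_plus_imag; exact Hr|exact N2| |].
  { rewrite pair_plus_imag. replace (s + h + - h) with s by ring. exact N1. }
  rewrite pair_plus_imag, Cmod_mult, Cmod_Ci, Cmod_R, Rmult_1_l in H1.
  rewrite pair_plus_imag, Cmod_mult, Cmod_Ci, Cmod_R, Rmult_1_l, Rabs_Ropp in H2.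
  replace (s + h + - h) with s in H2 by ring.
  assert (Hp : 0 < Rabs h) by (apply Rabs_pos_lt; exact Hh0).
  apply Rmult_le_reg_l with (Rabs h); [exact Hp|].
  replace (Rabs h * norm (minus (F' (r, s + h)) (F' (r, s)))) with
    (norm (scal (Ci * RtoC h)%C (minus (F' (r, s + h)) (F' (r, s)))))
    by (rewrite vnorm_scal, Cmod_mult, Cmod_Ci, Cmod_R, Rmult_1_l; reflexivity).
  replace (scal (Ci * RtoC h)%C (minus (F' (r, s + h)) (F' (r, s)))) with
    (plus (minus (minus (F (r, s + h)) (F (r, s))) (scal (Ci * RtoC h)%C (F' (r, s))))
      (minus (minus (F (r, s)) (F (r, s + h))) (scal (Ci * RtoC (- h))%C (F' (r, s + h)))))
    by (rewrite RtoC_opp; vring W).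
  eapply Rle_trans; [apply vnorm_triangle|].
  apply Rle_trans with (Rabs h * (Rabs h * (2 * B + 1))); [nra|].
  apply Rmult_le_compat_l; [lra|].
  apply Rle_trans with (eps / (2 * B + 1) * (2 * B + 1)).
  - apply Rmult_le_compat_r; lra.
  - apply Req_le. field. lra.
Qed.

(** Let [G r] be the integral over the window at abscissa [r]. By the Cauchy-Riemann equation its
    derivative [G' r] involves only the two end points, where [F] is of size [n^-3]. Moving right by
    [n] therefore changes [G] little, and on the line reached the decay of [F] makes the whole
    window small. *)
Lemma holo_line_zero a c F F' M : 1 <= a -> a < c -> holo a F F' ->
  (forall z, a < Re z -> norm (F z) <= M / Cmod z ^ 3) ->
  line (fun s => F (c, s)) = zero.
Proof.
  intros Ha Hc HF HM.
  assert (HM0 : 0 <= M).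
  { specialize (HM (RtoC c) Hc). rewrite Cmod_R, Rabs_pos_eq in HM by lra.
    assert (0 < c ^ 3) by (apply pow_lt; lra).
    assert (0 <= M / c ^ 3) by (generalize (vnorm_ge_0 (F (RtoC c))); lra).
    replace M with (M / c ^ 3 * c ^ 3) by (field; lra). nra. }
  assert (Hcont : forall r, a < r -> cont (fun s => F (r, s))).
  { intros r Hr s. exact (deriv_cont_at _ _ _ (holo_deriv_imag a F F' r s HF Hr)). }
  assert (Hsq : forall r s, a < r -> 1 + s ^ 2 <= Cmod (r, s) * Cmod (r, s) /\ r <= Cmod (r, s)).
  { intros r s Hr. rewrite Cmod_line_sq. split; [nra|].
    eapply Rle_trans; [|apply re_le_Cmod]. apply Rle_abs. }
  (* Of the three factors [1 / |z|], two provide the majorant in [s] and the third provides [1 / r],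
     which makes distant lines negligible. *)
  assert (Hdom : forall r, a < r -> dominated (M / r) (fun s => F (r, s))).
  { intros r Hr s. destruct (Hsq r s Hr) as [H1 H2].
    eapply Rle_trans; [apply HM; exact Hr|].
    replace (M / r / (1 + s ^ 2)) with (M * / (r * (1 + s ^ 2))) by (field; split; nra).
    apply Rmult_le_compat_l; [exact HM0|]. apply Rinv_le_contravar; [nra|].
    simpl. rewrite Rmult_1_r. nra. }
  (* [2 M / n] from the displacement of the line and [4 M / n] from the window on the distant
     line. *)
  apply line_unique with (C := 6 * M).
  { split; [apply Hcont; exact Hc|]. exists (M / c). apply Hdom. exact Hc. }
  intros m Hm. set (n := INR m).
  assert (Hn : 1 <= n) by (apply (le_INR 1); lia).
  assert (Hedge : forall r s, a < r -> Rabs s = n -> norm (F (r, s)) <= M / n ^ 3).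
  { intros r s Hr Hs. eapply Rle_trans; [apply HM; exact Hr|].
    apply Rmult_le_compat_l; [exact HM0|]. apply Rinv_le_contravar; [apply pow_lt; lra|].
    apply pow_incr. split; [lra|]. rewrite <- Hs.
    eapply Rle_trans; [|apply Rmax_Cmod]. apply Rmax_r. }
  set (G := fun r => int (fun s => F (r, s)) (- n) n).
  set (G' := fun r => scal (- Ci)%C (minus (F (r, n)) (F (r, - n)))).
  (* Along a vertical line [F'] is [- Ci] times the derivative in the ordinate, so its integral
     consists of boundary values. *)
  assert (HG' : forall r, a < r -> int (fun s => F' (r, s)) (- n) n = G' r).
  { intros r Hr. assert (Hc' := holo_derivative_cont a F F' r HF Hr).
    assert (HI : scal Ci (int (fun s => F' (r, s)) (- n) n) = minus (F (r, n)) (F (r, - n))).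
    { rewrite <- (int_lin _ _ _ _ (is_linear_scal_const Ci) Hc').
      apply int_unique. apply (int_deriv (fun s => F (r, s))).
      - intros s _. apply (holo_deriv_imag a F F'); assumption.
      - intros s _. apply cont_at_lin; [apply is_linear_scal_const|apply Hc']. }
    unfold G'. rewrite <- HI. vcoefs W. transitivity (- (Ci * Ci))%C; [|ring].
    unfold Ci, RtoC, Cmult, Copp. simpl. f_equal; ring. }
  assert (HG : forall r, a < r -> deriv_at G r (G' r)).
  { intros r Hr. rewrite <- HG' by exact Hr.
    destruct (HF (Rabs r + 1 + n)) as [B [HB HN]].
    apply quadratic_deriv with (B := 2 * n * B) (d := Rmin 1 (r - a));
      [nra|apply Rmin_glb_lt; lra|]. intros h Hh.
    assert (Hh1 := Rlt_le_trans _ _ _ Hh (Rmin_l _ _)).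
    assert (Hh2 := Rlt_le_trans _ _ _ Hh (Rmin_r _ _)).
    apply Rabs_def2 in Hh2.
    assert (C1 : cont (fun s => F (r + h, s))) by (apply Hcont; lra).
    assert (C2 : cont (fun s => scal (RtoC (-1)) (F (r, s)))).
    { intro s. apply cont_at_lin; [apply is_linear_scal_const|]. apply Hcont. exact Hr. }
    assert (C3 : cont (fun s => scal (- RtoC h)%C (F' (r, s)))).
    { intro s. apply cont_at_lin; [apply is_linear_scal_const|].
      apply (holo_derivative_cont a F F' r HF Hr). }
    assert (C12 : cont (fun s => plus (F (r + h, s)) (scal (RtoC (-1)) (F (r, s))))).
    { intro s. apply cont_at_plus; [apply C1|apply C2]. }
    replace (minus (minus (G (r + h)) (G r))
      (scal (RtoC h) (int (fun s => F' (r, s)) (- n) n))) with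
      (int (fun s => plus (plus (F (r + h, s)) (scal (RtoC (-1)) (F (r, s))))
        (scal (- RtoC h)%C (F' (r, s)))) (- n) n).
    - replace (2 * n * B * (Rabs h * Rabs h)) with ((n - - n) * (B * (Rabs h * Rabs h)))
        by ring.
      apply norm_int_le_const; [|lra|].
      + intro s. apply cont_at_plus; [apply C12|apply C3].
      + intros s Hs. assert (Hs' : Rabs s <= n) by (apply Rabs_le; exact Hs).
        destruct (HN (r, s) (RtoC h)%C) as [_ [_ H1]].
        * exact Hr.
        * rewrite pair_plus_real. simpl. lra.
        * apply Cmod_pair_bound; [rewrite Rminus_diag, Rabs_R0|]; lra.
        * rewrite pair_plus_real. apply Cmod_pair_bound; [rewrite Rplus_minus_l|]; lra.
        * rewrite pair_plus_real, Cmod_R in H1.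
          eapply Rle_trans; [|exact H1]. apply Req_le. f_equal. vring W.
    - rewrite int_plus by assumption. rewrite int_plus by assumption.
      rewrite (int_lin _ (fun s => F (r, s)) _ _ (is_linear_scal_const (RtoC (-1))))
        by (apply Hcont; exact Hr).
      rewrite (int_lin _ (fun s => F' (r, s)) _ _ (is_linear_scal_const (- RtoC h)%C))
        by (apply (holo_derivative_cont a F F' r HF Hr)).
      unfold G. vring W. }
  assert (HV : norm (minus (G (c + n)) (G c)) <= (c + n - c) * (2 * M / n ^ 3)).
  { apply mean_value with (g' := G'); [lra| | |].
    - intros r Hr. apply HG. lra.
    - intros r Hr. apply (cont_at_lin _ (is_linear_scal_const (- Ci)%C)
        (fun r => minus (F (r, n)) (F (r, - n)))).
      apply (cont_at_plus (fun r => F (r, n)) (fun r => opp (F (r, - n)))).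
      + apply deriv_cont_at with (l := F' (r, n)). apply (holo_deriv_real a); [exact HF|lra].
      + apply (cont_at_opp (fun r => F (r, - n))).
        apply deriv_cont_at with (l := F' (r, - n)). apply (holo_deriv_real a); [exact HF|lra].
    - intros r Hr. unfold G'. rewrite vnorm_scal, Cmod_opp, Cmod_Ci, Rmult_1_l.
      eapply Rle_trans; [apply vnorm_triangle_minus|].
      assert (E1 := Hedge r n ltac:(lra) (Rabs_pos_eq n ltac:(lra))).
      assert (E2 : norm (F (r, - n)) <= M / n ^ 3).
      { apply Hedge; [lra|]. rewrite Rabs_Ropp. apply Rabs_pos_eq. lra. }
      unfold Rdiv in *. lra. }
  assert (HW : norm (G (c + n)) <= 4 * (M / (c + n))).
  { apply int_window; [apply Hcont; lra|apply Hdom; lra|lra]. }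
  assert (K1 : (c + n - c) * (2 * M / n ^ 3) <= 2 * M / n).
  { replace ((c + n - c) * (2 * M / n ^ 3)) with (2 * M * / (n * n)) by (field; lra).
    apply Rmult_le_compat_l; [lra|]. apply Rinv_le_contravar; nra. }
  assert (K2 : M / (c + n) <= M / n).
  { apply Rmult_le_compat_l; [exact HM0|]. apply Rinv_le_contravar; lra. }
  replace (minus zero _) with (plus (minus (G (c + n)) (G c)) (opp (G (c + n))))
    by (unfold G; vring W).
  eapply Rle_trans; [apply vnorm_triangle|]. rewrite vnorm_opp. unfold Rdiv in *. lra.
Qed.

End Holomorphic.

Lemma deriv_unique {W : CompleteNormedModule C_AbsRing} (g : R -> W) t l1 l2 :
  deriv_at g t l1 -> deriv_at g t l2 -> l1 = l2.
Proof.
  intros H1 H2. apply minus_zero_eq, vnorm_small. intros eps He.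
  destruct (H1 (eps / 2)) as [d1 [Hd1 Hg1]]; [lra|].
  destruct (H2 (eps / 2)) as [d2 [Hd2 Hg2]]; [lra|].
  set (h := Rmin d1 d2 / 2).
  assert (Hm : 0 < Rmin d1 d2) by (apply Rmin_glb_lt; assumption).
  assert (Hh : Rabs h = h) by (apply Rabs_pos_eq; unfold h; lra).
  specialize (Hg1 h). specialize (Hg2 h). rewrite Hh in Hg1, Hg2.
  assert (M1 := Rmin_l d1 d2). assert (M2 := Rmin_r d1 d2).
  specialize (Hg1 ltac:(unfold h; lra)). specialize (Hg2 ltac:(unfold h; lra)).
  assert (Hp : 0 < h) by (unfold h; lra).
  apply Rmult_le_reg_l with h; [exact Hp|].
  replace (h * norm (minus l1 l2)) with (norm (scal (RtoC h) (minus l1 l2)))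
    by (rewrite vnorm_scal, Cmod_R, Hh; reflexivity).
  replace (scal (RtoC h) (minus l1 l2)) with
    (minus (minus (minus (g (t + h)) (g t)) (scal (RtoC h) l2))
      (minus (minus (g (t + h)) (g t)) (scal (RtoC h) l1))) by (vring W).
  eapply Rle_trans; [apply vnorm_triangle_minus|]. lra.
Qed.

Lemma is_linear_iter {W : CompleteNormedModule C_AbsRing} (T : W -> W) n :
  is_linear T -> is_linear (fun x => Nat.iter n T x).
Proof.
  intro HT. induction n as [|n IH]; simpl.
  - apply is_linear_id.
  - apply (is_linear_comp (fun x => Nat.iter n T x) T); assumption.
Qed.

Lemma is_linear_minus {W W' : CompleteNormedModule C_AbsRing} (T1 T2 : W -> W') :
  is_linear T1 -> is_linear T2 -> is_linear (fun x => minus (T1 x) (T2 x)).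
Proof.
  intros H1 H2. split.
  - intros x y. rewrite (lin_plus T1 H1), (lin_plus T2 H2). vring W'.
  - intros k x. etransitivity;
      [exact (f_equal2 (@minus W') (lin_scal T1 H1 k x) (lin_scal T2 H2 k x))|]. vring W'.
  - destruct (lin_bound T1 H1) as [M1 [HM1 HT1]]. destruct (lin_bound T2 H2) as [M2 [HM2 HT2]].
    exists (M1 + M2). split; [lra|]. intro x.
    eapply Rle_trans; [apply vnorm_triangle_minus|].
    rewrite Rmult_plus_distr_r. apply Rplus_le_compat; [apply HT1|apply HT2].
Qed.

(** * Solutions of [R u' = - u] for a resolvent family of polynomial growth *)

Section ResolventFamily.

Context {W : CompleteNormedModule C_AbsRing}.
Variables (T : W -> W) (S : C -> W -> W) (a K : R) (p : nat).
Hypothesis a_ge_1 : 1 <= a.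
Hypothesis K_ge_0 : 0 <= K.
Hypothesis T_lin : is_linear T.
Hypothesis S_lin : forall z, a < Re z -> is_linear (S z).
Hypothesis S_bound : forall z w, a < Re z ->
  norm (S z w) <= K * (Cmod z ^ p / Cmod z) * norm w.
Hypothesis T_S : forall z w, a < Re z -> scal z (T (S z w)) = minus (T w) (S z w).
Hypothesis S_T : forall z w, a < Re z -> S z (T w) = T (S z w).

(** The product [S z (S z' w)] is expressed by [T_S] at [z] and by [T_S] at [z'], the latter carried
    through [S z] by [S_T]. Multiplied by [z'] and by [z] and subtracted, the two expressions lose
    their common term [T (S z (S z' w))]. *)
Lemma resolvent_eq z z' w : a < Re z -> a < Re z' ->
  scal (z' - z)%C (S z (S z' w)) = minus (S z w) (S z' w).
Proof.
  intros Hz Hz'.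
  assert (E1 := T_S z (S z' w) Hz). assert (E2 := T_S z' w Hz').
  assert (E3 := T_S z w Hz).
  assert (E4 : scal z' (T (S z (S z' w))) = minus (T (S z w)) (S z (S z' w))).
  { rewrite <- (S_T z _ Hz), <- (lin_scal _ (S_lin z Hz)), E2.
    rewrite (lin_minus _ (S_lin z Hz)), (S_T z w Hz). reflexivity. }
  assert (F1 : S z (S z' w) = minus (T (S z' w)) (scal z (T (S z (S z' w)))))
    by (rewrite E1; vring W).
  assert (F2 : S z (S z' w) = minus (T (S z w)) (scal z' (T (S z (S z' w)))))
    by (rewrite E4; vring W).
  assert (F3 : S z w = minus (T w) (scal z (T (S z w)))) by (rewrite E3; vring W).
  assert (F4 : S z' w = minus (T w) (scal z' (T (S z' w)))) by (rewrite E2; vring W).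
  rewrite F3 at 1. rewrite F4 at 2.
  transitivity (minus (scal z' (S z (S z' w))) (scal z (S z (S z' w)))); [vring W|].
  transitivity (minus (scal z' (minus (T (S z' w)) (scal z (T (S z (S z' w))))))
    (scal z (minus (T (S z w)) (scal z' (T (S z (S z' w))))))).
  - f_equal; f_equal; assumption.
  - vring W.
Qed.

(** Two uses of the resolvent equation give the exact remainder [h^2 S (z + h) (S z (S z w))], and
    each factor is bounded by [B] where [Cmod z <= N]. *)
Lemma S_holo w : holo a (fun z => S z w) (fun z => opp (S z (S z w))).
Proof.
  intro N. set (N' := Rmax 1 N).
  assert (HN' : 1 <= N') by apply Rmax_l.
  set (B := K * N' ^ p).
  assert (Hp : 0 < N' ^ p) by (apply pow_lt; lra).
  assert (HB : 0 <= B) by (apply Rmult_le_pos; lra).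
  assert (HS : forall z x, a < Re z -> Cmod z <= N -> norm (S z x) <= B * norm x).
  { intros z x Hz Hn. eapply Rle_trans; [apply S_bound; exact Hz|].
    apply Rmult_le_compat_r; [apply vnorm_ge_0|]. apply Rmult_le_compat_l; [exact K_ge_0|].
    assert (H1 := half_plane_Cmod a z a_ge_1 Hz).
    assert (H2 : Cmod z ^ p <= N' ^ p).
    { apply pow_incr. split; [lra|]. eapply Rle_trans; [exact Hn|apply Rmax_r]. }
    assert (H3 : 0 <= Cmod z ^ p) by (apply pow_le; lra).
    assert (H4 : / Cmod z <= 1) by (rewrite <- Rinv_1; apply Rinv_le_contravar; lra).
    assert (H5 : 0 < / Cmod z) by (apply Rinv_0_lt_compat; lra).
    unfold Rdiv. nra. }
  assert (Hw := vnorm_ge_0 w).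
  (* One summand each for the value, the derivative and the remainder. *)
  exists (B * norm w + B * (B * norm w) + B * (B * (B * norm w))).
  assert (B1 : 0 <= B * norm w) by nra. assert (B2 : 0 <= B * (B * norm w)) by nra.
  assert (B3 : 0 <= B * (B * (B * norm w))) by nra.
  split; [lra|].
  intros z h Hz Hzh Hn Hnh.
  assert (E1 := HS z w Hz Hn). assert (E2 := HS z (S z w) Hz Hn).
  assert (E2' : norm (S z (S z w)) <= B * (B * norm w)) by nra.
  split; [lra|]. split; [rewrite vnorm_opp; lra|].
  assert (D : forall x, minus (S (z + h)%C x) (S z x) = scal (- h)%C (S (z + h)%C (S z x))).
  { intro x. rewrite <- (resolvent_eq (z + h) z x Hzh Hz). f_equal. ring. }
  replace (minus _ _) with (scal (h * h)%C (S (z + h)%C (S z (S z w)))).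
  - rewrite vnorm_scal, Cmod_mult.
    assert (E3 := HS (z + h)%C (S z (S z w)) Hzh Hnh).
    assert (E3' : norm (S (z + h)%C (S z (S z w))) <= B * (B * (B * norm w))) by nra.
    rewrite Rmult_comm. apply Rmult_le_compat_r; [|lra].
    generalize (Cmod_ge_0 h). nra.
  - rewrite D.
    transitivity (scal (- h)%C (minus (S (z + h)%C (S z w)) (S z (S z w)))).
    + rewrite D. vring W.
    + vring W.
Qed.

Lemma S_div_holo w j : exists F', holo a (fun z => scal ((/ z) ^ j)%C (S z w)) F'.
Proof.
  induction j as [|j [F' IH]].
  - eexists. apply (holo_ext a (fun z => S z w)); [|apply S_holo].
    intro z. simpl. vring W.
  - eexists. apply (holo_ext a (fun z => scal (/ z)%C (scal ((/ z) ^ j)%C (S z w)))).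
    + intro z. simpl. vring W.
    + apply (holo_div a _ F' a_ge_1 IH).
Qed.

(** * Inverse transforms of the operator family *)

Let c := a + 1.

Lemma c_ge_1 : 1 <= c.
Proof. unfold c. lra. Qed.

Lemma c_pos : 0 < c.
Proof. unfold c. lra. Qed.

Lemma line_half_plane s : a < Re (c, s).
Proof. simpl. unfold c. lra. Qed.

Definition transform (j : nat) (w : W) (s : R) : W := scal (zinv c s ^ j)%C (S (c, s) w).

Lemma transform_cont j w : cont (transform j w).
Proof.
  destruct (S_div_holo w j) as [F' HF]. intro s.
  exact (deriv_cont_at _ _ _
    (holo_deriv_imag a _ F' c s HF (line_half_plane s))).
Qed.

(** The exponents add up to [(p - 1) - (p + 2) = -3], the decay that [holo_line_zero] asks for. *)
Lemma S_div_norm w z : a < Re z ->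
  norm (scal ((/ z) ^ (2 + p))%C (S z w)) <= K * norm w / Cmod z ^ 3.
Proof.
  intro Hz. assert (H1 := half_plane_Cmod a z a_ge_1 Hz).
  rewrite vnorm_scal, Cmod_pow, Cmod_inv by (apply (half_plane_nonzero a); lra).
  assert (Hp : 0 < Cmod z ^ p) by (apply pow_lt; lra).
  apply Rle_trans with ((/ Cmod z) ^ (2 + p) * (K * (Cmod z ^ p / Cmod z) * norm w)).
  - apply Rmult_le_compat_l; [|apply S_bound; exact Hz].
    apply pow_le, Rlt_le, Rinv_0_lt_compat. lra.
  - apply Req_le. rewrite pow_add, (pow_inv _ p). simpl. field. split; lra.
Qed.

(** At [j = 1 + p] the decay is [|z|^(p - 1) / |z|^(1 + p) = |z|^-2], just enough for the majorant.
    Differentiation in time costs one power of [z], hence the power [2 + p] for the function and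
    [1 + p] for its derivative. *)
Lemma transform_dominated j w : (1 + p <= j)%nat -> dominated (K * norm w) (transform j w).
Proof.
  intros Hj s. unfold transform. rewrite vnorm_scal.
  set (r := Cmod (zinv c s)). set (q := Cmod (c, s)).
  assert (Hq : q * r = 1) by exact (Cmod_zinv c c_ge_1 s).
  assert (Hr0 : 0 < r) by exact (Cmod_zinv_pos c c_ge_1 s).
  assert (Hr1 := Cmod_zinv_sq c c_ge_1 s). fold r in Hr1.
  assert (Hj' : Cmod (zinv c s ^ j) <= r ^ (1 + p)) by (apply Cmod_zinv_pow_le; [exact c_ge_1|exact Hj]).
  assert (HS := S_bound (c, s) w (line_half_plane s)). fold q in HS.
  assert (Hrp : 0 < r ^ (1 + p)) by (apply pow_lt; exact Hr0).
  apply Rle_trans with (r ^ (1 + p) * (K * (q ^ p / q) * norm w)).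
  - apply Rmult_le_compat; [apply Cmod_ge_0|apply vnorm_ge_0|exact Hj'|exact HS].
  - assert (Hrq : r = / q).
    { apply Rmult_eq_reg_l with q; [rewrite Hq; field|]; intro H0; rewrite H0 in Hq; lra. }
    assert (Hq0 : 0 < q) by (rewrite <- (Rinv_inv q), <- Hrq; apply Rinv_0_lt_compat; exact Hr0).
    replace (r ^ (1 + p) * (K * (q ^ p / q) * norm w)) with (K * norm w * (r * r)).
    + unfold Rdiv at 1. apply Rmult_le_compat_l; [|lra].
      apply Rmult_le_pos; [exact K_ge_0|apply vnorm_ge_0].
    + assert (Hqp : q ^ p <> 0) by (apply pow_nonzero; lra).
      rewrite Hrq, pow_add, (pow_inv _ p). simpl. field. split; (assumption || lra).
Qed.

Lemma transform_summable j w : (1 + p <= j)%nat -> summable (transform j w).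
Proof.
  intro Hj. split; [apply transform_cont|].
  exists (K * norm w). apply transform_dominated. exact Hj.
Qed.

Lemma lap_transform_lin (j : nat) t : (1 + p <= j)%nat ->
  is_linear (fun w => lap c (transform j w) t).
Proof.
  intro Hj. split.
  - intros x y. etransitivity; [|apply lap_plus; apply transform_summable; exact Hj].
    apply lap_ext; [apply transform_summable; exact Hj|].
    intro s. unfold transform. rewrite (lin_plus _ (S_lin _ (line_half_plane s))). vring W.
  - intros k x.
    etransitivity; [|exact (lap_lin _ c _ t c_pos (is_linear_scal_const (k : C))
      (transform_summable j x Hj))].
    apply lap_ext; [apply transform_summable; exact Hj|].
    intro s. unfold transform.
    etransitivity; [apply f_equal; exact (lin_scal _ (S_lin _ (line_half_plane s)) k x)|].
    vring W.
  (* [is_linear] asks for a positive bound, and [K] may be 0. *)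
  - exists (4 * exp (t * c) * K + 1). assert (He := exp_pos (t * c)). split; [nra|].
    intro w. eapply Rle_trans.
    + apply (lap_norm c); [apply transform_cont|apply transform_dominated; exact Hj].
    + generalize (vnorm_ge_0 w). intro. change (norm w) with (@norm C_AbsRing W w). nra.
Qed.

Lemma lap_transform_comm j w t : (1 + p <= j)%nat ->
  lap c (transform j (T w)) t = T (lap c (transform j w) t).
Proof.
  intro Hj. rewrite <- (lap_lin T c _ t c_pos T_lin (transform_summable j w Hj)).
  apply lap_ext; [apply transform_summable; exact Hj|]. intro s. unfold transform.
  rewrite (lin_scal T T_lin), (S_T _ _ (line_half_plane s)). reflexivity.
Qed.

(** This is [f], kept as an operator acting on [w]: the uniqueness argument applies it to a vector
    that varies with time. *)
Definition lap_part (t : R) (w : W) : W := lap c (transform (2 + p) w) t.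

Definition lap_part' (t : R) (w : W) : W := lap c (transform (1 + p) w) t.

Lemma lap_part_deriv w t : deriv_at (fun t => lap_part t w) t (lap_part' t w).
Proof.
  assert (HE : forall s, transform (1 + p) w s = scal ((c, s) : C) (transform (2 + p) w s)).
  { intro s. unfold transform.
    replace (zinv c s ^ (1 + p))%C with ((c, s) * zinv c s ^ (2 + p))%C; [vring W|].
    change (zinv c s ^ (2 + p))%C with (zinv c s * zinv c s ^ (1 + p))%C.
    rewrite Cmult_assoc, (zinv_mult c c_ge_1). ring. }
  assert (H2 : (1 + p <= 2 + p)%nat) by lia.
  unfold lap_part, lap_part'. rewrite (lap_ext c _ _ t (transform_summable (1 + p) w (Nat.le_refl _)) HE).
  refine (lap_deriv c c_pos (transform (2 + p) w) t (transform_summable _ w H2) _).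
  destruct (transform_summable (1 + p) w (Nat.le_refl _)) as [H [M HM]].
  split; [exact (cont_ext _ _ HE H)|]. exists M. intro s. rewrite <- HE. apply HM.
Qed.

Lemma lap_part'_cont w : cont (fun t => lap_part' t w).
Proof. exact (lap_cont c c_pos _ (transform_summable (1 + p) w (Nat.le_refl _))). Qed.

Lemma lap_part_0 w : lap_part 0 w = zero.
Proof.
  destruct (S_div_holo w (2 + p)) as [F' HF].
  transitivity (line (fun s => scal ((/ (c, s)) ^ (2 + p))%C (S (c, s) w))).
  - apply line_ext.
    + apply (lap_integrand_summable c). apply transform_summable. lia.
    + intro s. rewrite Cmult_0_l, cexp_0. unfold transform, zinv. vring W.
  - apply (holo_line_zero a c (fun z => scal ((/ z) ^ (2 + p))%C (S z w)) F' (K * norm w)).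
    + exact a_ge_1.
    + unfold c. lra.
    + exact HF.
    + intros z Hz. apply S_div_norm. exact Hz.
Qed.

(** Under the integral, [z T (S z w) + S z w = T w] by [T_S], so only the scalar transform of
    [z^-(2 + p)] is left in front of [T w]. *)
Lemma lap_part_eq w t : plus (T (lap_part' t w)) (lap_part t w) = scal (phi c (2 + p) t) (T w).
Proof.
  assert (H1 := transform_summable (1 + p) w (Nat.le_refl _)).
  assert (H2 : summable (transform (2 + p) w)) by (apply transform_summable; lia).
  unfold lap_part, lap_part'. rewrite <- (lap_lin T c _ t c_pos T_lin H1).
  assert (H3 := summable_lin T T_lin _ H1).
  rewrite <- lap_plus by assumption.
  etransitivity; [|exact (lap_lin (W := CC) (fun z : C => scal z (T w)) c _ t c_pos
    (is_linear_scal_atom (T w)) (zinv_pow_summable c c_ge_1 p))].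
  apply lap_ext; [apply summable_plus; assumption|].
  intro s. unfold transform. rewrite (lin_scal T T_lin).
  assert (E := T_S (c, s) w (line_half_plane s)).
  assert (E' : S (c, s) w = minus (T w) (scal ((c, s) : C) (T (S (c, s) w))))
    by (rewrite E; vring W).
  rewrite E' at 2.
  change (zinv c s ^ (2 + p))%C with (zinv c s * zinv c s ^ (1 + p))%C.
  (* Inserting [z * zinv = 1] brings the term of [lap_part'] to the common power [2 + p]. *)
  replace (zinv c s ^ (1 + p))%C with ((c, s) * zinv c s * zinv c s ^ (1 + p))%C at 1
    by (rewrite (zinv_mult c c_ge_1); ring).
  change (zinv c s ^ (Datatypes.S (Datatypes.S p)))%C
    with (zinv c s * zinv c s ^ (1 + p))%C.
  vring W.
Qed.

(* [poly_part j] solves [T (poly_part j)' + poly_part j = t^j / j! T]. *)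
Fixpoint poly_part (j : nat) (t : R) (w : W) : W :=
  match j with
  | O => T w
  | Datatypes.S i => minus (scal (RtoC (t ^ j / INR (fact j))) (T w)) (T (poly_part i t w))
  end.

Fixpoint poly_part' (j : nat) (t : R) (w : W) : W :=
  match j with
  | O => zero
  | Datatypes.S i => minus (scal (RtoC (t ^ i / INR (fact i))) (T w)) (T (poly_part' i t w))
  end.

Lemma monomial_deriv i t :
  is_derive (fun t => t ^ Datatypes.S i / INR (fact (Datatypes.S i))) t (t ^ i / INR (fact i)).
Proof.
  assert (Hf := INR_fact_neq_0 i). assert (Hi : INR (Datatypes.S i) <> 0) by (apply not_0_INR; lia).
  auto_derive; [exact I|].
  change (fact i + i * fact i)%nat with (Datatypes.S i * fact i)%nat.
  rewrite mult_INR. change (pred (Datatypes.S i)) with i.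
  change (match i with O => 1 | Datatypes.S _ => INR i + 1 end) with (INR (Datatypes.S i)).
  field. split; assumption.
Qed.

Lemma poly_part_deriv j w t : deriv_at (fun t => poly_part j t w) t (poly_part' j t w).
Proof.
  induction j as [|i IH].
  - exact (deriv_const (T w) t).
  - apply (deriv_plus
      (fun t => scal (RtoC (t ^ Datatypes.S i / INR (fact (Datatypes.S i)))) (T w))
      (fun t => opp (T (poly_part i t w)))).
    + exact (deriv_lin _ (is_linear_scal_atom (T w)) _ t _ (deriv_real _ _ _ (monomial_deriv i t))).
    + apply deriv_opp. exact (deriv_lin T T_lin _ t _ IH).
Qed.

Lemma poly_part'_cont j w : cont (fun t => poly_part' j t w).
Proof.
  induction j as [|i IH].
  - exact (cont_const zero).
  - intro t. apply (cont_at_plus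
      (fun t => scal (RtoC (t ^ i / INR (fact i))) (T w)) (fun t => opp (T (poly_part' i t w)))).
    + apply (cont_at_lin _ (is_linear_scal_atom (T w)) (fun t => RtoC (t ^ i / INR (fact i)))).
      assert (D : is_derive (fun t => t ^ i / INR (fact i)) t
        (INR i * t ^ pred i / INR (fact i))).
      { auto_derive; [exact I|]. field. apply INR_fact_neq_0. }
      exact (deriv_cont_at _ _ _ (deriv_real _ _ _ D)).
    + apply (cont_at_opp (fun t => T (poly_part' i t w))).
      exact (cont_at_lin T T_lin _ t (IH t)).
Qed.

(** Apart from the top monomial, the terms at [i + 1] are [T] applied to the equation at [i], and
    cancel. *)
Lemma poly_part_eq j w t :
  plus (T (poly_part' j t w)) (poly_part j t w) = scal (RtoC (t ^ j / INR (fact j))) (T w).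
Proof.
  induction j as [|i IH].
  - simpl. rewrite (lin_zero T T_lin). replace (1 / 1) with 1 by field. vring W.
  - change (poly_part' (Datatypes.S i) t w) with
      (minus (scal (RtoC (t ^ i / INR (fact i))) (T w)) (T (poly_part' i t w))).
    change (poly_part (Datatypes.S i) t w) with
      (minus (scal (RtoC (t ^ Datatypes.S i / INR (fact (Datatypes.S i)))) (T w))
        (T (poly_part i t w))).
    rewrite <- IH. rewrite !(lin_minus T T_lin), !(lin_plus T T_lin). vring W.
Qed.

(** Every recursion step contributes a factor [- T] to the constant term, and the starting value is
    already [T w]; so [j = 1 + p] produces the power [2 + p]. *)
Lemma poly_part_0 j w : poly_part j 0 w = scal (RtoC ((-1) ^ j)) (Nat.iter (1 + j) T w).
Proof.
  induction j as [|i IH].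
  - simpl. vring W.
  - change (poly_part (Datatypes.S i) 0 w) with
      (minus (scal (RtoC (0 ^ Datatypes.S i / INR (fact (Datatypes.S i)))) (T w))
        (T (poly_part i 0 w))).
    rewrite IH, (lin_scal T T_lin), pow_i by lia.
    change (Nat.iter (1 + Datatypes.S i) T w) with (T (Nat.iter (1 + i) T w)).
    unfold Rdiv. rewrite Rmult_0_l.
    change ((-1) ^ Datatypes.S i) with (-1 * (-1) ^ i). rewrite RtoC_mult. vring W.
Qed.

Lemma poly_part_lin j t : is_linear (poly_part j t).
Proof.
  induction j as [|i IH]; [exact T_lin|].
  apply (is_linear_minus
    (fun w => scal (RtoC (t ^ Datatypes.S i / INR (fact (Datatypes.S i)))) (T w))
    (fun w => T (poly_part i t w))).
  - apply (is_linear_comp T (fun x : W => scal _ x)); [exact T_lin|apply is_linear_scal_const].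
  - apply (is_linear_comp (poly_part i t) T); assumption.
Qed.

Lemma poly_part_bound j r : 0 <= r ->
  exists B, 0 <= B /\ forall t w, Rabs t <= r -> norm (poly_part j t w) <= B * norm w.
Proof.
  intro Hr. destruct (lin_bound T T_lin) as [M [HM HT]].
  induction j as [|i [B [HB IH]]].
  - exists M. split; [lra|]. intros t w _. apply HT.
  - set (q := r ^ Datatypes.S i / INR (fact (Datatypes.S i))).
    assert (Hf := INR_fact_lt_0 (Datatypes.S i)).
    assert (Hq : 0 <= q).
    { apply Rmult_le_pos; [apply pow_le; exact Hr|]. apply Rlt_le, Rinv_0_lt_compat, Hf. }
    exists (q * M + M * B). split; [nra|]. intros t w Ht.
    change (poly_part (Datatypes.S i) t w) with
      (minus (scal (RtoC (t ^ Datatypes.S i / INR (fact (Datatypes.S i)))) (T w))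
        (T (poly_part i t w))).
    eapply Rle_trans; [apply vnorm_triangle_minus|]. rewrite vnorm_scal, Cmod_R.
    rewrite Rmult_plus_distr_r. apply Rplus_le_compat.
    + rewrite Rmult_assoc. apply Rmult_le_compat; [apply Rabs_pos|apply vnorm_ge_0| |apply HT].
      unfold Rdiv, q. rewrite Rabs_mult, (Rabs_pos_eq (/ _))
        by (apply Rlt_le, Rinv_0_lt_compat, Hf).
      apply Rmult_le_compat_r; [apply Rlt_le, Rinv_0_lt_compat, Hf|].
      rewrite <- RPow_abs. apply pow_incr. split; [apply Rabs_pos|exact Ht].
    + eapply Rle_trans; [apply HT|]. rewrite Rmult_assoc.
      apply Rmult_le_compat_l; [lra|]. apply IH. exact Ht.
Qed.

Lemma poly_part'_comm j t w : poly_part' j t (T w) = T (poly_part' j t w).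
Proof.
  induction j as [|i IH].
  - simpl. rewrite (lin_zero T T_lin). reflexivity.
  - change (minus (scal (RtoC (t ^ i / INR (fact i))) (T (T w))) (T (poly_part' i t (T w))) =
      T (minus (scal (RtoC (t ^ i / INR (fact i))) (T w)) (T (poly_part' i t w)))).
    rewrite (lin_minus T T_lin), (lin_scal T T_lin), IH. reflexivity.
Qed.

(* [phi c (2 + p)] is [kappa c] times [t^(1 + p) / (1 + p)!], so that the
   inhomogeneities of [lap_part] and [poly_part (1 + p)] cancel. *)
Definition sol (t : R) (w : W) : W :=
  scal (RtoC ((-1) ^ (1 + p))) (minus (poly_part (1 + p) t w) (scal (/ kappa c)%C (lap_part t w))).

Definition sol' (t : R) (w : W) : W :=
  scal (RtoC ((-1) ^ (1 + p))) (minus (poly_part' (1 + p) t w) (scal (/ kappa c)%C (lap_part' t w))).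

Lemma sol_deriv w t : deriv_at (fun t => sol t w) t (sol' t w).
Proof.
  apply (deriv_lin _ (is_linear_scal_const (RtoC ((-1) ^ (1 + p))))
    (fun t => minus (poly_part (1 + p) t w) (scal (/ kappa c)%C (lap_part t w)))).
  apply (deriv_plus (fun t => poly_part (1 + p) t w)
    (fun t => opp (scal (/ kappa c)%C (lap_part t w)))); [apply poly_part_deriv|].
  apply deriv_opp.
  exact (deriv_lin _ (is_linear_scal_const (/ kappa c)%C) _ t _ (lap_part_deriv w t)).
Qed.

Lemma sol'_cont w : cont (fun t => sol' t w).
Proof.
  intro t. apply (cont_at_lin _ (is_linear_scal_const (RtoC ((-1) ^ (1 + p))))
    (fun t => minus (poly_part' (1 + p) t w) (scal (/ kappa c)%C (lap_part' t w)))).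
  apply (cont_at_plus (fun t => poly_part' (1 + p) t w)
    (fun t => opp (scal (/ kappa c)%C (lap_part' t w)))); [apply poly_part'_cont|].
  apply (cont_at_opp (fun t => scal (/ kappa c)%C (lap_part' t w))).
  exact (cont_at_lin _ (is_linear_scal_const (/ kappa c)%C) _ t (lap_part'_cont w t)).
Qed.

Lemma sol_eq w t : 0 <= t -> T (sol' t w) = opp (sol t w).
Proof.
  intro Ht. unfold sol, sol'.
  rewrite (lin_scal T T_lin), (lin_minus T T_lin), (lin_scal T T_lin).
  assert (E1 := poly_part_eq (1 + p) w t). assert (E2 := lap_part_eq w t).
  change (phi c (2 + p) t) with (phi c (Datatypes.S (Datatypes.S p)) t) in E2.
  (* The sign of [t] enters here: the explicit form of [phi] holds on the nonnegative axis. *)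
  rewrite (phi_explicit c c_ge_1 p t Ht) in E2.
  change (Datatypes.S p) with (1 + p)%nat in E2.
  assert (E1' : T (poly_part' (1 + p) t w) = minus (scal (RtoC (t ^ (1 + p) / INR (fact (1 + p)))) (T w))
    (poly_part (1 + p) t w)) by (rewrite <- E1; vring W).
  assert (E2' : T (lap_part' t w) = minus (scal (RtoC (t ^ (1 + p) / INR (fact (1 + p))) * kappa c)%C (T w))
    (lap_part t w)) by (rewrite <- E2; vring W).
  rewrite E1', E2'. assert (Hk := kappa_nonzero c c_ge_1).
  vcoefs W; try ring. field. exact Hk.
Qed.

Lemma sol_0 w : sol 0 w = Nat.iter (2 + p) T w.
Proof.
  unfold sol. rewrite lap_part_0, poly_part_0.
  change (Nat.iter (1 + (1 + p)) T w) with (Nat.iter (2 + p) T w).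
  assert (E : (-1) ^ (1 + p) * (-1) ^ (1 + p) = 1).
  { rewrite <- Rpow_mult_distr. replace (-1 * -1) with 1 by ring. apply pow1. }
  transitivity (scal (RtoC ((-1) ^ (1 + p) * (-1) ^ (1 + p))) (Nat.iter (2 + p) T w)).
  - rewrite RtoC_mult. vring W.
  - rewrite E. vring W.
Qed.

(** With [sol_eq] this makes the time derivative of [sol (t - s) (T (u s))] vanish in the uniqueness
    argument. *)
Lemma sol'_comm w t : sol' t (T w) = T (sol' t w).
Proof.
  unfold sol'. rewrite (lin_scal T T_lin), (lin_minus T T_lin), (lin_scal T T_lin).
  rewrite poly_part'_comm.
  unfold lap_part'. rewrite lap_transform_comm by lia. reflexivity.
Qed.

Lemma sol_lin t : is_linear (sol t).
Proof.
  apply (is_linear_comp (fun w => minus (poly_part (1 + p) t w) (scal (/ kappa c)%C (lap_part t w)))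
    (fun x : W => scal (RtoC ((-1) ^ (1 + p))) x)); [|apply is_linear_scal_const].
  apply is_linear_minus; [apply poly_part_lin|].
  apply (is_linear_comp (lap_part t) (fun x : W => scal (/ kappa c)%C x));
    [|apply is_linear_scal_const].
  apply lap_transform_lin. lia.
Qed.

(** Boundedness uniform in times near [t], in the form of the hypothesis [M_bound] of the product
    rule. *)
Lemma sol_bound t : exists B, 0 < B /\
  forall s w, Rabs (s - t) < 1 -> norm (sol s w) <= B * norm w.
Proof.
  set (r := Rabs t + 1). assert (Hr : 0 <= r) by (unfold r; generalize (Rabs_pos t); lra).
  destruct (poly_part_bound (1 + p) r Hr) as [B [HB HQ]].
  assert (Hk0 := Cmod_ge_0 (/ kappa c)).
  assert (He := exp_pos (r * c)).
  set (L := Cmod (/ kappa c) * (4 * (exp (r * c) * K))).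
  assert (HL : 0 <= L) by (unfold L; apply Rmult_le_pos; nra).
  exists (B + L + 1). split; [lra|]. intros s w Hs.
  assert (Hs' : Rabs s <= r).
  { unfold r. replace s with (t + (s - t)) by ring.
    eapply Rle_trans; [apply Rabs_triang|]. lra. }
  unfold sol. rewrite vnorm_scal, Cmod_R, pow_1_abs, Rmult_1_l.
  eapply Rle_trans; [apply vnorm_triangle_minus|]. rewrite vnorm_scal.
  assert (H1 := HQ s w Hs').
  assert (H2 : norm (lap_part s w) <= 4 * (exp (s * c) * (K * norm w))).
  { assert (Hp : (1 + p <= 2 + p)%nat) by lia.
    exact (lap_norm c _ _ s (transform_cont (2 + p) w) (transform_dominated (2 + p) w Hp)). }
  assert (H3 : exp (s * c) <= exp (r * c)).
  { apply exp_monotone. apply Rmult_le_compat_r; [apply Rlt_le, c_pos|].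
    eapply Rle_trans; [apply Rle_abs|exact Hs']. }
  assert (Hw := vnorm_ge_0 w).
  assert (H4 : Cmod (/ kappa c) * norm (lap_part s w) <= L * norm w).
  { unfold L. rewrite Rmult_assoc. apply Rmult_le_compat_l; [exact Hk0|].
    eapply Rle_trans; [exact H2|]. rewrite !Rmult_assoc.
    apply Rmult_le_compat_l; [lra|]. apply Rmult_le_compat_r; [|exact H3]. nra. }
  nra.
Qed.

(** Only [T u] is known to be differentiable, so the propagator acts on [T (u s)], at the price of
    one more power of [T]. Vanishing on the negative axis makes differentiability at 0 two-sided. *)
Lemma zero_solution_unique (u : R -> W) : (forall t, t <= 0 -> u t = zero) ->
  (forall t, deriv_at (fun s => T (u s)) t (opp (u t))) -> forall t, u t = zero.
Proof.
  intros H0 Hd.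
  assert (HT : forall t, Nat.iter (2 + p) T (T (u t)) = zero).
  { intro t. assert (HTu0 : forall s, s <= 0 -> T (u s) = zero).
    { intros s Hs. rewrite H0 by exact Hs. apply (lin_zero T T_lin). }
    destruct (Rle_dec t 0) as [Ht|Ht].
    { rewrite HTu0 by exact Ht. exact (lin_zero _ (is_linear_iter T (2 + p) T_lin)). }
    rewrite <- sol_0.
    transitivity (sol (t - t) (T (u t))); [f_equal; ring|].
    transitivity (sol (t - 0) (T (u 0))).
    - apply (deriv_zero_const (fun s => sol (t - s) (T (u s)))); [lra|]. intros s Hs.
      (* The product rule yields [- sol' (t - s) (T (u s)) - sol (t - s) (u s)], where [sol' (t - s)
         (T (u s)) = T (sol' (t - s) (u s)) = - sol (t - s) (u s)]. *)
      replace (@zero W) with (plus (opp (sol' (t - s) (T (u s)))) (sol (t - s) (opp (u s)))).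
      + apply (deriv_product (fun s => sol (t - s)) (fun s => T (u s))).
        * intros. apply (lin_minus _ (sol_lin _)).
        * intros. apply (lin_scal _ (sol_lin _)).
        * destruct (sol_bound (t - s)) as [B [HB HS]]. exists B, 1.
          split; [exact HB|]. split; [lra|]. intros h x Hh. apply HS.
          replace (t - (s + h) - (t - s)) with (- h) by ring. rewrite Rabs_Ropp. exact Hh.
        * apply (deriv_comp_sub (fun r => sol r (T (u s)))). apply sol_deriv.
        * apply (cont_at_comp_sub (fun r => sol r (opp (u s)))).
          exact (deriv_cont_at _ _ _ (sol_deriv _ _)).
        * apply Hd.
      + rewrite sol'_comm, sol_eq, (lin_opp _ (sol_lin _)) by lra. vring W.
    - rewrite HTu0 by lra. apply (lin_zero _ (sol_lin _)). }
  (* Since [T u] has derivative [- u], differentiating [T^n (T u) = 0] gives [T^n u = 0], with one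
     power of [T] less. *)
  assert (HI : forall n, (forall t, Nat.iter n T (T (u t)) = zero) -> forall t, u t = zero).
  { intro n. induction n as [|n IH]; intros Hn t.
    - assert (D := deriv_ext _ (fun _ => @zero W) t _ (fun s => Hn s) (Hd t)).
      exact (opp_zero_eq _ (deriv_unique _ _ _ _ D (deriv_const zero t))).
    - apply IH. clear t. intro t.
      assert (D := deriv_lin _ (is_linear_iter T (Datatypes.S n) T_lin) _ t _ (Hd t)).
      assert (D' := deriv_ext _ (fun _ => @zero W) t _ (fun s => Hn s) D).
      assert (E := deriv_unique _ _ _ _ D' (deriv_const zero t)). cbv beta in E.
      rewrite (lin_opp _ (is_linear_iter T (Datatypes.S n) T_lin)) in E.
      rewrite Nat.iter_swap. exact (opp_zero_eq _ E). }
  exact (HI _ HT).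
Qed.

End ResolventFamily.

(** * Resolvents of the pencil *)

Section Resolvents.

Context {X Z : CompleteNormedModule C_AbsRing}.
Variables (E : X -> Z) (A : linear_operator X Z).
Hypothesis E_lin : is_linear E.

(** With [x = R2 z], the pencil at [lam] sends [x] to [z + (lam - lam') E x]; the left inverse [R1]
    is then applied. *)
Lemma resolvent_identity lam lam' R1 R2 z :
  is_resolvent E A lam R1 -> is_resolvent E A lam' R2 ->
  R2 z = plus (R1 z) (scal (lam - lam')%C (R1 (E (R2 z)))).
Proof.
  intros [L1 [_ H1]] [_ [H2 _]]. destruct (H2 z) as [Hd Hp].
  rewrite <- (lin_scal R1 L1), <- (lin_plus R1 L1), <- (H1 _ Hd) at 1. f_equal.
  rewrite <- Hp at 2. unfold pencil. vring Z.
Qed.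

Lemma operator_norm_bound (T : Z -> X) B z : is_linear T ->
  Rbar_le (operator_norm T) (Finite B) -> norm (T z) <= B * norm z.
Proof.
  intros HT HB. destruct (Req_dec (norm z) 0) as [Hz|Hz].
  { apply (vnorm_eq_0 (W := Z)) in Hz. rewrite Hz, (lin_zero T HT).
    rewrite (vnorm_zero (W := Z)), (vnorm_zero (W := X)). lra. }
  assert (Hp : 0 < norm z) by (generalize (vnorm_ge_0 z); lra).
  assert (HN : Cmod (RtoC (/ norm z)) = / norm z).
  { rewrite Cmod_R. apply Rabs_pos_eq, Rlt_le, Rinv_0_lt_compat, Hp. }
  set (v := scal (RtoC (/ norm z)) z).
  assert (Hv : Rbar_le (Finite (norm (T v))) (operator_norm T)).
  { apply (proj1 (Lub_Rbar_correct _)). exists v. split; [|reflexivity].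
    apply Req_le. etransitivity; [exact (vnorm_scal (RtoC (/ norm z)) z)|].
    rewrite HN. field. lra. }
  assert (H := Rbar_le_trans _ _ _ Hv HB). simpl in H.
  unfold v in H. rewrite (lin_scal T HT), (vnorm_scal (W := X)), HN in H.
  apply Rmult_le_reg_l with (/ norm z); [apply Rinv_0_lt_compat, Hp|].
  eapply Rle_trans; [exact H|]. apply Req_le. field. lra.
Qed.

Lemma op_minus x y : dom A x -> dom A y ->
  dom A (minus x y) /\ A (minus x y) = minus (A x) (A y).
Proof.
  intros Hx Hy.
  assert (Hy' := dom_scal _ _ A (RtoC (-1)) y Hy).
  replace (minus x y) with (plus x (scal (RtoC (-1)) y)) by (vring X).
  split; [apply dom_plus; assumption|].
  rewrite (op_plus _ _ A _ _ Hx Hy'), (op_scal _ _ A _ _ Hy). vring Z.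
Qed.

End Resolvents.

(** * Classical solutions in terms of increments *)

Lemma deriv_ext_loc {W : CompleteNormedModule C_AbsRing} (g1 g2 : R -> W) t l d : 0 < d ->
  (forall s, Rabs (s - t) < d -> g1 s = g2 s) -> deriv_at g1 t l -> deriv_at g2 t l.
Proof.
  intros Hd HE H eps He. destruct (H eps He) as [d1 [Hd1 Hg]].
  exists (Rmin d d1). split; [apply Rmin_glb_lt; assumption|]. intros h Hh.
  rewrite <- !HE.
  - apply Hg. exact (Rlt_le_trans _ _ _ Hh (Rmin_r _ _)).
  - rewrite Rminus_diag, Rabs_R0. exact Hd.
  - rewrite Rplus_minus_l. exact (Rlt_le_trans _ _ _ Hh (Rmin_l _ _)).
Qed.

Lemma right_filter_proper : ProperFilter (within (fun s : R => 0 <= s) (locally 0)).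
Proof.
  constructor.
  - intros P HP. exists 0. exact (locally_singleton _ _ HP (Rle_refl 0)).
  - apply within_filter. apply locally_filter.
Qed.

Section Classical.

Context {X Z : CompleteNormedModule C_AbsRing}.
Variables (E : X -> Z) (A : linear_operator X Z).

(** The constructed solution is continuously differentiable in [X] on the whole line, so the
    one-sided derivative at 0 is the restriction of a two-sided one. *)
Lemma classical_solution_intro (x x' : R -> X) : is_linear E ->
  (forall t, deriv_at x t (x' t)) -> cont x' ->
  (forall t, 0 <= t -> dom A (x t) /\ A (x t) = E (x' t)) ->
  is_classical_solution E A (x 0) x.
Proof.
  intros HE Hd Hc HA. split; [|split; [|split]].
  - intros t _. eapply filterlim_filter_le_1; [apply filter_le_within|].
    exact (proj1 (cont_at_continuous x t) (deriv_cont_at _ _ _ (Hd t))).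
  - intros t Ht. apply HA. exact Ht.
  - reflexivity.
  - assert (HD : forall t, is_derive (V := restrict_scalars Z) (fun s => E (x s)) t (E (x' t))).
    { intro t. apply deriv_at_is_derive. exact (deriv_lin E HE x t _ (Hd t)). }
    exists (fun t => E (x' t)). split; [|split; [|split]].
    + intros t _. apply HD.
    + intros t _. eapply filterlim_filter_le_1; [apply filter_le_within|].
      exact (proj1 (cont_at_continuous _ t) (cont_at_lin E HE x' t (Hc t))).
    + apply (@filterdiff_locally R_AbsRing R_NormedModule (restrict_scalars Z)
        (within (fun s : R => 0 <= s) (locally 0)) right_filter_proper _ 0).
      * apply filter_le_within.
      * exact (HD 0).
    + intros t Ht. symmetry. apply HA. exact Ht.
Qed.

Lemma classical_solution_elim x0 (x : R -> X) : is_classical_solution E A x0 x ->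
  x 0 = x0 /\ (forall t, 0 <= t -> dom A (x t)) /\
  (forall t, 0 < t -> deriv_at (fun s => E (x s)) t (A (x t))) /\
  (forall eps, 0 < eps -> exists del, 0 < del /\ forall h, 0 <= h < del ->
    norm (minus (minus (E (x h)) (E (x 0))) (scal (RtoC h) (A (x 0)))) <= eps * h).
Proof.
  intros [_ [Hdom [H0 [D [HD [_ [HD0 HDA]]]]]]].
  split; [exact H0|]. split; [exact Hdom|]. split.
  - intros t Ht. rewrite <- HDA by lra. apply deriv_at_is_derive. apply HD. exact Ht.
  - intros eps He. destruct HD0 as [_ HD0].
    (* The [filter_le_within] argument certifies that 0 is a limit of the one-sided filter. *)
    destruct (HD0 0 (filter_le_within (F := locally 0) (fun s : R => 0 <= s)) (mkposreal eps He)) as [del Hdel].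
    exists del. split; [apply cond_pos|]. intros h Hh.
    assert (Hb : ball 0 del h).
    { change (Rabs (h - 0) < del). rewrite Rminus_0_r, Rabs_pos_eq; lra. }
    specialize (Hdel h Hb (proj1 Hh)).
    change (norm (minus (minus (E (x h)) (E (x 0))) (scal (RtoC (h - 0)) (D 0)))
      <= eps * Rabs (h - 0)) in Hdel.
    rewrite Rminus_0_r, Rabs_pos_eq, HDA in Hdel by lra. exact Hdel.
Qed.

End Classical.

(** * Passage between the pencil and the bounded operator [T] *)

Section Pencil.

Context {X Z : CompleteNormedModule C_AbsRing}.
Variables (E : X -> Z) (A : linear_operator X Z) (mu : C) (Rmu : Z -> X).
Hypothesis E_lin : is_linear E.
Hypothesis Rmu_res : is_resolvent E A mu Rmu.

Let T (x : X) : X := Rmu (E x).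

Lemma T_linear : is_linear T.
Proof. apply (is_linear_comp E Rmu); [exact E_lin|apply Rmu_res]. Qed.

(* Multiplying by [exp (- mu t)] turns the difference of two classical
   solutions into a solution of [(T u)' = - u], extended by [0] to the left. *)
Lemma classical_solution_unique x0 x y :
  (forall u : R -> X, (forall t, t <= 0 -> u t = zero) ->
    (forall t, deriv_at (fun s => T (u s)) t (opp (u t))) -> forall t, u t = zero) ->
  is_classical_solution E A x0 x -> is_classical_solution E A x0 y ->
  forall t, 0 <= t -> y t = x t.
Proof.
  intros HU Hx Hy.
  destruct (classical_solution_elim E A x0 x Hx) as [Hx0 [Hxd [Hxt Hxr]]].
  destruct (classical_solution_elim E A x0 y Hy) as [Hy0 [Hyd [Hyt Hyr]]].
  assert (HR := proj1 Rmu_res).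
  set (d := fun t => minus (y t) (x t)).
  assert (Hd0 : d 0 = zero) by (unfold d; rewrite Hx0, Hy0; vring X).
  assert (Hdd : forall t, 0 <= t -> dom A (d t) /\ A (d t) = minus (A (y t)) (A (x t))).
  { intros t Ht. apply op_minus; [apply Hyd|apply Hxd]; exact Ht. }
  (* The left inverse turns [mu E d - A d] back into [d]; this removes [A] from the equation. *)
  assert (HdT : forall t, 0 <= t -> Rmu (A (d t)) = minus (scal mu (T (d t))) (d t)).
  { intros t Ht. destruct Rmu_res as [_ [_ Hl]].
    assert (H := Hl (d t) (proj1 (Hdd t Ht))). unfold pencil in H.
    rewrite (lin_minus Rmu HR), (lin_scal Rmu HR) in H.
    rewrite <- H at 3. unfold T. vring X. }
  set (u := fun t => if Rle_dec t 0 then @zero X else scal (cexp (RtoC t * - mu)) (d t)).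
  assert (Hu0 : forall t, t <= 0 -> u t = @zero X).
  { intros t Ht. unfold u. destruct (Rle_dec t 0); [reflexivity|lra]. }
  assert (Hu1 : forall t, 0 < t -> u t = scal (cexp (RtoC t * - mu)) (d t)).
  { intros t Ht. unfold u. destruct (Rle_dec t 0); [lra|reflexivity]. }
  assert (HT0 : T (@zero X) = @zero X) by exact (lin_zero T T_linear).
  assert (Hud : forall t, deriv_at (fun s => T (u s)) t (opp (u t))).
  { intro t. destruct (Rtotal_order t 0) as [Ht|[->|Ht]].
    - assert (H0 : opp (u t) = zero) by (rewrite Hu0 by lra; vring X). rewrite H0.
      apply (deriv_ext_loc (fun _ => zero) _ t zero (- t)); [lra| |apply deriv_const].
      intros s Hs. apply Rabs_def2 in Hs. rewrite Hu0 by lra. symmetry. exact HT0.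
    - rewrite Hu0 by lra. intros eps He.
      destruct (lin_bound Rmu HR) as [M [HM HRM]].
      set (B := exp (Rabs (Re mu))). assert (HB : 0 < B) by apply exp_pos.
      (* The estimates below multiply [2 * e * h], from the two solutions, by the bound [M] of [Rmu]
         and by the bound [B] of the exponential. *)
      set (e := eps / (2 * B * M)).
      assert (He' : 0 < e) by (apply Rdiv_lt_0_compat; [lra|]; repeat apply Rmult_lt_0_compat; lra).
      destruct (Hxr e He') as [d1 [Hd1 H1]]. destruct (Hyr e He') as [d2 [Hd2 H2]].
      exists (Rmin 1 (Rmin d1 d2)). split; [repeat apply Rmin_glb_lt; lra|]. intros h Hh.
      assert (Ha := Rlt_le_trans _ _ _ Hh (Rmin_l _ _)).
      assert (Hb := Rlt_le_trans _ _ _ Hh (Rmin_r _ _)).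
      assert (Hb1 := Rlt_le_trans _ _ _ Hb (Rmin_l _ _)).
      assert (Hb2 := Rlt_le_trans _ _ _ Hb (Rmin_r _ _)).
      rewrite Rplus_0_l, (Hu0 0), HT0 by lra.
      replace (@minus X _ _) with (T (u h)) by (vring X).
      destruct (Rle_dec h 0) as [Hh0|Hh0].
      { rewrite Hu0, HT0, vnorm_zero by exact Hh0.
        apply Rmult_le_pos; [lra|apply Rabs_pos]. }
      assert (Hpos : 0 < h) by lra. rewrite (Rabs_pos_eq h) in * by lra.
      specialize (H1 h ltac:(lra)). specialize (H2 h ltac:(lra)).
      rewrite Hu1, (lin_scal T T_linear), vnorm_scal, Cmod_cexp by exact Hpos.
      (* Both solutions start at [x0], so the values and the derivatives at 0 cancel, and the
         difference of the two remainders is left. *)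
      assert (HEd : E (d h) = minus
        (minus (minus (E (y h)) (E (y 0))) (scal (RtoC h) (A (y 0))))
        (minus (minus (E (x h)) (E (x 0))) (scal (RtoC h) (A (x 0))))).
      { unfold d. rewrite (lin_minus E E_lin), Hx0, Hy0. vring Z. }
      assert (HEn : norm (E (d h)) <= 2 * e * h).
      { rewrite HEd. eapply Rle_trans; [apply vnorm_triangle_minus|]. lra. }
      assert (HTn : norm (T (d h)) <= M * (2 * e * h)).
      { eapply Rle_trans; [apply HRM|]. apply Rmult_le_compat_l; lra. }
      assert (Hexp : exp (Re (RtoC h * - mu)%C) <= B).
      { apply exp_monotone.
        replace (Re (RtoC h * - mu)%C) with (h * - Re mu) by (unfold Re; simpl; ring).
        generalize (Rle_abs (- Re mu)) (Rabs_pos (Re mu)). rewrite Rabs_Ropp. nra. }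
      apply Rle_trans with (B * (M * (2 * e * h))).
      + apply Rmult_le_compat; [apply Rlt_le, exp_pos|apply vnorm_ge_0|exact Hexp|exact HTn].
      + apply Req_le. unfold e. field. split; lra.
    - apply (deriv_ext_loc (fun s => scal (cexp (RtoC s * - mu)) (T (d s))) _ t _ t); [lra| |].
      { intros s Hs. apply Rabs_def2 in Hs. rewrite Hu1 by lra.
        symmetry. apply (lin_scal T T_linear). }
      assert (HEd : deriv_at (fun s => E (d s)) t (A (d t))).
      { rewrite (proj2 (Hdd t (Rlt_le _ _ Ht))).
        apply (deriv_ext (fun s => plus (E (y s)) (opp (E (x s))))).
        - intro s. unfold d. rewrite (lin_minus E E_lin). reflexivity.
        - apply deriv_plus; [apply Hyt; exact Ht|]. apply deriv_opp. apply Hxt. exact Ht. }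
      assert (HTd := deriv_lin Rmu HR _ t _ HEd).
      (* The exponential contributes [- mu T d] and [HdT] gives [mu T d - d]; their sum is [- d],
         multiplied by the exponential. *)
      assert (H := deriv_scal _ _ t _ _ (deriv_cexp (- mu)%C t) HTd). cbv beta in H.
      rewrite HdT in H by lra.
      assert (H0 : opp (u t) =
        plus (scal (- mu * cexp (RtoC t * - mu))%C (T (d t)))
          (scal (cexp (RtoC t * - mu)) (minus (scal mu (T (d t))) (d t))))
        by (rewrite Hu1 by exact Ht; vring X).
      rewrite H0. exact H. }
  intros t [Ht|<-]; [|rewrite Hx0, Hy0; reflexivity].
  apply minus_zero_eq. change (d t = zero).
  transitivity (scal (cexp (RtoC t * mu)) (u t)).
  - rewrite Hu1 by exact Ht.
    transitivity (scal (cexp (RtoC t * mu) * cexp (RtoC t * - mu))%C (d t)); [|vring X].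
    rewrite <- cexp_plus. replace (RtoC t * mu + RtoC t * - mu)%C with (RtoC 0) by ring.
    rewrite cexp_0. vring X.
  - rewrite (HU u Hu0 Hud t). vring X.
Qed.

(** For [x = exp (mu t) g], the equation [T g' = - g] says [x = Rmu (mu E x - E x')]. The right
    inverse property then yields both membership in the domain and [A x = E x']. *)
Lemma classical_solution_exists (g g' : R -> X) :
  (forall t, deriv_at g t (g' t)) -> cont g' ->
  (forall t, 0 <= t -> T (g' t) = opp (g t)) ->
  is_classical_solution E A (g 0) (fun t => scal (cexp (RtoC t * mu)) (g t)).
Proof.
  intros Hd Hc Heq. assert (HR := proj1 Rmu_res).
  set (x := fun t => scal (cexp (RtoC t * mu)) (g t)).
  set (x' := fun t => scal (cexp (RtoC t * mu)) (plus (scal mu (g t)) (g' t))).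
  replace (g 0) with (x 0) by (unfold x; rewrite Cmult_0_l, cexp_0; vring X).
  apply (classical_solution_intro E A x x' E_lin).
  - intro t. assert (H := deriv_scal _ _ t _ _ (deriv_cexp mu t) (Hd t)). cbv beta in H.
    unfold x'. replace (scal _ (plus _ _)) with
      (plus (scal (mu * cexp (RtoC t * mu))%C (g t)) (scal (cexp (RtoC t * mu)) (g' t)))
      by (vring X). exact H.
  - intro t. apply (cont_at_scal (fun t => cexp (RtoC t * mu)%C)).
    + exact (deriv_cont_at _ _ _ (deriv_cexp mu t)).
    + apply (cont_at_plus (fun t => scal mu (g t)) g'); [|apply Hc].
      apply (cont_at_lin _ (is_linear_scal_const mu)). exact (deriv_cont_at _ _ _ (Hd t)).
  - intros t Ht. set (z := minus (scal mu (E (x t))) (E (x' t))).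
    assert (Hz : x t = Rmu z).
    { transitivity (minus (scal mu (T (x t))) (T (x' t))).
      - unfold x, x'. rewrite !(lin_scal T T_linear), (lin_plus T T_linear),
          (lin_scal T T_linear), Heq by exact Ht. vring X.
      - unfold z. rewrite (lin_minus Rmu HR), (lin_scal Rmu HR). reflexivity. }
    destruct (proj1 (proj2 Rmu_res) z) as [Hdom Hp].
    rewrite <- Hz in Hdom, Hp. split; [exact Hdom|].
    assert (Hp' : minus (scal mu (E (x t))) (A (x t)) = z) by exact Hp.
    transitivity (minus (scal mu (E (x t))) (minus (scal mu (E (x t))) (A (x t)))); [vring Z|].
    rewrite Hp'. unfold z. vring Z.
Qed.

(** The exponent is [-1] when [p = 0], so [Cmod lam] has to be compared with [r] from both sides:
    [2 * r] for the power [p], [r / 2] for the inverse. *)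
Lemma growth_near_infinity (p : nat) (lam : C) (r : R) : 0 < r ->
  r / 2 <= Cmod lam <= 2 * r ->
  powerRZ (Cmod lam) (Z.of_nat p - 1) <= 2 ^ p * 2 * (r ^ p / r).
Proof.
  intros Hr [H1 H2]. unfold Z.sub. rewrite powerRZ_add by lra. rewrite <- pow_powerRZ.
  change (powerRZ (Cmod lam) (- (1))) with (/ (Cmod lam ^ 1)). rewrite pow_1.
  replace (2 ^ p * 2 * (r ^ p / r)) with ((2 * r) ^ p * / (r / 2))
    by (rewrite Rpow_mult_distr; field; lra).
  apply Rmult_le_compat.
  - apply pow_le. lra.
  - apply Rlt_le, Rinv_0_lt_compat. lra.
  - apply pow_incr. lra.
  - apply Rinv_le_contravar; lra.
Qed.

(** The resolvent at [mu + z] composed with [E]. The resolvent identity with [mu], taken in one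
    order, gives the equation for [T (S z w)]; comparison with the other order gives commutation
    after division by [z]. *)
Lemma resolvent_family (p : nat) : complex_resolvent_growth E A p ->
  exists (S : C -> X -> X) (a K : R), 1 <= a /\ 0 <= K /\
    (forall z, a < Re z -> is_linear (S z)) /\
    (forall z w, a < Re z -> norm (S z w) <= K * (Cmod z ^ p / Cmod z) * norm w) /\
    (forall z w, a < Re z -> scal z (T (S z w)) = minus (T w) (S z w)) /\
    (forall z w, a < Re z -> S z (T w) = T (S z w)).
Proof.
  intros [omega [K [HK [Hres Hgr]]]].
  destruct (lin_bound E E_lin) as [M [HM HEM]].
  set (T_ := fun lam => epsilon (inhabits (fun _ : Z => @zero X)) (is_resolvent E A lam)).
  assert (HT_ : forall lam, omega < Re lam -> is_resolvent E A lam (T_ lam)).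
  { intros lam Hl. apply epsilon_spec. apply Hres. exact Hl. }
  (* The three bounds serve the estimates on [1 / z], keep [mu + z] in the half-plane of the growth
     bound, and ensure that [Cmod (mu + z)] lies between half and twice [Cmod z]. *)
  set (a := Rmax 1 (Rmax (omega - Re mu) (2 * Cmod mu))).
  assert (Ha1 : 1 <= a) by apply Rmax_l.
  assert (Ha2 : omega - Re mu <= a) by (eapply Rle_trans; [apply Rmax_l|apply Rmax_r]).
  assert (Ha3 : 2 * Cmod mu <= a) by (eapply Rle_trans; [apply Rmax_r|apply Rmax_r]).
  assert (Hom : forall z, a < Re z -> is_resolvent E A (mu + z)%C (T_ (mu + z)%C)).
  { intros z Hz. apply HT_. change (omega < Re mu + Re z). lra. }
  (* [2 ^ p * 2] is the cost of replacing [mu + z] by [z] in the growth bound, and [M] bounds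
     [E]. *)
  exists (fun z x => T_ (mu + z)%C (E x)), a, (K * (2 ^ p * 2) * M).
  assert (H2p : 0 < 2 ^ p) by (apply pow_lt; lra).
  assert (HTS : forall z w, a < Re z ->
    scal z (T (T_ (mu + z)%C (E w))) = minus (T w) (T_ (mu + z)%C (E w))).
  { intros z w Hz.
    assert (H := resolvent_identity E A mu (mu + z)%C _ _ (E w) Rmu_res (Hom z Hz)).
    rewrite H at 2. unfold T. vring X. }
  split; [exact Ha1|]. split; [repeat apply Rmult_le_pos; lra|].
  split; [|split; [|split; [exact HTS|]]].
  - intros z Hz. apply (is_linear_comp E (T_ (mu + z)%C)); [exact E_lin|apply (Hom z Hz)].
  - intros z w Hz.
    assert (Hz1 : a < Cmod z).
    { eapply Rlt_le_trans; [exact Hz|]. eapply Rle_trans; [apply Rle_abs|apply re_le_Cmod]. }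
    assert (HB : norm (T_ (mu + z)%C (E w))
      <= K * powerRZ (Cmod (mu + z)) (Z.of_nat p - 1) * norm (E w)).
    { apply operator_norm_bound; [apply (Hom z Hz)|]. apply Hgr; [|apply (Hom z Hz)].
      change (omega < Re mu + Re z). lra. }
    assert (HG : powerRZ (Cmod (mu + z)) (Z.of_nat p - 1)
      <= 2 ^ p * 2 * (Cmod z ^ p / Cmod z)).
    { apply growth_near_infinity; [lra|]. split.
      - assert (H := Cmod_triangle (mu + z) (- mu)).
        replace (mu + z + - mu)%C with z in H by ring. rewrite Cmod_opp in H. lra.
      - assert (H := Cmod_triangle mu z). lra. }
    assert (HP : 0 <= powerRZ (Cmod (mu + z)) (Z.of_nat p - 1)).
    { apply powerRZ_le. assert (H := Cmod_triangle (mu + z) (- mu)).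
      replace (mu + z + - mu)%C with z in H by ring. rewrite Cmod_opp in H. lra. }
    eapply Rle_trans; [exact HB|].
    replace (K * (2 ^ p * 2) * M * (Cmod z ^ p / Cmod z) * norm w) with
      (K * (2 ^ p * 2 * (Cmod z ^ p / Cmod z)) * (M * norm w)) by ring.
    apply Rmult_le_compat; [apply Rmult_le_pos; lra|apply (vnorm_ge_0 (E w))| |apply HEM].
    apply Rmult_le_compat_l; lra.
  - intros z w Hz.
    assert (H := resolvent_identity E A (mu + z)%C mu _ _ (E w) (Hom z Hz) Rmu_res).
    assert (Hz0 : z <> 0%C) by (apply (half_plane_nonzero a); lra).
    assert (H1 := HTS z w Hz).
    fold (T w) in H.
    assert (H2 : scal z (T_ (mu + z)%C (E (T w))) = scal z (T (T_ (mu + z)%C (E w)))).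
    { transitivity (minus (plus (T_ (mu + z)%C (E w))
        (scal (mu + z - mu)%C (T_ (mu + z)%C (E (T w))))) (T_ (mu + z)%C (E w))).
      - vring X.
      - rewrite H1. exact (f_equal (fun q => minus q _) (eq_sym H)). }
    transitivity (scal (/ z)%C (scal z (T_ (mu + z)%C (E (T w))))).
    + vcoefs X. field. exact Hz0.
    + rewrite H2. vcoefs X. field. exact Hz0.
Qed.

End Pencil.

Theorem theorem2p2 (X Z : HilbertSpace) (E : X -> Z) (A : linear_operator X Z)
    (p : nat) (mu : C) (Rmu : Z -> X) (x0 : X) :
  is_linear E ->
  closed_operator A ->
  densely_defined A ->
  is_complex_resolvent_index E A p ->
  is_resolvent E A mu Rmu ->
  (exists v : X, x0 = Nat.iter (p + 2) (fun x : X => Rmu (E x)) v) ->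
  exists x : R -> X,
    is_classical_solution E A x0 x /\
    (forall y : R -> X, is_classical_solution E A x0 y ->
      forall t : R, (0 <= t)%R -> y t = x t).
Proof.
  intros HE _ _ [Hgr _] HR [v Hv].
  destruct (resolvent_family E A mu Rmu HE HR p Hgr)
    as [S [a [K [Ha [HK [HSl [HSb [HTS HST]]]]]]]].
  set (T := fun x : X => Rmu (E x)) in *.
  assert (HT : is_linear T) by exact (T_linear E A mu Rmu HE HR).
  (* The given initial value is read as the value at time 0 of [sol] applied to the preimage [v]. *)
  rewrite Nat.add_comm, <- (sol_0 T S a K p) in Hv by assumption.
  assert (Hx : is_classical_solution E A x0
    (fun t => scal (cexp (RtoC t * mu)) (sol T S a p t v))).
  { rewrite Hv.
    refine (classical_solution_exists E A mu Rmu HE HR (fun t => sol T S a p t v)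
      (fun t => sol' T S a p t v) _ _ _).
    - intro t. apply (sol_deriv T S a K p); assumption.
    - apply (sol'_cont T S a K p); assumption.
    - intros t Ht. apply (sol_eq T S a K p); assumption. }
  eexists. split; [exact Hx|]. intros y Hy.
  apply (classical_solution_unique E A mu Rmu HE HR x0 _ y); [|exact Hx|exact Hy].
  apply (zero_solution_unique T S a K p); assumption.
Qed.
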